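(* Let $d\ge 2$ and let $X_d$ denote the set of all real sequences $(x_k)_{k\ge 1}$ of the form $$x_k=\int_{[-1,1]} d^{-1/2}(d-1)^{(1-k)/2}\,q_k\,d\eta\qquad(k\ge 1),$$ where $\eta$ is a Borel probability measure on $[-1,1]$. Then the closure, with respect to pointwise convergence, of the set of all correlation sequences of factor of i.i.d. processes on $T_d$ is equal to $X_d$.
   Context: $T_d$ is the infinite $d$-regular tree, and $T_d^*$ is $T_d$ with a distinguished root vertex $o$. Polynomials: $U_k$ is the $k$-th Chebyshev polynomial of the second kind, $U_k(\cos\vartheta)=\frac{\sin((k+1)\vartheta)}{\sin\vartheta}$ for $k\ge 0$, and $U_{-1}\equiv 0$. For $k\ge 1$, $$q_k(x)=\sqrt{\frac{d-1}{d}}\,U_k(x)-\frac{1}{\sqrt{d(d-1)}}\,U_{k-2}(x).$$ Factor of i.i.d. process: let $f:[0,1]^{V(T_d^* )}\to\mathbb{R}$ be a measurable function, square-integrable with respect to the product of Lebesgue measures, and invariant under the action of the group $\mathrm{Aut}(T_d^* )$ of root-preserving automorphisms (permuting coordinates). Put independent uniform $[0,1]$ labels $\omega$ on the vertices of $T_d$ and at each vertex $v$ let $Y_v$ be the value of $f$ when the root is placed at $v$, i.e. $Y_v=f(\omega\circ\alpha_v)$ where $\alpha_v\in\mathrm{Aut}(T_d)$ is any automorphism with $\alpha_v(o)=v$ (well defined by invariance of $f$). The process $(Y_v)_{v\in V(T_d)}$ is called a factor of i.i.d. process; its law is $\mathrm{Aut}(T_d)$-invariant. If $f$ is not almost everywhere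 constant, its correlation sequence is $(c_k)_{k\ge1}$, where $c_k=\mathrm{corr}(Y_v,Y_w)=\mathrm{cov}(Y_v,Y_w)/\mathrm{var}(Y_v)$ for any $v,w$ at distance $k$ (this depends only on $k$). *)

(* Defs.v *)
From HB Require Import structures.
From mathcomp Require Import all_boot all_order all_algebra.
From mathcomp Require Import all_classical all_reals all_analysis.
From mathcomp Require Import zify ring.

Set Implicit Arguments.
Unset Strict Implicit.
Unset Printing Implicit Defensive.

Import Order.TTheory GRing.Theory Num.Theory.
Import numFieldNormedType.Exports.

Local Open Scope classical_set_scope.
Local Open Scope ring_scope.

(* Vertices are the words over 'I_d without two equal consecutive letters, and
   each nonempty word is joined to the word obtained by deleting its first
   letter: the root [::] has d children and every other word has one parent and
   d - 1 children.  This is the Cayley graph of the free product of d copies of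
   Z/2. *)
Definition reduced (d : nat) (w : seq 'I_d) : bool :=
  sorted (fun i j => i != j) w.

Definition tree (d : nat) := {w : seq 'I_d | reduced w}.

Definition tree_root (d : nat) : tree d := exist (fun w => reduced w) [::] isT.

Definition child (d : nat) (v u : tree d) : bool :=
  (val v != [::]) && (behead (val v) == val u).

Definition tree_adj (d : nat) (u v : tree d) : bool := child u v || child v u.

Definition at_distance (d k : nat) (u v : tree d) : Prop :=
  (exists p, [/\ path (@tree_adj d) u p, last u p = v & size p = k]) /\
  (forall p, path (@tree_adj d) u p -> last u p = v -> (k <= size p)%N).

Definition tree_aut (d : nat) (a : tree d -> tree d) : Prop :=
  bijective a /\ forall u v, tree_adj (a u) (a v) = tree_adj u v.

Lemma adj_sym d : symmetric (@tree_adj d).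
Proof. by move=> u v; rewrite /tree_adj orbC. Qed.

Lemma adj_size d (u v : tree d) : tree_adj u v ->
  size (val u) = (size (val v)).+1 \/ size (val v) = (size (val u)).+1.
Proof.
rewrite /tree_adj /child; case/orP => /andP[].
  by case: (val u) => //= a w _ /eqP ->; left.
by case: (val v) => //= a w _ /eqP ->; right.
Qed.

Lemma tree_connected d (u v : tree d) :
  exists2 p, path (@tree_adj d) u p & last u p = v.
Proof.
have H (x : tree d) : exists p,
    [/\ path (@tree_adj d) x p, last x p = tree_root d,
        path (@tree_adj d) (tree_root d) (rev (belast x p)) &
        last (tree_root d) (rev (belast x p)) = x].
  case: x => w; elim: w => [|a w IH] rw.
    exists [::]; rewrite /= /tree_root; split=> //; exact: val_inj.
  have rw' : reduced w by move: rw; rewrite /reduced /= => /path_sorted.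
  have [p [p1 p2 p3 p4]] := IH rw'.
  pose y : tree d := exist _ w rw'; pose z : tree d := exist _ (a :: w) rw.
  have zy : tree_adj z y by rewrite /tree_adj /child /= eqxx.
  exists (y :: p); split=> //=; first by rewrite zy.
    rewrite rev_cons rcons_path p3 /=; move: p4; rewrite /y => ->.
    by rewrite adj_sym.
  by rewrite rev_cons last_rcons.
have [p [p1 p2 _ _]] := H u; have [q [_ _ q3 q4]] := H v.
exists (p ++ rev (belast v q)); first by rewrite cat_path p1 p2.
by rewrite last_cat p2.
Qed.

Lemma tree_acyclic d (c : seq (tree d)) :
  (2 < size c)%N -> uniq c -> ~~ cycle (@tree_adj d) c.
Proof.
move=> sc uc; apply/negP => cc.
have [x xc xmax] : exists2 x, x \in c &
    forall y, y \in c -> (size (val y) <= size (val x))%N.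
  elim: c sc {uc cc} => [//|a c IH] _.
  elim: c {IH} a => [|b c IH] a.
    by exists a; rewrite ?mem_seq1 // => y; rewrite mem_seq1 => /eqP ->.
  have [x xc xm] := IH b.
  have [le|/ltnW le] := leqP (size (val a)) (size (val x)).
    exists x; first by rewrite in_cons xc orbT.
    by move=> y; rewrite in_cons => /orP[/eqP -> //|/xm].
  exists a; first by rewrite mem_head.
  move=> y; rewrite in_cons => /orP[/eqP -> //|/xm h]; exact: leq_trans h le.
have [i s def] := rot_to xc.
have := cc; rewrite -(rot_cycle i) def.
have : uniq (x :: s) by rewrite -def rot_uniq.
have ss : (2 < size (x :: s))%N by rewrite -def size_rot.
have xm y : y \in s -> (size (val y) <= size (val x))%N.
  by move=> ys; apply: xmax; rewrite -(mem_rot i) def in_cons ys orbT.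
have par y : y \in s -> tree_adj x y -> val y = behead (val x).
  move=> /xm le axy; have [h|h] := adj_size axy; last by rewrite h ltnn in le.
  case/orP: axy => /andP[_ /eqP e]; first by rewrite e.
  move: (congr1 size e); rewrite size_behead h => e1.
  by have := leq_pred (size (val y)); rewrite e1 ltnn.
case: s ss xm par {def} => [//|y s] ss xm par.
case/lastP: s ss xm par => [//|s z] ss xm par.
rewrite /= rcons_path last_rcons => /and3P[_ yz _] /and3P[axy _ azx].
have ey := par y (mem_head _ _) axy.
have zs : z \in y :: rcons s z by rewrite in_cons mem_rcons mem_head orbT.
have ez : val z = behead (val x) by apply: par => //; rewrite adj_sym.
have : y = z by apply: val_inj; rewrite /= ey ez.
by move=> e; move: yz; rewrite e mem_rcons mem_head.
Qed.

(* Left and right multiplication by a generator in the free product. *)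
Definition lmulw d (i : 'I_d) (w : seq 'I_d) : seq 'I_d :=
  if w is a :: t then if a == i then t else i :: w else [:: i].

Fixpoint rmulw d (j : 'I_d) (w : seq 'I_d) : seq 'I_d :=
  if w is a :: t then
    if t is [::] then if a == j then [::] else [:: a; j] else a :: rmulw j t
  else [:: j].

Lemma lmulw_reduced d (i : 'I_d) w : reduced w -> reduced (lmulw i w).
Proof.
rewrite /reduced; case: w => [//|a t] /= h; case: eqVneq => [_|ai] /=.
  exact: path_sorted h.
by rewrite eq_sym ai.
Qed.

Lemma rmulw_reduced d (j : 'I_d) w : reduced w -> reduced (rmulw j w).
Proof.
rewrite /reduced; elim: w => [//|a [|b t] IH] /=.
  by case: eqVneq => //= ->.
move=> /andP[ab pt]; have := IH pt.
case: t pt {IH} => [|c t] /= _; last by rewrite ab.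
by case: eqVneq => //= _; rewrite ab.
Qed.

Lemma lrmulw d (i j : 'I_d) w : lmulw i (rmulw j w) = rmulw j (lmulw i w).
Proof.
case: w => [|a [|b t]] /=; first by rewrite eq_sym; case: eqVneq => // ->.
  have [aj|aj] := boolP (a == j); have [ai|ai] := boolP (a == i);
    rewrite /= ?(negPf ai) ?ai ?(negPf aj) ?aj //=.
  by rewrite -(eqP ai) (eqP aj).
by case: eqVneq.
Qed.

Lemma rmulwK d (j : 'I_d) w : reduced w -> rmulw j (rmulw j w) = w.
Proof.
rewrite /reduced; elim: w => [|a [|b t] IH] /=; first by rewrite eqxx.
  by case: (eqVneq a j) => [->|aj] //= _; rewrite eqxx.
move=> /andP[ab pt]; have := IH pt.
case: t pt {IH} => [|c t] /= _.
  by case: (eqVneq b j) ab => [->|bj] ab _ //=;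
    rewrite ?(negPf ab) // eqxx.
by move=> ->.
Qed.

Definition lmul d (i : 'I_d) (u : tree d) : tree d :=
  exist _ (lmulw i (val u)) (lmulw_reduced i (valP u)).

Definition rmul d (j : 'I_d) (u : tree d) : tree d :=
  exist _ (rmulw j (val u)) (rmulw_reduced j (valP u)).

Lemma adjP d (u v : tree d) : reflect (exists i, v = lmul i u) (tree_adj u v).
Proof.
apply: (iffP idP); last first.
  move=> [i ->]; rewrite /tree_adj /child /=; case: (val u) => [|a t] //=.
  by case: (eqVneq a i) => _ /=; rewrite eqxx ?orbT.
rewrite /tree_adj /child => /orP[] /andP[].
  case E : (val u) => [//|a t] _ /= /eqP e.
  by exists a; apply: val_inj; rewrite /= E /= eqxx.
case E : (val v) => [//|a t] _ /= /eqP e.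
exists a; apply: val_inj; rewrite /= E -e.
have := valP v; rewrite /reduced E; case: t {E e} => [//|b t] /= /andP[ab _].
by rewrite eq_sym (negPf ab).
Qed.

Lemma tree_regular d (u : tree d) :
  exists s, [/\ uniq s, size s = d & forall v, (v \in s) = tree_adj u v].
Proof.
exists [seq lmul i u | i <- enum 'I_d]; split.
- rewrite map_inj_uniq ?enum_uniq // => i j /(congr1 val) /=.
  case: (val u) => [|a t] /=; first by case.
  case: (eqVneq a i) => [->|_]; case: (eqVneq _ j) => [->|_] //;
    try (by case=> ->); by move=> /(congr1 size) /=; lia.
- by rewrite size_map size_enum_ord.
- move=> v; apply/mapP/adjP => [[i _ ->]|[i ->]]; first by exists i.
  by exists i; rewrite ?mem_enum.
Qed.

Lemma rmul_aut d (j : 'I_d) : tree_aut (rmul j).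
Proof.
have K : cancel (rmul j) (rmul j).
  by move=> u; apply: val_inj; rewrite /= rmulwK // (valP u).
have C i u : lmul i (rmul j u) = rmul j (lmul i u).
  by apply: val_inj; rewrite /= lrmulw.
split; first by exists (rmul j).
move=> u v; apply/adjP/adjP => -[i e]; exists i.
  by rewrite -[LHS]K e C K.
by rewrite e C.
Qed.

Lemma tree_transitive d (v : tree d) :
  exists2 a, tree_aut a & a (tree_root d) = v.
Proof.
case: v => w; elim/last_ind: w => [|w j IH] rw.
  exists id; last exact: val_inj.
  by split=> //; exists id.
have rw' : reduced w.
  by move: rw; rewrite /reduced -cats1 => /cat_sorted2[].
have [a [ba ha] ea] := IH rw'; exists (rmul j \o a).
  have [bj hj] := rmul_aut j; split; first exact: bij_comp.
  by move=> u v /=; rewrite hj ha.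
apply: val_inj; rewrite /= ea /=.
elim: w rw {rw' IH ea} => [//|b [|c w] IH] rw.
  by move: rw; rewrite /reduced /= andbT => /negPf ->.
have rw1 : reduced (rcons (c :: w) j).
  by move: rw; rewrite /reduced /= => /andP[].
by rewrite [RHS]/= -[c :: rcons w j](IH rw1).
Qed.

Definition unit_interval (R : realType) := {t : R | 0 <= t <= 1}.

Definition unit_interval0 (R : realType) : unit_interval R :=
  exist (fun t : R => 0 <= t <= 1) 0 (introT andP (conj (lexx 0) ler01)).

HB.instance Definition _ (R : realType) := Choice.on (unit_interval R).
HB.instance Definition _ (R : realType) :=
  isPointed.Build (unit_interval R) (unit_interval0 R).

(* The product sigma-algebra on [0,1]^V(T_d): generated by the sets
   {w | w(v) \in B}, for v a vertex and B a Borel subset of R. *)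
Definition cylinders (R : realType) (d : nat) :
    set (set (tree d -> unit_interval R)) :=
  [set C | exists (v : tree d) (B : set R),
    measurable B /\ C = [set w | B (val (w v))]].

Definition labelling (R : realType) (d : nat) :=
  g_sigma_algebraType (@cylinders R d).

(* Such a probability measure is unique, the finite-dimensional cylinders being
   stable under intersection and generating the sigma-algebra. *)
Definition is_lebesgue_product (R : realType) (d : nat)
    (P : probability (labelling R d) R) : Prop :=
  forall (s : seq (tree d)) (B : tree d -> set R),
    uniq s -> (forall v, measurable (B v)) ->
    P [set w | forall v, v \in s -> B v (val (w v))] =
    (\prod_(v <- s) fine (lebesgue_measure (B v `&` `[0, 1])))%:E.

Definition root_invariant (R : realType) (d : nat) (f : labelling R d -> R) :=
  forall a, tree_aut a -> a (tree_root d) = tree_root d ->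
  forall w : labelling R d, f (w \o a) = f w.

Definition is_factor_process (R : realType) (d : nat) (f : labelling R d -> R)
    (Y : tree d -> labelling R d -> R) : Prop :=
  forall (v : tree d) a, tree_aut a -> a (tree_root d) = v ->
  forall w : labelling R d, Y v w = f (w \o a).

Definition corr (R : realType) (dT : measure_display) (T : measurableType dT)
    (P : probability T R) (X Y : T -> R) : R :=
  fine (covariance P X Y) / fine 'V_P[X].

(* A sequence (x_k)_{k >= 1} is represented by x : nat -> R with x n = x_{n+1}. *)
Definition is_correlation_sequence (R : realType) (d : nat)
    (P : probability (labelling R d) R) (Y : tree d -> labelling R d -> R)
    (c : nat -> R) : Prop :=
  forall (n : nat) (u v : tree d), at_distance n.+1 u v ->
  c n = corr P (Y u) (Y v).

Definition fiid_correlations (R : realType) (d : nat) : set (nat -> R) :=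
  [set c : nat -> R | exists (P : probability (labelling R d) R) (f : labelling R d -> R)
                  (Y : tree d -> labelling R d -> R),
    [/\ is_lebesgue_product P,
        [/\ measurable_fun setT f,
            P.-integrable setT (fun w => (f w ^+ 2)%:E) & root_invariant f],
        ~ (exists r : R, {ae P, forall w, f w = r}),
        is_factor_process f Y & is_correlation_sequence P Y c]].

Fixpoint chebyshevU (R : realType) (k : nat) : {poly R} :=
  match k with
  | 0 => 1
  | k1.+1 => match k1 with
             | 0 => 2%:R *: 'X
             | k2.+1 => 2%:R *: 'X * chebyshevU R k1 - chebyshevU R k2
             end
  end.

Lemma chebyshevU_cos (R : realType) (k : nat) (t : R) :
  (chebyshevU R k).[cos t] * sin t = sin (k.+1%:R * t).
Proof.
suff: (chebyshevU R k).[cos t] * sin t = sin (k.+1%:R * t) /\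
      (chebyshevU R k.+1).[cos t] * sin t = sin (k.+2%:R * t) by case.
elim: k => [|k [IH1 IH2]].
  split; first by rewrite /= hornerC !mul1r.
  have -> : 2%:R * t = t + t by ring.
  by rewrite /= hornerZ hornerX sinD; ring.
split=> //.
have -> : (chebyshevU R k.+2).[cos t] =
    2%:R * cos t * (chebyshevU R k.+1).[cos t] - (chebyshevU R k).[cos t].
  rewrite [chebyshevU R k.+2]/=.
  by rewrite !(hornerD, hornerN, hornerM, hornerZ, hornerX).
rewrite mulrBl -[X in X - _]mulrA IH2 IH1.
have -> : k.+3%:R * t = k.+2%:R * t + t.
  by rewrite -[k.+3]addn1 natrD mulrDl mul1r.
have -> : k.+1%:R * t = k.+2%:R * t - t.
  by rewrite -[k.+2]addn1 natrD mulrDl mul1r addrK.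
by rewrite sinB sinD; ring.
Qed.

(* U_{k-2} for k >= 1, with the convention U_{-1} = 0. *)
Definition chebyshevU_sub2 (R : realType) (k : nat) : {poly R} :=
  if k is k'.+2 then chebyshevU R k' else 0.

Definition q_poly (R : realType) (d k : nat) (t : R) : R :=
  Num.sqrt ((d%:R - 1) / d%:R) * (chebyshevU R k).[t] -
  (Num.sqrt (d%:R * (d%:R - 1)))^-1 * (chebyshevU_sub2 R k).[t].

Definition X_set (R : realType) (d : nat) : set (nat -> R) :=
  [set x : nat -> R | exists eta : probability (measurableTypeR R) R,
    eta `[-1, 1]%classic = 1%E /\
    forall n : nat, let k := n.+1 in
      x n = \int[eta]_(t in `[-1, 1])
              (d%:R `^ (- (1 / 2)) * (d%:R - 1) `^ ((1 - k%:R) / 2) * q_poly d k t)].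

Arguments fiid_correlations R d : clear implicits.
Arguments X_set R d : clear implicits.

(* Main.v *)
(** Let M be the adjacency operator of the tree divided by 2 sqrt(d - 1), acting
    on square-integrable functions of the labels through the translations
    [rmul i].  For a centred f with variance 1, <f, M^k f> is a fixed linear
    combination of 1, c_1, ..., c_k; equivalently c_k = <f, p_k(M) f>, where p_k
    is the spherical polynomial, which is d^(-1/2) (d-1)^((1-k)/2) q_k.  Hence x
    belongs to X_d if and only if the moments that x prescribes are those of a
    probability measure on [-1, 1].

    The moments of a factor are positive because |<f, M f>| <= <f, f>: expanding
    f over the finite sets A of labels it depends on, M sends the block of A to
    those of its d translates, and the weights sum_(v in A) (d-1)^(-|v|/2) have
    the superharmonicity needed for Schur's test.  Positivity passes to pointwise
    limits, and it yields a representing measure by Bernstein approximation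
    (Hausdorff's moment problem).

    Conversely, the Bernstein approximations are atomic measures on ]-1, 1[.
    An atom t is realised by the radial linear factor whose coefficients are the
    spherical function of eigenvalue t truncated to a ball: M - t has a bounded
    defect on it, while its norm tends to infinity with the radius.  Different
    atoms use orthogonal functions of the same labels, so weighted sums realise
    all finite convex combinations. *)

Require Import Defs.
From HB Require Import structures.
From mathcomp Require Import all_boot all_order all_algebra finmap.
From mathcomp Require Import all_classical all_reals all_analysis measurable_realfun.
From mathcomp Require Import zify ring lra.

Import Order.TTheory GRing.Theory Num.Theory.
Import numFieldNormedType.Exports.

Set Implicit Arguments.
Unset Strict Implicit.
Unset Printing Implicit Defensive.

Local Open Scope classical_set_scope.
Local Open Scope ring_scope.

(** * Moment functional of a correlation sequence *)

(** M is built from right multiplications by the generators because these are automorphisms carrying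
    the root to its neighbours; M then acts on arbitrary functions of the labels, and it is
    symmetric since the generators are involutions. A right multiplication does not in general send
    a vertex to one of its neighbours, but the d images of a vertex have the heights of its
    neighbours, and correlations with the root see heights only.

    On constants M is multiplication by d / (2 sqrt(d - 1)), which exceeds 1 as soon as d > 2, so
    the spectral bound needs centring; in the expansion over finite sets the constants belong to the
    empty set, the only one of weight 0.

    The representing measure is the law of a limit of quantile functions along an ultrafilter, so
    that compactness of [0, 1] replaces weak compactness of measures. The converse inclusion also
    needs the labels to exist: one uniform variable is split into infinitely many independent ones
    by distributing its binary digits. *)

Section RadialOperator.
Variables (R : realType) (d : nat).
Hypothesis hd : (2 <= d)%N.

Definition kap : R := 2 * Num.sqrt (d%:R - 1).

Lemma d1_ge1 : 1 <= d%:R - 1 :> R.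
Proof. by rewrite lerBrDr (_ : 1 + 1 = 2%:R) ?ler_nat. Qed.

Lemma d1_gt0 : 0 < d%:R - 1 :> R.
Proof. exact: lt_le_trans d1_ge1. Qed.

Lemma d_gt0 : 0 < d%:R :> R.
Proof. by rewrite ltr0n; lia. Qed.

Lemma kap_gt0 : 0 < kap.
Proof. by rewrite mulr_gt0 // sqrtr_gt0 d1_gt0. Qed.

Lemma sqr_sqrtd1 : Num.sqrt (d%:R - 1) ^+ 2 = d%:R - 1 :> R.
Proof. by rewrite sqr_sqrtr // ltW // d1_gt0. Qed.

(** The radial part of M: if a function on the tree takes the value [c n] at height [n], its
    normalised sum over neighbours takes the value [tstep c n]. *)
Definition tstep (c : nat -> R) : nat -> R := fun n =>
  if n is m.+1 then ((d%:R - 1) * c m.+2 + c m) / kap else d%:R * c 1%N / kap.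

(** The value at the root of the [i]-th iterate of M on the radial function [c]. When [c] is a
    correlation sequence, it is the moment <f, M^i f> / <f, f>. *)
Definition mom (c : nat -> R) (i : nat) : R := iter i tstep c 0%N.

(* The linear functional on polynomials that maps [sph k] to [c k]. *)
Definition Lc (c : nat -> R) (p : {poly R}) : R :=
  \sum_(i < size p) p`_i * mom c i.

Lemma LcE c (p : {poly R}) n : (size p <= n)%N ->
  Lc c p = \sum_(i < n) p`_i * mom c i.
Proof.
move=> le; rewrite /Lc (big_ord_widen _ (fun i => p`_i * mom c i) le).
rewrite big_mkcond; apply: eq_bigr => i _; case: ltnP => // h.
by rewrite nth_default ?mul0r.
Qed.

Lemma LcD c p q : Lc c (p + q) = Lc c p + Lc c q.
Proof.
pose n := maxn (size p) (size q).
rewrite !(@LcE _ _ n) ?leq_maxl ?leq_maxr ?size_polyD // -big_split /=.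
by apply: eq_bigr => i _; rewrite coefD mulrDl.
Qed.

Lemma LcZ c a p : Lc c (a *: p) = a * Lc c p.
Proof.
rewrite (@LcE _ _ (size p)) ?size_scale_leq // mulr_sumr.
by apply: eq_bigr => i _; rewrite coefZ mulrA.
Qed.

Lemma LcB c p q : Lc c (p - q) = Lc c p - Lc c q.
Proof. by rewrite LcD -scaleN1r LcZ mulN1r. Qed.

Lemma Lc0 c : Lc c 0 = 0.
Proof. by rewrite /Lc size_poly0 big_ord0. Qed.

Lemma Lc_sum c I (r : seq I) (P : pred I) (F : I -> {poly R}) :
  Lc c (\sum_(i <- r | P i) F i) = \sum_(i <- r | P i) Lc c (F i).
Proof. by apply: (big_morph _ (@LcD c) (Lc0 c)). Qed.

Lemma Lc1 c : Lc c 1 = c 0%N.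
Proof. by rewrite /Lc size_poly1 big_ord1 coef1 mul1r. Qed.

(** Multiplication by X is the transpose of [tstep]; inductions on the degree therefore quantify
    over the sequence [c]. *)
Lemma LcMX c p : Lc c (p * 'X) = Lc (tstep c) p.
Proof.
rewrite (@LcE _ _ (size p).+1) ?(leq_trans (size_polyMleq _ _)) ?size_polyX ?addn2 //.
rewrite big_ord_recl /= coefMX eqxx mul0r add0r.
by apply: eq_bigr => i _; rewrite coefMX /= /mom iterSr.
Qed.

Lemma LcXn c n : Lc c 'X^n = mom c n.
Proof.
elim: n c => [|n IH] c; first by rewrite expr0 Lc1.
by rewrite exprSr LcMX IH /mom iterSr.
Qed.

(* [sph k] evaluated at [t] is the value at distance [k] of the spherical
   function of the tree with adjacency eigenvalue [kap * t]. *)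
Fixpoint sph2 (k : nat) : {poly R} * {poly R} :=
  if k is k'.+1 then
    let: (p, q) := sph2 k' in
    (q, (d%:R - 1)^-1 *: (kap *: (q * 'X) - p))
  else (1, (kap / d%:R) *: 'X).

Definition sph k := (sph2 k).1.

Lemma sph0 : sph 0 = 1. Proof. by []. Qed.
Lemma sph1 : sph 1 = (kap / d%:R) *: 'X. Proof. by []. Qed.
Lemma sphSS k : sph k.+2 = (d%:R - 1)^-1 *: (kap *: (sph k.+1 * 'X) - sph k).
Proof. by rewrite /sph /=; case: (sph2 k). Qed.

(** The recurrence of [sph] solves the definition of [tstep c k.+1] for [c k.+2], once the
    multiplication by X has been moved onto [c]. *)
Lemma Lc_sph c k : Lc c (sph k) = c k.
Proof.
have k0 := kap_gt0; have d0 := d_gt0; have d10 := d1_gt0.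
suff: forall c, Lc c (sph k) = c k /\ Lc c (sph k.+1) = c k.+1 by case/(_ c).
elim: k => [|k IH] {}c.
  rewrite sph0 sph1 Lc1 LcZ -['X]mul1r LcMX Lc1 /=; split=> //.
  by field; rewrite !gt_eqF.
split; first by have [] := IH c.
rewrite sphSS LcZ LcB LcZ LcMX; have [_ ->] := IH (tstep c).
have [-> _] := IH c; rewrite /=; by field; rewrite !gt_eqF.
Qed.

Lemma tstep_horner t : tstep (fun k => (sph k).[t]) = (fun k => t * (sph k).[t]).
Proof.
have k0 := kap_gt0; have d0 := d_gt0; have d10 := d1_gt0.
apply/funext => -[|k] /=.
  rewrite sph1 sph0 !(hornerD, hornerN, hornerM, hornerZ, hornerX) ?hornerC; by field; rewrite !gt_eqF.
rewrite sphSS !(hornerD, hornerN, hornerM, hornerZ, hornerX) ?hornerC; by field; rewrite !gt_eqF.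
Qed.

(** Real powers are expressed by the square roots [s] and [r] of d - 1 and d; both sides then obey
    the same three-term recurrence, up to the factor s^(-k). Positivity of [k] matters: at [k = 0]
    the left side is (d - 1) / d instead of 1. *)
Lemma q_poly_sph k t : (0 < k)%N ->
  d%:R `^ (- (1 / 2)) * (d%:R - 1) `^ ((1 - k%:R) / 2) * q_poly d k t =
  (sph k).[t].
Proof.
have d0 := d_gt0; have d10 := d1_gt0.
pose s := Num.sqrt (d%:R - 1) : R; pose r := Num.sqrt d%:R : R.
have s0 : 0 < s by rewrite sqrtr_gt0.
have r0 : 0 < r by rewrite sqrtr_gt0.
have s2 : s ^+ 2 = d%:R - 1 by rewrite sqr_sqrtd1.
have r2 : r ^+ 2 = d%:R by rewrite sqr_sqrtr // ltW.
have kE : kap = 2 * s by [].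
have -> : d%:R `^ (- (1 / 2)) = r^-1 :> R.
  by rewrite powRN div1r powR12_sqrt // ltW.
have H n : (d%:R - 1) `^ ((1 - n.+1%:R) / 2) = s ^- n :> R.
  have -> : (1 - n.+1%:R) / 2 = - (2^-1 * n%:R) :> R by rewrite -natr1; field.
  by rewrite powRN powRrM powR12_sqrt ?(ltW d10) // powR_mulrn // ltW.
case: k => // k _; rewrite H.
have qE n : q_poly d n.+1 t = s / r * (chebyshevU R n.+1).[t]
      - (r * s)^-1 * (chebyshevU_sub2 R n.+1).[t].
  by rewrite /q_poly sqrtrM ?(ltW d10) // sqrtrV ?(ltW d0) // sqrtrM // ltW.
rewrite qE.
suff: r^-1 * s ^- k * (s / r * (chebyshevU R k.+1).[t]
      - (r * s)^-1 * (chebyshevU_sub2 R k.+1).[t]) = (sph k.+1).[t] /\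
      r^-1 * s ^- k.+1 * (s / r * (chebyshevU R k.+2).[t]
      - (r * s)^-1 * (chebyshevU_sub2 R k.+2).[t]) = (sph k.+2).[t] by case.
have U0 : (chebyshevU R 0).[t] = 1 by rewrite hornerC.
have U1 : (chebyshevU R 1).[t] = 2 * t by rewrite hornerZ hornerX.
have UE n : (chebyshevU R n.+2).[t] = 2 * t * (chebyshevU R n.+1).[t] - (chebyshevU R n).[t].
  by rewrite [chebyshevU R n.+2]/= !(hornerD, hornerN, hornerM, hornerZ, hornerX).
have sN : s != 0 by rewrite gt_eqF.
have rN : r != 0 by rewrite gt_eqF.
have V1 : (chebyshevU_sub2 R 1).[t] = 0 by rewrite horner0.
have VE n : (chebyshevU_sub2 R n.+2).[t] = (chebyshevU R n).[t] by [].
have hE := (hornerD, hornerN, hornerM, hornerZ, hornerX).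
elim: k => [|k [IH1 IH2]].
  rewrite VE V1 UE U1 U0 sphSS sph1 sph0 !hE hornerC kE -s2 -r2.
  (* Distance 2 is the only case that uses r^2 = s^2 + 1. *)
  have s2' : r ^+ 2 = s ^+ 2 + 1 by rewrite r2 s2 subrK.
  split; first by field; rewrite ?sN ?rN.
  have -> : r^-1 * s ^- 1 * (s / r * (2 * t * (2 * t) - 1) - (r * s)^-1 * 1) =
     (4 * t ^+ 2 * s ^+2 - (s ^+ 2 + 1)) / (r ^+ 2 * s ^+ 2).
    by field; rewrite ?sN ?rN.
  by rewrite -s2'; field; rewrite ?sN ?rN.
split=> //; rewrite sphSS !hE -IH1 -IH2 -s2 kE.
case: k {IH1 IH2} => [|k]; rewrite ?VE ?V1 !UE ?U1 ?U0 ?exprS ?expr0;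
  field; by rewrite ?expf_neq0 // ?sN ?rN.
Qed.

(** Hausdorff's condition for a moment sequence on [-1, 1]. *)
Definition haus (c : nat -> R) := forall i j, 0 <= Lc c ((1 + 'X) ^+ i * (1 - 'X) ^+ j).

End RadialOperator.

Lemma cvg_sumr (R : realType) T (F : set_system T) (FF : Filter F) (I : Type)
    (r : seq I) (f : I -> T -> R) (a : I -> R) :
  (forall i, f i @ F --> a i) ->
  (fun x => \sum_(i <- r) f i x) @ F --> \sum_(i <- r) a i.
Proof.
move=> fa; elim: r => [|i r IH].
  by rewrite big_nil; under eq_fun do rewrite big_nil; exact: cvg_cst.
by rewrite big_cons; under eq_fun do rewrite big_cons; exact: cvgD.
Qed.

(** * Bernstein approximation *)

Section BernsteinIdentity.

Lemma bin_ffact_shift m n i : (i <= n)%N ->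
  ('C(m + n, m + i) * (m + i) ^_ m = (m + n) ^_ m * 'C(n, i))%N.
Proof.
move=> le_in; apply/eqP; rewrite -(eqn_pmul2r (fact_gt0 i)) -(eqn_pmul2r (fact_gt0 (n - i))).
have e1 := bin_fact le_in.
have le2 : (m + i <= m + n)%N by rewrite leq_add2l.
have e2 := bin_fact le2; rewrite subnDl in e2.
have e3 := ffact_fact (leq_addr i m); rewrite addKn in e3.
have e4 := ffact_fact (leq_addr n m); rewrite addKn in e4.
apply/eqP; transitivity ((m + n)`!); first by rewrite -e2 -e3; ring.
by rewrite -e4 -e1; ring.
Qed.

(** The factorial moments of the binomial distribution: falling factorials are reproduced without
    lower-order terms. The ring is general because [x] and [y] will be polynomials. *)
Lemma bernstein_ffact (A : comPzRingType) (x y : A) m N : x + y = 1 -> (m <= N)%N ->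
  \sum_(j < N.+1) ('C(N, j) * j ^_ m)%:R * (x ^+ j * y ^+ (N - j)) =
  (N ^_ m)%:R * x ^+ m.
Proof.
move=> xy /subnKC <-; move: (N - m)%N => n.
rewrite -addnS big_split_ord /= big1 ?add0r => [|i _]; last first.
  by rewrite ffact_small ?muln0 ?mul0r.
transitivity (\sum_(i < n.+1) ((m + n) ^_ m)%:R * x ^+ m * (y ^+ (n - i) * x ^+ i *+ 'C(n, i))).
  apply: eq_bigr => i _; have le_in : (i <= n)%N by rewrite -ltnS.
  rewrite bin_ffact_shift // subnDl exprD natrM.
  by rewrite -mulr_natl; ring.
by rewrite -mulr_sumr -exprDn addrC xy expr1n mulr1.
Qed.

End BernsteinIdentity.

Section BernsteinNodes.
Variable R : realType.

(** Shifted from j / N so that no node is 0 or 1: the truncated spherical functions below realise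
    only eigenvalues strictly between -1 and 1. *)
Definition bnode N j : R := j.+1%:R / N.+2%:R.

Lemma bnode_gt0 N j : 0 < bnode N j.
Proof. by rewrite divr_gt0 ?ltr0n. Qed.

Lemma bnode_lt1 N j : (j <= N)%N -> bnode N j < 1.
Proof. by move=> jN; rewrite ltr_pdivrMr ?ltr0n // mul1r ltr_nat ltnS ltnS. Qed.

Lemma bnode_factor N i j : (i < N)%N -> (j <= N)%N ->
  `|(j - i)%:R / (N - i)%:R - bnode N j| <= i.+2%:R / (N - i)%:R.
Proof.
move=> iN jN; have Ni : 0 < (N - i)%:R :> R by rewrite ltr0n subn_gt0.
have N2 : 0 < N.+2%:R :> R by [].
have -> : (j - i)%:R / (N - i)%:R - bnode N j =
   ((j - i)%:R * N.+2%:R - j.+1%:R * (N - i)%:R) / (N - i)%:R / N.+2%:R :> R.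
  by rewrite /bnode; field; rewrite !gt_eqF.
rewrite normrM normfV (gtr0_norm N2) normrM normfV (gtr0_norm Ni) mulrAC.
rewrite ler_pM2r ?invr_gt0 // ler_pdivrMr // -!natrM ler_norml; apply/andP; split.
  by rewrite lerBrDr addrC lerBlDr -natrD ler_nat; nia.
by rewrite lerBlDr -natrD ler_nat; nia.
Qed.

(** The quotient is a product of [m] factors in [0, 1], each within (k + 2) / (N - k) <= 2 (m + 1) /
    N of the node because k < m and 2 m <= N; the errors add up. *)
Lemma bnode_ffact N m j : (m.*2 <= N)%N -> (0 < N)%N -> (j <= N)%N ->
  `|(j ^_ m)%:R / (N ^_ m)%:R - bnode N j ^+ m| <= (2 * m * m.+1)%:R / N%:R.
Proof.
move=> mN N0 jN; suff H k : (k <= m)%N ->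
    `|(j ^_ k)%:R / (N ^_ k)%:R - bnode N j ^+ k| <= (2 * k * m.+1)%:R / N%:R.
  exact: H.
elim: k => [|k IH] km; first by rewrite !ffactn0 expr0 divr1 subrr normr0 muln0 mul0n mul0r.
have kN : (k < N)%N by lia.
have Nk : 0 < (N ^_ k)%:R :> R by rewrite ltr0n ffact_gt0; lia.
have N'k : 0 < (N - k)%:R :> R by rewrite ltr0n; lia.
rewrite !ffactnSr !(natrM _ (_ ^_ k)) exprSr.
set a := _ / (N ^_ k)%:R in IH; set b := (j - k)%:R / (N - k)%:R : R.
have -> : (j ^_ k)%:R * (j - k)%:R / ((N ^_ k)%:R * (N - k)%:R) = a * b :> R.
  by rewrite /a /b; field; rewrite !gt_eqF.
set t := bnode N j in IH *; have t0 : 0 < t by exact: bnode_gt0.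
have t1 : t < 1 by exact: bnode_lt1.
have b0 : 0 <= b by rewrite divr_ge0.
have b1 : b <= 1 by rewrite ler_pdivrMr // mul1r ler_nat leq_sub2r.
have -> : a * b - t ^+ k * t = (a - t ^+ k) * b + t ^+ k * (b - t) by ring.
apply: le_trans (ler_normD _ _) _; rewrite (normrM _ b) (normrM _ (b - t)).
have h1 : `|a - t ^+ k| * `|b| <= (2 * k * m.+1)%:R / N%:R.
  apply: le_trans (IH (ltnW km)); rewrite (ger0_norm b0) ler_piMr //.
have h2 : `|t ^+ k| * `|b - t| <= (2 * m.+1)%:R / N%:R.
  have : `|b - t| <= k.+2%:R / (N - k)%:R by exact: bnode_factor.
  rewrite normrX (gtr0_norm t0) => h.
  have : t ^+ k * `|b - t| <= `|b - t| by rewrite ler_piMl // exprn_ile1 // ltW.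
  move=> h'; apply: le_trans h' (le_trans h _).
  rewrite ler_pdivrMr // mulrAC ler_pdivlMr ?ltr0n // -!natrM ler_nat.
  by nia.
apply: le_trans (lerD h1 h2) _; rewrite -mulrDl -natrD.
by rewrite ler_pM2r ?invr_gt0 ?ltr0n // ler_nat; lia.
Qed.

End BernsteinNodes.

Section HausdorffMoments.
Variables (R : realType) (d : nat).
Hypothesis hd : (2 <= d)%N.
Variable c : nat -> R.
Hypotheses (hc : haus d c) (c0 : c 0%N = 1).

Notation L := (Lc d c).
Let S : {poly R} := 2^-1 *: (1 + 'X).
Let S' : {poly R} := 2^-1 *: (1 - 'X).

(** The functional applied to a Bernstein basis polynomial in the variable [S], which maps [-1, 1]
    onto [0, 1]. *)
Definition bweight N j : R := 'C(N, j)%:R * L (S ^+ j * S' ^+ (N - j)).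

Lemma bweight_ge0 N j : 0 <= bweight N j.
Proof.
rewrite /bweight; have -> : S ^+ j * S' ^+ (N - j) =
    (2^-1 ^+ j * 2^-1 ^+ (N - j)) *: ((1 + 'X) ^+ j * (1 - 'X) ^+ (N - j)).
  by rewrite !exprZn -scalerAl -scalerAr scalerA.
by rewrite mulr_ge0 // LcZ mulr_ge0 ?hc // mulr_ge0 // exprn_ge0 // invr_ge0.
Qed.

Lemma bweight_ffact N m : (m <= N)%N ->
  \sum_(j < N.+1) bweight N j * (j ^_ m)%:R = (N ^_ m)%:R * L (S ^+ m).
Proof.
move=> mN; have SS : S + S' = 1.
  rewrite /S /S' -scalerDr addrACA subrr addr0 scalerDr -scalerDl.
  by rewrite -[2^-1]mul1r -splitr scale1r.
have := congr1 L (bernstein_ffact SS mN).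
rewrite mulr_natl -(@scaler_nat R {poly R}) LcZ => <-; rewrite Lc_sum; apply: eq_bigr => j _.
by rewrite mulr_natl -(@scaler_nat R {poly R}) LcZ natrM /bweight; ring.
Qed.

Lemma bweight_sum N : \sum_(j < N.+1) bweight N j = 1.
Proof.
have := @bweight_ffact N 0 isT; rewrite ffactn0 expr0 Lc1 c0 mulr1 => h.
rewrite -[RHS]/(1%:R) -h.
by apply: eq_bigr => j _; rewrite ffactn0 mulr1.
Qed.

(** The factorial moments of the weights are exact by [bweight_ffact], so the only error comes from
    replacing quotients of falling factorials by powers of the nodes. *)
Lemma bmoment_bound N m : (m.*2 <= N)%N -> (0 < N)%N ->
  `|\sum_(j < N.+1) bweight N j * bnode R N j ^+ m - L (S ^+ m)| <=
  (2 * m * m.+1)%:R / N%:R.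
Proof.
move=> mN N0.
have Nm : 0 < (N ^_ m)%:R :> R by rewrite ltr0n ffact_gt0; lia.
have -> : L (S ^+ m) = \sum_(j < N.+1) bweight N j * ((j ^_ m)%:R / (N ^_ m)%:R).
  under eq_bigr do rewrite mulrA.
  rewrite -mulr_suml bweight_ffact; last by lia.
  by rewrite mulrAC mulfV ?mul1r // gt_eqF.
rewrite -sumrB; apply: le_trans (ler_norm_sum _ _ _) _.
rewrite -[leRHS]mul1r -[X in _ <= X * _](bweight_sum N) mulr_suml; apply: ler_sum => j _.
rewrite -mulrBr normrM ger0_norm ?bweight_ge0 // ler_wpM2l ?bweight_ge0 //.
by rewrite distrC bnode_ffact // -ltnS.
Qed.

Lemma bmoment_cvg m :
  (fun N => \sum_(j < N.+1) bweight N j * bnode R N j ^+ m) @ \oo --> L (S ^+ m).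
Proof.
apply/cvgrPdist_le => e e0.
near=> N; rewrite distrC; apply: le_trans (bmoment_bound _ _) _.
- by near: N; exists m.*2.
- by near: N; exists 1%N.
have N0 : (0 < N)%N by near: N; exists 1%N.
rewrite ler_pdivrMr ?ltr0n // mulrC -ler_pdivrMr //.
near: N; exists (Num.truncn ((2 * m * m.+1)%:R / e)).+1 => // N /= le.
apply/ltW; apply: lt_le_trans (truncnS_gt _) _; by rewrite ler_nat.
Unshelve. all: by end_near. Qed.

Lemma poly_bernstein_basis (p : {poly R}) :
  p = \sum_(i < size (p \Po (2 *: 'X - 1))) (p \Po (2 *: 'X - 1))`_i *: S ^+ i.
Proof.
set r := p \Po _.
have -> : \sum_(i < size r) r`_i *: S ^+ i = r \Po S by rewrite comp_polyE.
rewrite /r -comp_polyA comp_polyB comp_polyZ comp_polyX.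
have -> : (1 : {poly R}) \Po S = 1 by rewrite -polyC1 comp_polyC.
by rewrite /S scalerA mulfV ?pnatr_eq0 // scale1r addrAC subrr add0r comp_polyXr.
Qed.

Lemma bpoly_cvg (p : {poly R}) :
  (fun N => \sum_(j < N.+1) bweight N j * p.[2 * bnode R N j - 1]) @ \oo --> L p.
Proof.
set r := p \Po (2 *: 'X - 1).
have -> : (fun N => \sum_(j < N.+1) bweight N j * p.[2 * bnode R N j - 1]) =
  (fun N => \sum_(i < size r) r`_i * \sum_(j < N.+1) bweight N j * bnode R N j ^+ i).
  apply/funext => N; under [RHS]eq_bigr do rewrite mulr_sumr.
  rewrite exchange_big; apply: eq_bigr => j _ /=.
  have -> : p.[2 * bnode R N j - 1] = r.[bnode R N j].
    by rewrite horner_comp !(hornerD, hornerN, hornerZ, hornerX, hornerC).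
  by rewrite horner_coef mulr_sumr; apply: eq_bigr => i _; ring.
rewrite [X in L X]poly_bernstein_basis Lc_sum -/r.
under eq_bigr do rewrite LcZ.
apply: cvg_sumr => i; apply: cvgMl_tmp; exact: bmoment_cvg.
Qed.

End HausdorffMoments.

(** * Probability measures on an interval *)

Section Probability.
Context d (T : measurableType d) (R : realType) (P : probability T R).

Lemma bounded_integrable (D : set T) (f : T -> R) (M : R) : measurable D ->
  measurable_fun setT f -> (forall x, `|f x| <= M) -> P.-integrable D (EFin \o f).
Proof.
move=> mD mf fM; apply: measurable_bounded_integrable => //.
- by apply: le_lt_trans (probability_le1 P mD) _; rewrite ltry.
- exact: measurable_funTS.
exists M; split; first exact: num_real.
by move=> x Mx y _; apply: le_trans (fM y) (ltW Mx).
Qed.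

Lemma Rintegral_ae (D : set T) (f : T -> R) (M : R) : measurable D -> P D = 1%E ->
  measurable_fun setT f -> (forall x, `|f x| <= M) ->
  \int[P]_x f x = \int[P]_(x in D) f x.
Proof.
move=> mD PD mf fM; rewrite /Rintegral; congr fine.
rewrite (@negligible_integral _ _ _ P setT (~` D)) ?setTD ?setCK //.
- exact: measurableC.
- exact: (bounded_integrable _ mf fM).
- by have := probability_setC P mD; rewrite PD subee // => h; exact: h.
Qed.

End Probability.

Section UniformPartition.
Variables (R : realType) (P : probability (measurableTypeR R) R).
Hypothesis HP : forall a b : R, 0 <= a -> a <= b -> b <= 1 -> P `[a, b[%classic = (b - a)%:E.

Lemma partition_Rintegral (W : nat -> R) n (g : R -> R) (M : R) :
  (forall i, W i <= W i.+1) -> W 0 = 0 ->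
  measurable_fun setT (g : measurableTypeR R -> R) -> (forall x, `|g x| <= M) ->
  \int[P]_(x in `[0, W n[) g x = \sum_(i < n) \int[P]_(x in `[W i, W i.+1[) g x.
Proof.
move=> Wnd W0 mg gM; elim: n => [|n IH].
  by rewrite W0 big_ord0 set_itvco0 Rintegral_set0.
have W0n : 0 <= W n.
  by elim: n {IH} => [|n IH]; rewrite ?W0 //; apply: le_trans IH (Wnd n).
rewrite big_ord_recr -IH /=.
have -> : `[0, W n.+1[%classic = `[0, W n[ `|` `[W n, W n.+1[.
  by rewrite -itv_bndbnd_setU // bnd_simp.
rewrite Rintegral_setU //.
- by apply: bounded_integrable mg gM; exact: measurableU.
- apply/disj_setPS => x [] /=; rewrite !in_itv /= => /andP[_ h] /andP[h' _].
  by have := lt_le_trans h h'; rewrite ltxx.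
Qed.

Lemma Rintegral_piece (a b k : R) : 0 <= a -> a <= b -> b <= 1 ->
  \int[P]_(_ in `[a, b[) k = k * (b - a).
Proof.
move=> a0 ab b1; rewrite Rintegral_cst //; congr (_ * _).
exact: (congr1 fine (HP a0 ab b1)).
Qed.

(** Lower and upper sums differ by the telescoping amount (h 1 - h 0) / K. The rate does not depend
    on [h], which allows a limit in [h] at fixed [K]. *)
Lemma riemann_monotone (h : R -> R) K : (0 < K)%N -> nondecreasing_fun h ->
  (forall x, 0 <= h x <= 1) ->
  `|\int[P]_(x in `[0, 1[) h x - K%:R^-1 * \sum_(i < K) h (i%:R / K%:R)| <= K%:R^-1.
Proof.
move=> K0 hnd h01; have K0' : 0 < K%:R :> R by rewrite ltr0n.
pose W i : R := i%:R / K%:R.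
have Wnd i : W i <= W i.+1 by rewrite ler_pM2r ?invr_gt0 // ler_nat.
have W0 : W 0 = 0 by rewrite /W mul0r.
have W1 : W K = 1 by rewrite /W divff // gt_eqF.
have Wge0 i : 0 <= W i by rewrite divr_ge0.
have WK i : (i <= K)%N -> W i <= 1 by move=> le; rewrite ler_pdivrMr // mul1r ler_nat.
have Wd i : W i.+1 - W i = K%:R^-1 by rewrite /W -natr1; field; rewrite gt_eqF.
have mh : measurable_fun setT (h : measurableTypeR R -> R) by exact: nondecreasing_measurable.
have hb x : `|h x| <= 1 by have /andP[h0 ?] := h01 x; rewrite ger0_norm.
have ih a b : P.-integrable `[a, b[ (EFin \o h) by exact: bounded_integrable mh hb.
have ic a b k : P.-integrable `[a, b[ (EFin \o (fun=> k : R)).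
  by apply: (@bounded_integrable _ _ _ _ _ _ `|k|) => //; exact: measurable_cst.
rewrite -{1}W1 (partition_Rintegral _ Wnd W0 mh hb).
have lo : K%:R^-1 * \sum_(i < K) h (W i) <= \sum_(i < K) \int[P]_(x in `[W i, W i.+1[) h x.
  rewrite mulr_sumr; apply: ler_sum => i _.
  rewrite mulrC -(Wd i) -Rintegral_piece // ?WK //.
  apply: le_Rintegral => // x /=; rewrite in_itv /= => /andP[? _]; exact: hnd.
have up : \sum_(i < K) \int[P]_(x in `[W i, W i.+1[) h x <=
   K%:R^-1 * \sum_(i < K) h (W i.+1).
  rewrite mulr_sumr; apply: ler_sum => i _.
  rewrite mulrC -(Wd i) -Rintegral_piece // ?WK //.
  apply: le_Rintegral => // x /=; rewrite in_itv /= => /andP[_ /ltW ?]; exact: hnd.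
rewrite ger0_norm ?subr_ge0 // lerBlDr; apply: le_trans up _.
rewrite -[X in _ <= X + _]mulr1 -mulrDr ler_pM2l ?invr_gt0 //.
suff -> : \sum_(i < K) h (W i.+1) = h (W K) - h (W 0) + \sum_(i < K) h (W i).
  rewrite lerD2r; have /andP[_ ?] := h01 (W K); have /andP[? _] := h01 (W 0).
  by rewrite lerBlDr; apply: le_trans (_ : 1 <= _) => //; rewrite lerDl.
rewrite -(@telescope_sumr _ 0 K (h \o W)) // big_mkord -big_split /=.
by apply: eq_bigr => i _; rewrite subrK.
Qed.

End UniformPartition.

Lemma uniform_prob_itv (R : realType) (a b : R) : 0 <= a -> a <= b -> b <= 1 ->
  uniform_prob (@ltr01 R) `[a, b[%classic = (b - a)%:E.
Proof.
move=> a0 ab b1; rewrite /uniform_prob integral_uniform_pdf setIidl; last first.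
  move=> x /=; rewrite !in_itv /= => /andP[ax xb].
  by rewrite (le_trans a0 ax) (le_trans (ltW xb) b1).
rewrite (eq_integral (fun=> 1%:E)); last first.
  move=> x; rewrite inE /= in_itv /= => /andP[ax xb].
  by rewrite /uniform_pdf (le_trans a0 ax) (le_trans (ltW xb) b1) subr0 invr1.
rewrite integral_cst //= lebesgue_measure_itv /= lte_fin mul1e.
by case: ltgtP ab => // -> _; rewrite subrr.
Qed.

Section QuantileLimit.
Variables (R : realType) (P : probability (measurableTypeR R) R).
Hypothesis HP : forall a b : R, 0 <= a -> a <= b -> b <= 1 -> P `[a, b[%classic = (b - a)%:E.
Variables (w : nat -> nat -> R) (x : nat -> nat -> R) (mu : nat -> R).
Hypotheses (w0 : forall N j, 0 <= w N j) (w1 : forall N, \sum_(j < N.+1) w N j = 1).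
Hypotheses (x01 : forall N j, (j <= N)%N -> 0 <= x N j <= 1).
Hypothesis xnd : forall N i j, (i <= j)%N -> (j <= N)%N -> x N i <= x N j.
Hypothesis mu_cvg : forall m,
  (fun N => \sum_(j < N.+1) w N j * x N j ^+ m) @ \oo --> mu m.

Let W N i : R := \sum_(j < i) w N j.
Let J N (u : R) := (\sum_(j < N) (W N j.+1 <= u)%R)%N.
(* quantile function of the atomic measure with weights [w N j] at [x N j] *)
Let Q N u := x N (J N u).

Let WS N i : W N i.+1 = W N i + w N i.
Proof. by rewrite /W big_ord_recr. Qed.

Let Wnd N i : W N i <= W N i.+1.
Proof. by rewrite WS lerDl. Qed.

Let Wmono N i j : (i <= j)%N -> W N i <= W N j.
Proof.
move=> /subnKC <-; elim: (j - i)%N => [|k IH]; first by rewrite addn0.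
by rewrite addnS; apply: le_trans IH (Wnd _ _).
Qed.

Let JN N u : (J N u <= N)%N.
Proof.
rewrite -[leqRHS]card_ord -sum1_card; apply: leq_sum => i _; exact: leq_b1.
Qed.

Let J_piece N i u : (i <= N)%N -> W N i <= u < W N i.+1 -> J N u = i.
Proof.
move=> iN /andP[lo up]; rewrite /J (eq_bigr (fun j : 'I_N => (j < i)%N : nat)).
  rewrite -(big_mkord xpredT (fun j => (j < i)%N : nat)) (@big_cat_nat _ _ _ i) //=.
  rewrite big_nat (eq_bigr (fun=> 1%N)) => [|j /andP[_ ->] //].
  rewrite -big_nat sum_nat_const_nat muln1 subn0 big_nat big1 ?addn0 // => j.
  by case/andP => ij _; rewrite ltnNge ij.
move=> j _; congr nat_of_bool; case: ltnP => ji.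
  exact: le_trans (Wmono _ ji) lo.
apply/negbTE; rewrite -ltNge; apply: lt_le_trans up _; exact: Wmono.
Qed.

Let Qnd N : nondecreasing_fun (Q N).
Proof.
move=> u v uv; apply: xnd (JN _ _); apply: leq_sum => j _.
by case: (leP (W N j.+1) u) => // h; rewrite (le_trans h uv).
Qed.

Let Q01 N u : 0 <= Q N u <= 1.
Proof. exact: x01. Qed.

Lemma expr_nd01 m (h : R -> R) : nondecreasing_fun h -> (forall u, 0 <= h u <= 1) ->
  nondecreasing_fun (fun u => h u ^+ m) /\ (forall u, 0 <= h u ^+ m <= 1).
Proof.
move=> hnd h01; have h0 u : 0 <= h u by case/andP: (h01 u).
split=> [u v uv|u]; first by apply: lerXn2r; rewrite ?nnegrE ?h0 ?hnd.
by rewrite exprn_ge0 ?h0 // exprn_ile1 ?h0 //; case/andP: (h01 u).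
Qed.

Let Q_moment N m : \int[P]_(u in `[0, 1[) (Q N u ^+ m) = \sum_(j < N.+1) w N j * x N j ^+ m.
Proof.
have [nd h01] := expr_nd01 m (@Qnd N) (Q01 N).
have e1 : W N N.+1 = 1 by exact: w1.
have e0 : W N 0 = 0 by rewrite /W big_ord0.
rewrite -{1}e1 (@partition_Rintegral R P (W N) N.+1 _ 1 (Wnd N) e0); last 2 first.
- exact: nondecreasing_measurable.
- by move=> u; have /andP[? ?] := h01 u; rewrite ger0_norm.
apply: eq_bigr => i _.
rewrite (@eq_Rintegral _ _ _ _ _ (fun=> x N i ^+ m)); last first.
  move=> u; rewrite inE /= in_itv /= => ui; rewrite /Q (J_piece (i := i)) //.
  by rewrite -ltnS.
rewrite (Rintegral_piece HP) ?Wnd //; last 2 first.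
- by rewrite -e0; exact: Wmono.
- by rewrite -e1; exact: Wmono.
by rewrite WS mulrC addrAC subrr add0r.
Qed.

(** An ultrafilter finer than [\oo] makes the quantile functions converge at every point at once,
    since their values stay in the compact [0, 1]. The limit is monotone, and the moments pass to it
    because Riemann sums, which involve finitely many point values, approximate all these integrals
    uniformly. *)
Lemma quantile_limit : exists q : R -> R,
  [/\ nondecreasing_fun q, forall u, 0 <= q u <= 1 &
      forall m, \int[P]_(u in `[0, 1[) (q u ^+ m) = mu m].
Proof.
have [U [UU sU]] := ultraFilterLemma (eventually_filter : ProperFilter \oo).
have Ucvg u : exists l : R, (fun N => Q N u) @ U --> l.
  have cpt : compact `[0, 1 : R]%classic by exact: segment_compact.
  have [|l [_ cl]] := cpt ((fun N => Q N u) @ U) _.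
    by apply: (@filterE _ U) => N; rewrite /= in_itv /=; exact: Q01.
  exists l; move=> A Al.
  have [//|nA] := in_ultra_setVsetC ((fun N => Q N u) @^-1` A) UU.
  have [y [ny Ay]] := cl (~` A) A nA Al; by case: (ny Ay).
have [q qU] := choice Ucvg.
have qnd : nondecreasing_fun q.
  by move=> u v uv; apply: (ler_cvg_to (qU u) (qU v)); near=> N; exact: Qnd.
have q01 u : 0 <= q u <= 1.
  apply/andP; split.
    by apply: (cvgr_to_ge (qU u)); near=> N; case/andP: (Q01 N u).
  by apply: (cvgr_to_le (qU u)); near=> N; case/andP: (Q01 N u).
exists q; split=> // m.
have [qmnd qm01] := expr_nd01 m qnd q01.
pose rs K (h : R -> R) := K%:R^-1 * \sum_(i < K) h (i%:R / K%:R).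
have cQ u : (fun N => Q N u ^+ m) @ U --> q u ^+ m.
  elim: m {qmnd qm01} => [|m IH].
    by under eq_fun do rewrite expr0; rewrite expr0; exact: cvg_cst.
  by under eq_fun do rewrite exprS; rewrite exprS; exact: cvgM.
have crs K : (fun N => rs K (fun u => Q N u ^+ m)) @ U --> rs K (fun u => q u ^+ m).
  by apply: cvgMl_tmp; apply: cvg_sumr => i; exact: cQ.
have cmu : (fun N => \int[P]_(u in `[0, 1[) (Q N u ^+ m)) @ U --> mu m.
  under eq_fun do rewrite Q_moment.
  by move=> A /mu_cvg /sU.
have dist K : (0 < K)%N -> `|mu m - rs K (fun u => q u ^+ m)| <= K%:R^-1.
  move=> K0; apply: (cvgr_to_le (cvg_norm (cvgB cmu (crs K)))).
  near=> N; have [nd h01] := expr_nd01 m (@Qnd N) (Q01 N).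
  exact: (riemann_monotone HP K0 nd h01).
apply/eqP; rewrite -subr_eq0 -normr_le0; apply/ler_addgt0Pr => e e0; rewrite add0r.
pose K := (Num.truncn (2 / e)).+1.
have K0 : 0 < K%:R :> R by rewrite ltr0n.
have h1 := riemann_monotone HP (isT : (0 < K)%N) qmnd qm01.
have h2 := dist K isT.
rewrite -(subrKA (rs K (fun u => q u ^+ m))); apply: le_trans (ler_normD _ _) _.
rewrite [X in _ + X]distrC; apply: le_trans (lerD h1 h2) _.
have -> : K%:R^-1 + K%:R^-1 = 2 / K%:R :> R by ring.
rewrite ler_pdivrMr // mulrC -ler_pdivrMr //.
exact: ltW (truncnS_gt _).
Unshelve. all: by end_near. Qed.

End QuantileLimit.

Lemma Rintegral_sumr d (T : measurableType d) (R : realType)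
    (mu : {measure set T -> \bar R}) (D : set T) (I : Type) (r : seq I) (f : I -> T -> R) :
  measurable D -> (forall i, mu.-integrable D (EFin \o f i)) ->
  \int[mu]_(x in D) (\sum_(i <- r) f i x) = \sum_(i <- r) \int[mu]_(x in D) f i x.
Proof.
move=> mD fi; elim: r => [|i r IH].
  by rewrite big_nil; under eq_Rintegral do rewrite big_nil; rewrite Rintegral_cst // mul0r.
rewrite big_cons -IH -RintegralD //; first by under eq_Rintegral do rewrite big_cons.
rewrite (_ : _ \o _ = fun x => (\sum_(j <- r) (EFin \o f j) x)%E).
  by apply: integrable_sum => // j _; exact: fi.
by apply/funext => x; rewrite /= sumEFin.
Qed.

Lemma integrable_scale d (T : measurableType d) (R : realType)
    (mu : {measure set T -> \bar R}) (D : set T) (f : T -> R) (a : R) : measurable D ->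
  mu.-integrable D (EFin \o f) -> mu.-integrable D (EFin \o (fun t => a * f t)).
Proof. by move=> mD /(integrableZl mD a). Qed.

(** * The Hausdorff moment problem *)

Section MomentCharacterization.
Variables (R : realType) (d : nat).
Hypothesis hd : (2 <= d)%N.

(** Restores the index 0, where a correlation sequence has the value 1. *)
Definition ext1 (x : nat -> R) : nat -> R := fun n => if n is m.+1 then x m else 1.

Lemma horner_measurable (p : {poly R}) :
  measurable_fun setT (fun t : measurableTypeR R => p.[t]).
Proof.
under eq_fun do rewrite horner_coef.
apply: measurable_sum => i; apply: measurable_funM; first exact: measurable_cst.
exact: exprn_measurable.
Qed.

Lemma horner_bound (p : {poly R}) : exists M : R, forall t, -1 <= t <= 1 -> `|p.[t]| <= M.
Proof.
exists (\sum_(i < size p) `|p`_i|) => t t1; rewrite horner_coef.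
apply: le_trans (ler_norm_sum _ _ _) _; apply: ler_sum => i _.
rewrite normrM ler_piMr // normrX exprn_ile1 //.
by rewrite ler_norml.
Qed.

Lemma X_set_sph (x : nat -> R) : X_set R d x <->
  exists eta : probability (measurableTypeR R) R, eta `[-1, 1]%classic = 1%E /\
    forall n, x n = \int[eta]_(t in `[-1, 1]) (sph R d n.+1).[t].
Proof.
split=> -[eta [e1 ex]]; exists eta; split=> // n; rewrite ex;
  by apply: eq_Rintegral => t _; rewrite q_poly_sph.
Qed.

(** Spherical functions are eigenfunctions of [tstep], so iterating [tstep] on their integrals
    inserts powers of t under the integral sign; at index 0 only the power remains. *)
Lemma Lc_integral (eta : probability (measurableTypeR R) R) (p : {poly R}) (k : nat) :
  eta `[-1, 1]%classic = 1%E ->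
  Lc d (fun k => \int[eta]_(t in `[-1, 1]) (sph R d k).[t]) p =
  \int[eta]_(t in `[-1, 1]) p.[t].
Proof.
move=> e1; have ip (q : {poly R}) : eta.-integrable `[-1, 1] (fun t => (q.[t])%:E).
  have [M qM] := horner_bound q.
  apply: measurable_bounded_integrable => //.
  - by apply: le_lt_trans (_ : 1%E < _)%E; rewrite ?ltry // -e1.
  - by apply: measurable_funTS; exact: horner_measurable.
  exists M; split; first exact: num_real.
  move=> y My t /=; rewrite in_itv /= => t1; apply: le_trans (qM t t1) (ltW My).
pose I (f : R -> R) : R := \int[eta]_(t in `[-1, 1]) f t.
have mI i k0 : iter i (tstep d) (fun k => I (horner (sph R d k))) k0 =
    I (fun t => t ^+ i * (sph R d k0).[t]).
  elim: i k0 => [|i IH] k0 /=.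
    by apply: eq_Rintegral => t _; rewrite mul1r.
  have e (t : R) : t ^+ i.+1 * (sph R d k0).[t] =
      t ^+ i * tstep d (fun k => (sph R d k).[t]) k0.
    by rewrite tstep_horner // exprSr mulrA.
  rewrite (_ : I _ = I (fun t => t ^+ i * tstep d (fun k => (sph R d k).[t]) k0)); last first.
    by apply: eq_Rintegral => t _; exact: e.
  have iX j : eta.-integrable `[-1, 1] (EFin \o (fun t => t ^+ i * (sph R d j).[t])).
    rewrite (_ : _ \o _ = (fun t => (('X^i * sph R d j).[t])%:E)); first exact: ip.
    by apply/funext => t /=; rewrite hornerM hornerXn.
  case: k0 {e} => [|k0] /=; rewrite !IH.
    have -> : I (fun t => t ^+ i * (d%:R * (sph R d 1).[t] / kap R d)) =
        I (fun t => (d%:R / kap R d) * (t ^+ i * (sph R d 1).[t])).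
      by apply: eq_Rintegral => t _; ring.
    by rewrite /I RintegralZl // -!/(I _); ring.
  have -> : I (fun t => t ^+ i * (((d%:R - 1) * (sph R d k0.+2).[t] + (sph R d k0).[t]) / kap R d)) =
     I (fun t => ((d%:R - 1) / kap R d) * (t ^+ i * (sph R d k0.+2).[t]) +
                 (kap R d)^-1 * (t ^+ i * (sph R d k0).[t])).
    by apply: eq_Rintegral => t _; ring.
  have iXZ j a : eta.-integrable `[-1, 1] (EFin \o (fun t => a * (t ^+ i * (sph R d j).[t]))).
    exact: integrable_scale.
  by rewrite /I RintegralD // !RintegralZl // -!/(I _); ring.
rewrite /Lc; under [RHS]eq_Rintegral do rewrite horner_coef.
rewrite Rintegral_sumr //; last first.
  move=> i; rewrite (_ : _ \o _ = (fun t => ((p`_i *: 'X^i).[t])%:E)); first exact: ip.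
  by apply/funext => t /=; rewrite hornerZ hornerXn.
apply: eq_bigr => i _; rewrite /mom mI.
rewrite RintegralZl //; last first.
  rewrite (_ : _ \o _ = (fun t => (('X^i).[t])%:E)); first exact: ip.
  by apply/funext => t /=; rewrite hornerXn.
by congr (_ * _); apply: eq_Rintegral => t _; rewrite sph0 hornerC mulr1.
Qed.

Lemma X_set_haus (x : nat -> R) : X_set R d x -> haus d (ext1 x).
Proof.
move=> /X_set_sph [eta [e1 ex]].
have -> : ext1 x = fun k => \int[eta]_(t in `[-1, 1]) (sph R d k).[t].
  apply/funext => -[|n] /=; last exact: ex.
  under eq_Rintegral do rewrite sph0 hornerC.
  by rewrite Rintegral_cst // mul1r; symmetry; exact: (congr1 fine e1).
move=> i j; rewrite Lc_integral //; apply: Rintegral_ge0 => t /=.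
rewrite in_itv /= => /andP[t0 t1].
rewrite hornerM !horner_exp !(hornerD, hornerN, hornerX) hornerC.
by rewrite mulr_ge0 // exprn_ge0 //; [rewrite addrC -lerBlDr sub0r|rewrite subr_ge0].
Qed.

(** The measure is the law of 2 q(u) - 1 for [u] uniform, where [q] is the limit quantile function:
    its moments in the variable [S] are those of the functional. *)
Lemma haus_X_set (x : nat -> R) : haus d (ext1 x) -> X_set R d x.
Proof.
move=> hx; have c0 : ext1 x 0%N = 1 by [].
have nd N i j : (i <= j)%N -> (j <= N)%N -> bnode R N i <= bnode R N j.
  by move=> ij _; rewrite ler_pM2r ?invr_gt0 ?ltr0n // ler_nat.
have n01 N j : (j <= N)%N -> 0 <= bnode R N j <= 1.
  by move=> jN; rewrite (ltW (bnode_gt0 _ _ _)) (ltW (bnode_lt1 _ _)).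
pose U : probability (measurableTypeR R) R := uniform_prob (@ltr01 R).
have HU : forall a b : R, 0 <= a -> a <= b -> b <= 1 -> U `[a, b[%classic = (b - a)%:E.
  exact: uniform_prob_itv.
have [q [qnd q01 qm]] := quantile_limit HU
  (bweight_ge0 hx) (@bweight_sum R d _ c0) n01 nd (bmoment_cvg hd hx c0).
pose X0 (u : measurableTypeR R) : measurableTypeR R := 2 * q u - 1.
have mX0 : measurable_fun setT X0.
  apply: nondecreasing_measurable => // u v uv.
  by rewrite /X0 lerB // ler_pM2l // qnd.
have X01 u : -1 <= X0 u <= 1 by have /andP[? ?] := q01 u; rewrite /X0; apply/andP; split; lra.
pose X : {mfun measurableTypeR R >-> measurableTypeR R} := mfun_Sub (mem_set mX0).
apply/X_set_sph; exists (distribution U X).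
have pre : X @^-1` `[-1, 1] = setT.
  by apply/seteqP; split=> // u _ /=; rewrite in_itv /=; exact: X01.
split.
  transitivity (U (X @^-1` `[-1, 1])); first by [].
  by rewrite pre; exact: probability_setT.
move=> n; rewrite -[LHS](Lc_sph hd (ext1 x) n.+1).
set p := sph R d n.+1.
have [M pM] := horner_bound p.
have mp : measurable_fun setT (fun u => p.[X0 u]).
  exact: (measurableT_comp (horner_measurable p) mX0).
have -> : \int[distribution U X]_(t in `[-1, 1]) p.[t] = \int[U]_u p.[X0 u].
  rewrite /Rintegral integral_pushforward // ?pre //.
  - by apply/measurable_EFinP; exact: horner_measurable.
  - by apply: (bounded_integrable _ (M := M) _ mp) => // u; exact: pM.
(* The moments of [q] are known as integrals over [0, 1[, a set of full measure. *)
rewrite (@Rintegral_ae _ _ _ U (`[0, 1[%classic : set R) _ M _ _ mp) //; last 2 first.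
- by rewrite HU ?subr0.
- by move=> u; exact: pM.
have qi i : U.-integrable `[0, 1[ (EFin \o (fun u => q u ^+ i)).
  have [nd1 h01] := expr_nd01 i qnd q01.
  apply: (@bounded_integrable _ _ _ U _ _ 1) => //; first exact: nondecreasing_measurable.
  by move=> u; have /andP[? ?] := h01 u; rewrite ger0_norm.
rewrite [X in Lc _ _ X](poly_bernstein_basis p) Lc_sum.
set r := p \Po _.
transitivity (\int[U]_(u in `[0, 1[) (\sum_(i < size r) r`_i * q u ^+ i)).
  rewrite Rintegral_sumr //; last first.
    by move=> i; exact: integrable_scale.
  by apply: eq_bigr => i _; rewrite LcZ RintegralZl // qm.
apply: eq_Rintegral => u _.
rewrite -horner_coef /r horner_comp.
by rewrite !(hornerD, hornerN, hornerZ, hornerX, hornerC).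
Qed.

End MomentCharacterization.

(** * Stability under pointwise limits *)

Section PointwiseClosure.
Variable R : realType.

Lemma closure_seq (A : set (nat -> R)) (g : nat -> nat -> R) (x : nat -> R) :
  (forall N, A (g N)) -> (forall n, (fun N => g N n) @ \oo --> x n) ->
  closure (A : set {ptws nat -> R}) x.
Proof.
move=> Ag gx B Bx.
have : (g @ \oo) --> (x : {ptws nat -> R}).
  apply/(@pointwise_cvgP nat R (g @ \oo) x) => n; exact: gx.
move=> /(_ B Bx) [N _ /(_ N (leqnn N))]; by exists (g N).
Qed.

(** Each condition is a weak inequality on an affine expression in finitely many terms of the
    sequence, hence is closed under pointwise convergence. *)
Lemma haus_closure d (A : set (nat -> R)) : (forall x, A x -> haus d (ext1 x)) ->
  forall x, closure (A : set {ptws nat -> R}) x -> haus d (ext1 x).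
Proof.
move=> HA x; rewrite closureEcvg => -[G GG [Gx GA]] i j.
have e k : (fun g : nat -> R => ext1 g k) @ G --> ext1 x k.
  case: k => [|k]; rewrite /ext1; first exact: cvg_cst.
  by move/(@pointwise_cvgP nat R G x): Gx; exact.
have it m : forall k, (fun g : nat -> R => iter m (@tstep R d) (ext1 g) k) @ G -->
    iter m (@tstep R d) (ext1 x) k.
  elim: m => [|m IH] k; first exact: e.
  case: k => [|k].
    by apply: cvgMr_tmp; apply: cvgMl_tmp; exact: IH.
  by apply: cvgMr_tmp; apply: cvgD; [apply: cvgMl_tmp|]; exact: IH.
have cL : (fun g : nat -> R => Lc d (ext1 g) ((1 + 'X) ^+ i * (1 - 'X) ^+ j)) @ G -->
    Lc d (ext1 x) ((1 + 'X) ^+ i * (1 - 'X) ^+ j).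
  by apply: cvg_sumr => k; apply: cvgMl_tmp; exact: it.
apply: (cvgr_to_ge cL); apply: GA => g Ag; exact: (HA g Ag i j).
Qed.

End PointwiseClosure.

(** * Geometry of the tree *)

Section TreeGeometry.
Variable d : nat.

Definition height (v : tree d) : nat := size (val v).

Lemma rmulw_size (j : 'I_d) w :
  size (rmulw j w) = if (w != [::]) && (last j w == j) then (size w).-1 else (size w).+1.
Proof.
elim: w => [//|a [|b t] IH] /=; first by case: eqVneq.
move: IH => /= ->; case: eqVneq => //.
Qed.

Lemma rmulK (j : 'I_d) : involutive (rmul j).
Proof. by move=> u; apply: val_inj; rewrite /= rmulwK // (valP u). Qed.

Lemma rmul_inj (j : 'I_d) : injective (rmul j).
Proof. exact: inv_inj (rmulK j). Qed.

(** Right multiplication by the last letter shortens a word and by any other letter lengthens it. So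
    the [d] translates of [v], though not its neighbours in general, have the heights of its
    neighbours. *)
Lemma height_rmul_sum (R : pzRingType) (h : nat -> R) (v : tree d) :
  \sum_(i < d) h (height (rmul i v)) =
  if height v is n.+1 then (d%:R - 1) * h n.+2 + h n else d%:R * h 1%N.
Proof.
rewrite /height /=; case: v => /= w rw; case: w rw => [|a t] rw.
  by rewrite (eq_bigr (fun=> h 1%N)) // sumr_const card_ord mulr_natl.
rewrite (eq_bigr (fun i => h (if last a t == i then size t else (size t).+2))); last first.
  by move=> i _; rewrite rmulw_size.
rewrite (bigD1 (last a t)) //= eqxx addrC; congr (_ + _).
rewrite (eq_bigr (fun=> h (size t).+2)) => [|i ij]; last by rewrite eq_sym (negPf ij).
rewrite sumr_const -[_ - 1](_ : d.-1%:R = _) ?mulr_natl; last first.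
  by rewrite -[d in RHS](ltn_predK (ltn_ord a)) -natr1 addrK.
by congr (_ *+ _); rewrite cardC1 card_ord.
Qed.

Lemma path_height (u : tree d) p : path (@tree_adj d) u p ->
  (height (last u p) <= height u + size p)%N.
Proof.
elim: p u => [|v p IH] u /=; first by rewrite addn0.
move=> /andP[/adj_size uv /IH le]; apply: leq_trans le _.
by rewrite /height; case: uv => ->; lia.
Qed.

Lemma at_distance_root (v : tree d) : at_distance (height v) (tree_root d) v.
Proof.
split; last first.
  by move=> p pp pv; have := path_height pp; rewrite pv.
case: v => w; rewrite /height /=; elim: w => [|a w IH] rw.
  by exists [::]; split=> //; apply: val_inj.
have rw' : reduced w by move: rw; rewrite /reduced /= => /path_sorted.
have [p [p1 p2 p3]] := IH rw'.
exists (rcons p (exist _ (a :: w) rw)); split.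
- by rewrite rcons_path p1 p2 /= /tree_adj /child /= eqxx orbT.
- by rewrite last_rcons.
- by rewrite size_rcons p3.
Qed.

Lemma at_distance_inj k l (u v : tree d) : at_distance k u v -> at_distance l u v -> k = l.
Proof.
move=> [[p [p1 p2 <-]] hk] [[q [q1 q2 <-]] hl].
by apply/eqP; rewrite eqn_leq hk // hl.
Qed.

Lemma height_at_distance k (v : tree d) : at_distance k (tree_root d) v -> height v = k.
Proof. by move=> h; apply: at_distance_inj (at_distance_root v) h. Qed.

Lemma tree_aut_comp (a b : tree d -> tree d) : tree_aut a -> tree_aut b -> tree_aut (a \o b).
Proof.
move=> [ba ha] [bb hb]; split; first exact: bij_comp.
by move=> u v /=; rewrite ha hb.
Qed.

Lemma tree_aut_inv (a : tree d -> tree d) : tree_aut a ->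
  exists b, [/\ tree_aut b, cancel a b & cancel b a].
Proof.
move=> [[b ab ba] ha]; exists b; split=> //; split; first by exists a.
by move=> u v; rewrite -ha !ba.
Qed.

Lemma at_distance_aut (a : tree d -> tree d) k u v : tree_aut a ->
  at_distance k u v -> at_distance k (a u) (a v).
Proof.
move=> aa; have [b [[_ hb] ab ba]] := tree_aut_inv aa; have [_ ha] := aa.
move=> [[p [p1 p2 p3]] hmin]; split.
  exists (map a p); split.
  - rewrite path_map; apply: sub_path p1 => x y; by rewrite /= ha.
  - by rewrite last_map p2.
  - by rewrite size_map.
move=> q q1 q2; rewrite -(size_map b); apply: hmin.
  rewrite -[u]ab path_map; apply: sub_path q1 => x y; by rewrite /= hb.
by rewrite -[u]ab last_map q2 ab.
Qed.

Lemma height_aut (a : tree d -> tree d) v : tree_aut a -> a (tree_root d) = tree_root d ->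
  height (a v) = height v.
Proof.
move=> aa a0; apply: height_at_distance; rewrite -a0.
exact: at_distance_aut (at_distance_root v).
Qed.

Section BranchSwap.
Variables (x y : 'I_d) (s : seq 'I_d).

Definition swap_letter (z : 'I_d) := if z == x then y else if z == y then x else z.

(* Exchanging the letters [x] and [y] at all places above [s] swaps the two
   branches at [s] starting with [x] and [y]. *)
Fixpoint swapw (w : seq 'I_d) : seq 'I_d :=
  if w is a :: t then (if suffix s t then swap_letter a else a) :: swapw t else [::].

Lemma swap_letterK : involutive swap_letter.
Proof.
move=> z; rewrite /swap_letter; case: (eqVneq z x) => [->|zx].
  by case: (eqVneq y x) => [//|yx]; rewrite eqxx.
case: (eqVneq z y) => [->|zy]; first by rewrite eqxx.
by rewrite (negPf zx) (negPf zy).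
Qed.

Lemma suffix_consE a (t : seq 'I_d) : suffix s (a :: t) = (s == a :: t) || suffix s t.
Proof.
apply/suffixP/orP => [[[|b p] /= e]|[/eqP ->|/suffixP[p ->]]].
- by left; rewrite e.
- by right; case: e => _ ->; apply/suffixP; exists p.
- by exists [::].
- by exists (a :: p).
Qed.

Lemma size_swapw w : size (swapw w) = size w.
Proof. by elim: w => //= a w ->. Qed.

Lemma suffix_small (w : seq 'I_d) : (size w < size s)%N -> suffix s w = false.
Proof.
move=> lt; apply/negbTE/suffixP => -[p e]; move: lt.
by rewrite e size_cat ltnNge leq_addl.
Qed.

Lemma swapw_small w : (size w <= size s)%N -> swapw w = w.
Proof. by elim: w => //= a w IH lt; rewrite suffix_small // IH // ltnW. Qed.

(** Letters inside the suffix [s] are untouched, so whether a position lies above [s] can still be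
    read off after the swap; this makes the swap an involution. *)
Lemma suffix_swapw w : suffix s (swapw w) = suffix s w.
Proof.
elim: w => [//|a w IH]; rewrite [swapw _]/= !suffix_consE IH.
case sw: (suffix s w); first by rewrite !orbT.
rewrite !orbF; have [le|lt] := leqP (size w) (size s); first by rewrite swapw_small.
have ne b t : size t = size w -> (s == b :: t) = false.
  by move=> e; apply/negP => /eqP e'; move: lt; rewrite e' /= e; lia.
by rewrite !ne // size_swapw.
Qed.

Lemma swapwK : involutive swapw.
Proof.
elim=> [//|a w IH] /=; rewrite suffix_swapw IH.
by case: (suffix s w); rewrite ?swap_letterK.
Qed.

Hypothesis hxy : reduced (x :: s) /\ reduced (y :: s).

Lemma swapw_reduced w : reduced w -> reduced (swapw w).
Proof.
rewrite /reduced; elim: w => [//|a [|b t] IH] //= /andP[ab pt].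
have := IH pt; rewrite /= => ->; rewrite andbT.
rewrite -/(suffix s (b :: t)) suffix_consE; case st: (suffix s t).
  by rewrite orbT (can_eq swap_letterK).
(* Here the letter [a] sits directly above [s] and is swapped while [b] is not: this is where
   [x :: s] and [y :: s] must both be reduced. *)
rewrite orbF; case: (eqVneq s (b :: t)) => [e|//].
move: hxy; rewrite /reduced e /= => -[/andP[xb _] /andP[yb _]].
by rewrite /swap_letter; case: ifP => _ //; case: ifP.
Qed.

Definition swap_branch (v : tree d) : tree d :=
  exist _ (swapw (val v)) (swapw_reduced (valP v)).

Lemma swap_branchK : involutive swap_branch.
Proof. by move=> v; apply: val_inj; rewrite /= swapwK. Qed.

Lemma swap_branch_aut : tree_aut swap_branch.
Proof.
have H u v : child u v -> child (swap_branch u) (swap_branch v).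
  rewrite /child /=; case: (val u) => [//|a t] /= /eqP e.
  by rewrite -e.
have E u v : child (swap_branch u) (swap_branch v) = child u v.
  by apply/idP/idP => /H //; rewrite !swap_branchK.
split; first by exists swap_branch; exact: swap_branchK.
by move=> u v; rewrite /tree_adj !E.
Qed.

End BranchSwap.

(** Induction along the words: an automorphism matching the parents sends [v] to a child of the
    parent of [v'], and a branch swap at that parent corrects the child. The swap fixes the root, as
    it changes only words longer than its base. *)
Lemma sphere_transitive (v v' : tree d) : height v = height v' ->
  exists a, [/\ tree_aut a, a (tree_root d) = tree_root d & a v = v'].
Proof.
case: v v' => w rw [w' rw']; rewrite /height /=.
elim: w w' rw rw' => [|x w IH] [|y w'] rw rw' //= => [_|[e]].
  by exists id; split=> //; [split=> //; exists id|exact: val_inj].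
have rt : reduced w by move: rw; rewrite /reduced /= => /path_sorted.
have rt' : reduced w' by move: rw'; rewrite /reduced /= => /path_sorted.
have [a [aa a0 aw]] := IH w' rt rt' e.
set v : tree d := exist _ (x :: w) rw; set v' : tree d := exist _ (y :: w') rw'.
have hv : height (a v) = (size w').+1 by rewrite height_aut // /height /= e.
have vadj : tree_adj (exist _ w rt) v by rewrite /tree_adj /child /= eqxx orbT.
have : tree_adj (exist _ w' rt') (a v) by rewrite -aw; case: aa => _ ->.
rewrite /tree_adj /child /= => /orP[/andP[h1 /eqP h2]|/andP[_ /eqP h2]].
  by have := congr1 size h2; rewrite size_behead -[RHS]/(height (a v)) hv /=; lia.
have := erefl (val (a v)); case: {2}(val (a v)) => [|z t] E.
  by move: hv; rewrite /height E.
have {h2} tE : t = w' by move: h2; rewrite -[sval _]/(val (a v)) E.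
subst t.
have rz : reduced (z :: w') by rewrite -E (valP (a v)).
exists (swap_branch (conj rz rw') \o a); split.
- exact: tree_aut_comp (swap_branch_aut _) aa.
- by rewrite /= a0; apply: val_inj.
- apply: val_inj; rewrite /= E /= suffix_refl swapw_small // /swap_letter eqxx.
  by [].
Qed.

End TreeGeometry.

(** * The product measure *)

Section ProductMeasure.
Variables (R : realType) (d : nat).
Notation Om := (labelling R d).

Definition rect (s : seq (tree d)) (B : tree d -> set R) : set Om :=
  [set w | forall v, v \in s -> B v (val (w v))].

Lemma rect_undup s B : rect (undup s) B = rect s B.
Proof. by apply/seteqP; split=> w h v; have := h v; rewrite mem_undup. Qed.

Lemma rectI s s' B B' : rect s B `&` rect s' B' =
  rect (s ++ s') (fun v => (if v \in s then B v else setT) `&` (if v \in s' then B' v else setT)).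
Proof.
apply/seteqP; split=> [w [h h'] v|w h].
  by move=> _; split; case: ifP => // vs; [exact: h|exact: h'].
split=> v vs; have := h v; rewrite mem_cat vs ?orbT => /(_ isT) [] //.
Qed.

Lemma cylinder_measurable v (B : set R) : measurable B ->
  measurable ([set w | B (val (w v))] : set Om).
Proof. by move=> mB; apply: sub_sigma_algebra; exists v, B. Qed.

Lemma coord_measurable v : measurable_fun setT (fun w : Om => val (w v) : R).
Proof. by move=> _ B mB; rewrite setTI; exact: cylinder_measurable. Qed.

Lemma rect_measurable s B : (forall v, measurable (B v)) -> measurable (rect s B).
Proof.
move=> mB; elim: s => [|v s IH].
  by rewrite (_ : rect _ _ = setT) //; apply/seteqP; split.
rewrite (_ : rect _ _ = [set w | B v (val (w v))] `&` rect s B).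
  by apply: measurableI => //; exact: cylinder_measurable.
apply/seteqP; split=> [w h|w [h1 h2] u].
  by split=> [|u us]; apply: h; rewrite in_cons ?eqxx ?us ?orbT.
by rewrite in_cons => /orP[/eqP ->|]; [exact: h1|exact: h2].
Qed.

Definition rects : set (set Om) :=
  [set C | exists s B, (forall v, measurable (B v)) /\ C = rect s B].

Lemma rects_setI : setI_closed rects.
Proof.
move=> _ _ [s [B [mB ->]]] [s' [B' [mB' ->]]].
eexists; eexists; split; last exact: rectI.
by move=> v; apply: measurableI; case: ifP.
Qed.

Lemma rects_generate : @measurable _ Om = <<s rects >>.
Proof.
apply/seteqP; split.
  apply: smallest_sub; first exact: smallest_sigma_algebra.
  move=> _ [v [B [mB ->]]]; apply: sub_sigma_algebra.
  exists [:: v], (fun=> B); split=> //; apply/seteqP; split=> [w h u|w h].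
    by rewrite inE => /eqP ->.
  by apply: h; rewrite inE.
apply: smallest_sub; first exact: sigma_algebra_measurable.
by move=> _ [s [B [mB ->]]]; exact: rect_measurable.
Qed.

Definition relabel (a : tree d -> tree d) (w : Om) : Om := w \o a.

Lemma relabel_measurable a : measurable_fun setT (relabel a).
Proof.
apply: (@measurability _ _ Om Om setT (relabel a) (@cylinders R d)) => //.
move=> _ [_ [v [B [mB ->]]] <-]; rewrite setTI; exact: cylinder_measurable.
Qed.

Definition unif_mass (B : set R) : R := fine (lebesgue_measure (B `&` `[0, 1])).

Variable P : probability Om R.
Hypothesis HP : is_lebesgue_product P.

Lemma product_rect s B : (forall v, measurable (B v)) -> uniq s ->
  P (rect s B) = (\prod_(v <- s) unif_mass (B v))%:E.
Proof. by move=> mB us; exact: HP. Qed.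

(** Rectangles form a generating pi-system, and on them a relabelling by a bijection merely permutes
    the factors of the product. *)
Lemma relabel_invariant a (E : set Om) : bijective a -> measurable E ->
  P (relabel a @^-1` E) = P E.
Proof.
move=> [b ab ba] mE; pose X : {mfun Om >-> Om} := mfun_Sub (mem_set (@relabel_measurable a)).
apply: (@measure_unique _ R Om rects (fun=> setT) rects_generate rects_setI _ _
  (distribution P X) P _ _ E mE).
- move=> _; exists [::], (fun=> setT); split; first by move=> v; exact: measurableT.
  by apply/seteqP; split.
- by rewrite bigcup_const //; exists 0%N.
- move=> _ [s [B [mB ->]]]; rewrite -rect_undup.
  transitivity (P (rect (map a (undup s)) (B \o b))).
    rewrite /= /distribution /pushforward; congr (P _).
    apply/seteqP; split=> w /= h v.
      by move=> /mapP[u us ->]; rewrite /= ab; exact: h.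
    by move=> vs; have := h (a v); rewrite /= ab => h'; apply/h'/map_f.
  transitivity (P (rect (undup s) B)); last by [].
  have mBb v : measurable ((B \o b) v) by exact: mB.
  rewrite !product_rect ?undup_uniq //; last first.
    by rewrite map_inj_uniq ?undup_uniq //; exact: can_inj ab.
  by congr EFin; rewrite big_map; apply: eq_bigr => v _; rewrite /= ab.
- by move=> _; exact: (le_lt_trans (probability_le1 _ _) (ltry _)).
Qed.

Lemma relabel_integrable a (f : Om -> R) : bijective a -> measurable_fun setT f ->
  P.-integrable setT (EFin \o f) -> P.-integrable setT (EFin \o (f \o relabel a)).
Proof.
move=> ba mf intf.
pose X : {mfun Om >-> Om} := mfun_Sub (mem_set (@relabel_measurable a)).
have e E : measurable E -> P E = distribution P X E.
  by move=> mE; rewrite -(relabel_invariant ba mE).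
apply/integrableP; split.
  by apply/measurable_EFinP; apply: measurableT_comp => //; exact: relabel_measurable.
move/integrableP: intf => [mf' lt]; apply: le_lt_trans lt.
rewrite [leRHS](eq_measure_integral (distribution P X)); last by move=> A mA _; exact: e.
by rewrite ge0_integral_pushforward //; apply: (measurableT_comp (@abse_measurable _ setT) mf').
Qed.

Lemma relabel_Rintegral a (f : Om -> R) : bijective a -> measurable_fun setT f ->
  P.-integrable setT (EFin \o f) -> \int[P]_w f (relabel a w) = \int[P]_w f w.
Proof.
move=> ba mf intf.
pose X : {mfun Om >-> Om} := mfun_Sub (mem_set (@relabel_measurable a)).
have e E : measurable E -> P E = distribution P X E.
  by move=> mE; rewrite -(relabel_invariant ba mE).
rewrite /Rintegral [in RHS](eq_measure_integral (distribution P X)); last first.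
  by move=> A mA _; exact: e.
rewrite integral_pushforward //; first exact/measurable_EFinP.
exact: (relabel_integrable ba mf intf).
Qed.

End ProductMeasure.

(** * The inner product of square-integrable functions *)

Section SquareIntegrable.
Context d (T : measurableType d) (R : realType) (P : probability T R).
Implicit Types f g h : T -> R.

Definition sqint f := measurable_fun setT f /\
  P.-integrable setT (EFin \o (fun x => f x ^+ 2)).

Definition ip f g : R := \int[P]_x (f x * g x).

Lemma sqint_mul f g : sqint f -> sqint g -> P.-integrable setT (EFin \o (fun x => f x * g x)).
Proof.
move=> [mf if2] [mg ig2].
have ifg := integrableD measurableT if2 ig2.
apply: le_integrable ifg => //.
  by apply/measurable_EFinP; exact: measurable_funM.
move=> x _; rewrite /= lee_fin normrM [leRHS]ger0_norm ?addr_ge0 ?sqr_ge0 //.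
rewrite -(real_normK (num_real (f x))) -(real_normK (num_real (g x))).
have := sqr_ge0 (`|f x| - `|g x|); have := normr_ge0 (f x); have := normr_ge0 (g x).
by nra.
Qed.

Lemma sqint_bounded f (M : R) : measurable_fun setT f -> (forall x, `|f x| <= M) -> sqint f.
Proof.
move=> mf fM; split=> //; apply: (@bounded_integrable _ _ _ _ _ _ (M ^+ 2)) => //.
  exact: measurable_funX.
by move=> x; rewrite normrX lerXn2r ?nnegrE // (le_trans _ (fM x)).
Qed.

Lemma sqint_cst (k : R) : sqint (cst k).
Proof. by apply: (@sqint_bounded _ `|k|). Qed.

Lemma sqint_integrable f : sqint f -> P.-integrable setT (EFin \o f).
Proof.
move=> sf; have := sqint_mul sf (sqint_cst 1).
by congr (_.-integrable _ _); apply/funext => x; rewrite /= mulr1.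
Qed.

Lemma sqintZ (a : R) f : sqint f -> sqint (fun x => a * f x).
Proof.
move=> [mf if2]; split; first by apply: measurable_funM => //; exact: measurable_cst.
have := integrable_scale (a ^+ 2) measurableT if2.
by congr (_.-integrable _ _); apply/funext => x; rewrite /= exprMn.
Qed.

Lemma sqintD f g : sqint f -> sqint g -> sqint (fun x => f x + g x).
Proof.
move=> sf sg; split.
  by apply: measurable_funD; [exact: sf.1|exact: sg.1].
have := integrableD measurableT (integrableD measurableT sf.2 sg.2)
  (integrable_scale 2 measurableT (sqint_mul sf sg)).
by congr (_.-integrable _ _); apply/funext => x; rewrite /= -!EFinD; congr EFin; ring.
Qed.

Lemma sqintB f g : sqint f -> sqint g -> sqint (fun x => f x - g x).
Proof.
move=> sf /(sqintZ (-1)) /(sqintD sf); rewrite (_ : (fun=> _) = fun x => f x - g x) //.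
by apply/funext => x; rewrite mulN1r.
Qed.

Lemma sqint_sum (I : Type) (r : seq I) (F : I -> T -> R) : (forall i, sqint (F i)) ->
  sqint (fun x => \sum_(i <- r) F i x).
Proof.
move=> sF; elim: r => [|i r IH].
  by rewrite (_ : (fun=> _) = cst 0); [exact: sqint_cst|apply/funext => x; rewrite big_nil].
rewrite (_ : (fun=> _) = fun x => F i x + \sum_(j <- r) F j x); first exact: sqintD.
by apply/funext => x; rewrite big_cons.
Qed.

Lemma ipC f g : ip f g = ip g f.
Proof. by apply: eq_Rintegral => x _; rewrite mulrC. Qed.

Lemma eq_ip f g f' g' : f =1 f' -> g =1 g' -> ip f g = ip f' g'.
Proof. by move=> ff' gg'; apply: eq_Rintegral => x _; rewrite ff' gg'. Qed.

Lemma ipZl (a : R) f g : sqint f -> sqint g -> ip (fun x => a * f x) g = a * ip f g.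
Proof.
move=> sf sg; rewrite /ip -RintegralZl //; last exact: sqint_mul.
by apply: eq_Rintegral => x _; rewrite mulrA.
Qed.

Lemma ipDl f g h : sqint f -> sqint g -> sqint h ->
  ip (fun x => f x + g x) h = ip f h + ip g h.
Proof.
move=> sf sg sh; rewrite /ip -RintegralD //; try exact: sqint_mul.
by apply: eq_Rintegral => x _; rewrite mulrDl.
Qed.

Lemma ip_suml (I : Type) (r : seq I) (F : I -> T -> R) g : (forall i, sqint (F i)) -> sqint g ->
  ip (fun x => \sum_(i <- r) F i x) g = \sum_(i <- r) ip (F i) g.
Proof.
move=> sF sg; rewrite -Rintegral_sumr //; last by move=> i; exact: sqint_mul.
by apply: eq_Rintegral => x _; rewrite mulr_suml.
Qed.

Lemma ipZr (a : R) f g : sqint f -> sqint g -> ip f (fun x => a * g x) = a * ip f g.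
Proof. by move=> sf sg; rewrite ipC ipZl // ipC. Qed.

Lemma ipDr f g h : sqint f -> sqint g -> sqint h ->
  ip f (fun x => g x + h x) = ip f g + ip f h.
Proof. by move=> sf sg sh; rewrite ipC ipDl // ipC (ipC h). Qed.

Lemma ip_sumr (I : Type) (r : seq I) (F : I -> T -> R) g : (forall i, sqint (F i)) -> sqint g ->
  ip g (fun x => \sum_(i <- r) F i x) = \sum_(i <- r) ip g (F i).
Proof. by move=> sF sg; rewrite ipC ip_suml //; apply: eq_bigr => i _; rewrite ipC. Qed.

Lemma ipBl f g h : sqint f -> sqint g -> sqint h ->
  ip (fun x => f x - g x) h = ip f h - ip g h.
Proof.
move=> sf sg sh; rewrite -mulN1r -ipZl // -ipDl //; last exact: sqintZ.
by apply: eq_ip => // x; rewrite mulN1r.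
Qed.

Lemma ipBr f g h : sqint f -> sqint g -> sqint h ->
  ip f (fun x => g x - h x) = ip f g - ip f h.
Proof. by move=> sf sg sh; rewrite ipC ipBl // ipC (ipC h). Qed.

Lemma ip_ge0 f : 0 <= ip f f.
Proof. by apply: Rintegral_ge0 => x _; rewrite -expr2 sqr_ge0. Qed.

(** Cauchy-Schwarz in arithmetic-geometric form, from the positivity of the norms of s f + g and s f
    - g. The free [s] carries the weights of Schur's test and the small parameters of the
    approximations. *)
Lemma ip_amgm (s : R) f g : 0 < s -> sqint f -> sqint g ->
  `|ip f g| <= (s * ip f f + s^-1 * ip g g) / 2.
Proof.
move=> s0 sf sg.
have H (e : R) : e ^+ 2 = 1 -> 0 <= s ^+ 2 * ip f f + 2 * s * e * ip f g + ip g g.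
  move=> e1; have := ip_ge0 (fun x => s * f x + e * g x).
  have ssf := sqintZ s sf; have seg := sqintZ e sg.
  rewrite ipDl ?ipDr //; try exact: sqintD.
  rewrite !(ipZl, ipZr) // (ipC g f) => h; apply: le_trans h _.
  rewrite le_eqVlt; apply/orP; left; apply/eqP.
  by rewrite -[X in _ = _ + X]mul1r -[X in _ = _ + X * _]e1; ring.
have h1 := H 1 (expr1n _ _); have h2 : 0 <= s ^+ 2 * ip f f + 2 * s * -1 * ip f g + ip g g.
  by apply: H; rewrite sqrrN expr1n.
have -> : (s * ip f f + s^-1 * ip g g) / 2 = (s ^+ 2 * ip f f + ip g g) / (2 * s).
  by field; rewrite gt_eqF.
rewrite ler_pdivlMr ?mulr_gt0 //; case: (ger0P (ip f g)) => _; lra.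
Qed.

Lemma ip_normD f g : sqint f -> sqint g ->
  ip (fun x => f x + g x) (fun x => f x + g x) <= 2 * ip f f + 2 * ip g g.
Proof.
move=> sf sg; rewrite ipDl ?ipDr //; try exact: sqintD.
rewrite (ipC g f); have := ip_amgm ltr01 sf sg; have := ler_norm (ip f g).
by rewrite invr1; lra.
Qed.

End SquareIntegrable.

Section Correlation.
Context d (T : measurableType d) (R : realType) (P : probability T R).

Lemma corrE (X Y : T -> R) (m : R) : \int[P]_x X x = m -> \int[P]_x Y x = m ->
  corr P X Y = ip P (fun x => X x - m) (fun x => Y x - m) / ip P (fun x => X x - m) (fun x => X x - m).
Proof.
move=> mX mY; rewrite /corr /variance covariance.unlock.
by rewrite expectation.unlock -!/(Rintegral _ _ _) mX mY.
Qed.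

End Correlation.

(** * Orthogonal products of centred indicators *)

Section CylinderTerms.
Variables (R : realType) (d : nat).
Notation Om := (labelling R d).
Variable P : probability Om R.
Hypothesis HP : is_lebesgue_product P.

Definition centered (v : tree d) (B : set R) (w : Om) : R := \1_B (val (w v)) - unif_mass B.

(** Functions that ignore the label at [v], restricted to combinations of rectangles: for this
    inductive class, independence from the label at [v] follows from the product formula alone,
    without conditioning or iterated integrals. *)
Inductive cylfun (v : tree d) : (Om -> R) -> Prop :=
| cyl_rect s B : v \notin s -> (forall u, measurable (B u)) -> cylfun v \1_(rect s B)
| cyl_add f g : cylfun v f -> cylfun v g -> cylfun v (fun w => f w + g w)
| cyl_scale a f : cylfun v f -> cylfun v (fun w => a * f w).

Lemma eq_cylfun v f g : f =1 g -> cylfun v f -> cylfun v g.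
Proof. by move=> /funext ->. Qed.

Lemma cyl_measurable v f : cylfun v f ->
  measurable_fun setT f /\ exists M : R, forall w, `|f w| <= M.
Proof.
elim=> {f} [s B _ mB|f g _ [mf [M fM]] _ [mg [N gN]]|a f _ [mf [M fM]]].
- split; first by apply: measurable_indic; exact: rect_measurable.
  by exists 1 => w; rewrite indicE; case: (_ \in _); rewrite ?normr1 ?normr0.
- split; first exact: measurable_funD.
  by exists (M + N) => w; apply: le_trans (ler_normD _ _) (lerD _ _).
- split; first by apply: measurable_funM => //; exact: measurable_cst.
  by exists (`|a| * M) => w; rewrite normrM ler_wpM2l.
Qed.

Lemma cyl_sqint v f : cylfun v f -> sqint P f.
Proof. by move=> /cyl_measurable [mf [M fM]]; exact: sqint_bounded fM. Qed.

Lemma indicI_mul (T : Type) (A B : set T) x : \1_A x * \1_B x = \1_(A `&` B) x :> R.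
Proof. by rewrite !indicE in_setI; do 2 case: (_ \in _); rewrite ?mulr1 ?mulr0. Qed.

Lemma cyl_mul v f g : cylfun v f -> cylfun v g -> cylfun v (fun w => f w * g w).
Proof.
move=> cf; elim: cf g => {f} [s B vs mB|f1 f2 _ IH1 _ IH2|a f _ IH] g cg.
- elim: cg => {g} [s' B' vs' mB'|g1 g2 _ IH1 _ IH2|a g _ IH].
  + apply: (@eq_cylfun v (\1_(rect s B `&` rect s' B'))).
      by move=> w; rewrite -indicI_mul.
    rewrite rectI; apply: cyl_rect; first by rewrite mem_cat negb_or vs vs'.
    by move=> u; apply: measurableI; case: ifP.
  + by apply: eq_cylfun (cyl_add IH1 IH2) => w; rewrite mulrDr.
  + by apply: eq_cylfun (cyl_scale a IH) => w; rewrite mulrCA.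
- by apply: eq_cylfun (cyl_add (IH1 g cg) (IH2 g cg)) => w; rewrite mulrDl.
- by apply: eq_cylfun (cyl_scale a (IH g cg)) => w; rewrite mulrA.
Qed.

Lemma rect_nil (B : tree d -> set R) : rect [::] B = (setT : set Om).
Proof. by apply/seteqP; split. Qed.

Lemma cyl_cst v (k : R) : cylfun v (cst k).
Proof.
apply: eq_cylfun (cyl_scale k (@cyl_rect v [::] (fun=> setT) _ _)) => //.
by move=> w; rewrite /= rect_nil indicT mulr1.
Qed.

Lemma indic_coord (u : tree d) (B : set R) (w : Om) :
  \1_B (val (w u)) = \1_(rect [:: u] (fun=> B)) w :> R.
Proof.
rewrite !indicE; congr (nat_of_bool _)%:R.
apply/idP/idP => /set_mem h; apply/mem_set.
  by move=> v; rewrite inE => /eqP ->.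
by apply: h; rewrite inE.
Qed.

Lemma cyl_centered v u B : u != v -> measurable B -> cylfun v (centered u B).
Proof.
move=> uv mB; have vu : v \notin [:: u] by rewrite inE eq_sym.
apply: eq_cylfun (cyl_add (cyl_rect vu (fun=> mB)) (cyl_cst v (- unif_mass B))).
by move=> w; rewrite /centered indic_coord.
Qed.

Lemma cyl_prod v (s : seq (tree d)) (B : tree d -> set R) : v \notin s ->
  (forall u, measurable (B u)) -> cylfun v (fun w => \prod_(u <- s) centered u (B u) w).
Proof.
move=> + mB; elim: s => [_|u s IH].
  by apply: eq_cylfun (cyl_cst v 1) => w; rewrite big_nil.
rewrite inE negb_or eq_sym => /andP[uv vs].
apply: eq_cylfun (cyl_mul (cyl_centered uv (mB u)) (IH vs)).
by move=> w; rewrite big_cons.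
Qed.

Lemma centered_sqint v B : measurable B -> sqint P (centered v B).
Proof.
move=> mB; apply: sqintB; last exact: sqint_cst.
apply: (@sqint_bounded _ _ _ _ _ 1).
  by apply: measurableT_comp (@coord_measurable R d v); exact: measurable_indic.
by move=> w; rewrite indicE; case: (_ \in _); rewrite ?normr1 ?normr0.
Qed.

Lemma Rintegral_indicE (E : set Om) : measurable E -> \int[P]_w (\1_E w : R) = fine (P E).
Proof. by move=> mE; rewrite /Rintegral integral_indic // setIT. Qed.

(** On a rectangle avoiding [v], the product formula splits off the factor [unif_mass B], which the
    centring subtracts; the other cases are linear. *)
Lemma centered_indep v B G : measurable B -> cylfun v G -> ip P (centered v B) G = 0.
Proof.
move=> mB; have sc := centered_sqint v mB; elim=> {G} [s C vs mC|f g cf If cg Ig|a f cf If].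
- have mR : sqint P \1_(rect s C) by exact: (cyl_sqint (cyl_rect vs mC)).
  pose C' u := if u == v then B else C u.
  have mC' u : measurable (C' u) by rewrite /C'; case: ifP.
  have -> : ip P (centered v B) \1_(rect s C) =
      ip P \1_(rect (v :: s) C') (cst 1) - unif_mass B * ip P (cst 1) \1_(rect s C).
    have m' : sqint P \1_(rect (v :: s) C').
      apply: (@sqint_bounded _ _ _ _ _ 1).
        by apply: measurable_indic; exact: rect_measurable.
      by move=> w; rewrite indicE; case: (_ \in _); rewrite ?normr1 ?normr0.
    rewrite /ip -RintegralZl //; last by apply: sqint_mul => //; exact: sqint_cst.
    rewrite -RintegralB //.
    - apply: eq_Rintegral => w _; rewrite /centered indic_coord mulrBl mul1r; congr (_ - _).
      rewrite indicI_mul mulr1; congr (\1_ _ w); apply/seteqP; split.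
        move=> {}w [h1 h2] u; rewrite inE /C'; case: eqVneq => [-> _|_ /= us].
          by apply: (h1 v); rewrite inE.
        exact: h2.
      move=> {}w h; split=> u.
        by rewrite inE => /eqP ->; have := h v; rewrite inE eqxx /C' eqxx; apply.
      move=> us; have := h u; rewrite inE us orbT /C'; case: eqVneq => [e|_]; last exact.
      by move: vs; rewrite -e us.
    - by apply: sqint_mul => //; exact: sqint_cst.
    - by apply: integrable_scale => //; apply: sqint_mul => //; exact: sqint_cst.
  rewrite /ip; under eq_Rintegral do rewrite mulr1.
  under [X in _ - _ * X]eq_Rintegral do rewrite mul1r.
  rewrite !Rintegral_indicE; try exact: rect_measurable.
  rewrite -[rect (v :: s) C']rect_undup -[rect s C]rect_undup /= (negPf vs).
  have us' : uniq (v :: undup s) by rewrite /= undup_uniq mem_undup vs.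
  rewrite !(product_rect HP) ?undup_uniq //= big_cons {1}/C' eqxx.
  rewrite [X in _ * X - _](_ : _ = \prod_(u <- undup s) unif_mass (C u)) ?subrr //.
  rewrite !big_seq; apply: eq_bigr => u; rewrite mem_undup /C' => us.
  by case: eqVneq us => // ->; rewrite (negPf vs).
- by rewrite ipDr ?If ?Ig ?addr0 //; [exact: (cyl_sqint cf)|exact: (cyl_sqint cg)].
- by rewrite ipZr ?If ?mulr0 //; exact: (cyl_sqint cf).
Qed.

(** An element of the component indexed by [A] in the Efron-Stein (Hoeffding) decomposition: it
    depends on the labels in [A] and averages to zero over each of them. *)
Definition term (A : {fset tree d}) (B : tree d -> set R) (w : Om) : R :=
  \prod_(v <- A) centered v (B v) w.

Lemma prod_cyl_sqint (s : seq (tree d)) (B : tree d -> set R) :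
  (forall u, measurable (B u)) -> sqint P (fun w => \prod_(u <- s) centered u (B u) w).
Proof.
move=> mB; suff [mf [M fM]] : measurable_fun setT (fun w => \prod_(u <- s) centered u (B u) w)
    /\ exists M : R, forall w, `|\prod_(u <- s) centered u (B u) w| <= M.
  exact: sqint_bounded fM.
elim: s => [|u s [m1 [M fM]]].
  split.
    rewrite (_ : (fun w : Om => _) = cst 1); first exact: measurable_cst.
    by apply/funext => w; rewrite big_nil.
  by exists 1 => w; rewrite big_nil normr1.
split.
  rewrite (_ : (fun w : Om => _) =
    fun w => centered u (B u) w * \prod_(v <- s) centered v (B v) w).
    by apply: measurable_funM => //; exact: (centered_sqint u (mB u)).1.
  by apply/funext => w; rewrite big_cons.
exists ((1 + `|unif_mass (B u)|) * M) => w; rewrite big_cons normrM ler_pM //.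
apply: le_trans (ler_normB _ _) _; rewrite lerD2r indicE.
by case: (_ \in _); rewrite ?normr1 ?normr0.
Qed.

Lemma term_sqint A B : (forall u, measurable (B u)) -> sqint P (term A B).
Proof. exact: prod_cyl_sqint. Qed.

(** A vertex in one set and not in the other contributes a centred factor independent of all the
    rest. *)
Lemma term_orth A A' B B' : (forall u, measurable (B u)) -> (forall u, measurable (B' u)) ->
  A != A' -> ip P (term A B) (term A' B') = 0.
Proof.
suff H (C C' : {fset tree d}) D D' v : (forall u, measurable (D u)) ->
    (forall u, measurable (D' u)) -> v \in C -> v \notin C' ->
    ip P (term C D) (term C' D') = 0.
  move=> mB mB' AA'; have [v] : exists v, (v \in A) != (v \in A').
    apply: contrapT => h; move/eqP: AA'; apply; apply/fsetP => v; apply/eqP.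
    by apply/negPn/negP => h'; apply: h; exists v.
  case vA: (v \in A); case vA': (v \in A') => // _; first by apply: (H _ _ _ _ v); rewrite ?vA'.
  by rewrite ipC; apply: (H _ _ _ _ v); rewrite ?vA.
move=> mD mD' vC vC'.
pose G w := (\prod_(u <- rem v C) centered u (D u) w) * term C' D' w.
have cG : cylfun v G.
  by apply: cyl_mul; apply: cyl_prod => //; rewrite mem_rem_uniqF // fset_uniq.
rewrite -(centered_indep (mD v) cG); apply: eq_Rintegral => w _.
rewrite /G mulrA; congr (_ * _); rewrite /term.
by rewrite (perm_big _ (perm_to_rem vC)) big_cons.
Qed.

Lemma term_relabel (i : 'I_d) A B w :
  term A B (relabel (rmul i) w) = term [fset rmul i v | v in A]%fset (B \o rmul i) w.
Proof.
rewrite /term big_imfset /=; last by move=> u v _ _; exact: rmul_inj.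
by apply: eq_bigr => v _; rewrite rmulK.
Qed.

End CylinderTerms.

(** * Induction principles for square-integrable functions *)

Import HBSimple HBNNSimple.

Section SquareIntegrableInduction.
Context d (T : measurableType d) (R : realType) (P : probability T R).

Lemma ip_dominated (f : T -> R) (g : nat -> T -> R) : sqint P f ->
  (forall n, measurable_fun setT (g n)) -> (forall n x, `|g n x| <= `|f x|) ->
  (forall x, (fun n => g n x) @ \oo --> f x) ->
  (fun n => ip P (fun x => f x - g n x) (fun x => f x - g n x)) @ \oo --> (0 : R).
Proof.
move=> [mf if2] mg gf gcvg.
have := @dominated_convergence _ _ _ P setT measurableT
  (fun n => EFin \o (fun x => (f x - g n x) * (f x - g n x))) (cst 0%E)
  (fun x => (4 * f x ^+ 2)%:E).
case.
- move=> n; apply/measurable_EFinP.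
  by apply: measurable_funM; exact: measurable_funB.
- exact: measurable_cst.
- apply: aeW => x _; apply: cvg_EFin; first by apply: nearW.
  rewrite (_ : fine \o _ = (fun n => (f x - g n x) * (f x - g n x))) //=.
  have h : (fun n => f x - g n x) @ \oo --> (0 : R).
    by rewrite -(subrr (f x)); apply: cvgB; [exact: cvg_cst|exact: gcvg].
  by rewrite -[X in _ --> X](mul0r (0 : R)); exact: cvgM.
- exact: (integrable_scale 4 measurableT if2).
- apply: aeW => x n _; rewrite /= lee_fin normrM -expr2.
  rewrite -(real_normK (num_real (f x))).
  have h : `|f x - g n x| <= 2 * `|f x|.
    by apply: le_trans (ler_normB _ _) _; have := gf n x; lra.
  have -> : 4 * `|f x| ^+ 2 = (2 * `|f x|) ^+ 2 by ring.
  by rewrite lerXn2r // nnegrE // mulr_ge0.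
move=> _ _; rewrite integral_cst // mul0e => /fine_cvg; exact.
Qed.

Variable Q : (T -> R) -> Prop.
Hypothesis Q_indic : forall E, measurable E -> Q \1_E.
Hypothesis Q_add : forall f g, Q f -> Q g -> Q (fun x => f x + g x).
Hypothesis Q_scale : forall (a : R) f, Q f -> Q (fun x => a * f x).
Hypothesis Q_lim : forall f (g : nat -> T -> R), sqint P f -> (forall n, sqint P (g n)) ->
  (forall n, Q (g n)) ->
  (fun n => ip P (fun x => f x - g n x) (fun x => f x - g n x)) @ \oo --> (0 : R) -> Q f.

Let Q_sum n (F : 'I_n -> T -> R) : (forall i, Q (F i)) -> Q (fun x => \sum_(i < n) F i x).
Proof.
move=> QF; elim: n F QF => [|n IH] F QF.
  rewrite (_ : (fun=> _) = (fun x => 0 * \1_setT x)); first by apply: Q_scale; exact: Q_indic.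
  by apply/funext => x; rewrite big_ord0 mul0r.
rewrite (_ : (fun=> _) = (fun x => F ord0 x + \sum_(i < n) F (lift ord0 i) x)).
  by apply: Q_add => //; exact: IH.
by apply/funext => x; rewrite big_ord_recl.
Qed.

Let Q_nonneg f : sqint P f -> (forall x, 0 <= f x) -> Q f.
Proof.
move=> sf f0; have mf : measurable_fun setT (EFin \o f) by apply/measurable_EFinP; exact: sf.1.
pose g n := nnsfun_approx measurableT mf n.
have g0 n x : 0 <= g n x by [].
have gf n x : `|g n x| <= `|f x|.
  rewrite !ger0_norm // -lee_fin nnsfun_approxE; apply: (le_approx (f := EFin \o f)) => //.
  by move=> t _; rewrite /= lee_fin.
have mg n : measurable_fun setT (g n) by [].
apply: (@Q_lim f g) => //.
- move=> n; split; first exact: mg.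
  apply: le_integrable sf.2 => //.
    by apply/measurable_EFinP; exact: measurable_funX.
  by move=> x _; rewrite /= lee_fin !normrX lerXn2r ?nnegrE.
- move=> n; rewrite (_ : (g n : T -> R) = (fun x => \sum_(i < #|` fset_set (range (g n))|)
     ((fset_set (range (g n)))`_i * \1_(g n @^-1` [set (fset_set (range (g n)))`_i]) x))).
    by apply: Q_sum => i; apply: Q_scale; apply: Q_indic; exact: measurable_funPTI.
  by apply/funext => x; rewrite {1}fimfunEord.
- apply: ip_dominated => // x.
  have h := @cvg_nnsfun_approx _ _ _ _ measurableT _ mf (fun t _ => f0 t) x I.
  by move/fine_cvg: h.
Qed.

(** The usual passage from indicators to simple functions, nonnegative functions and differences,
    with limits taken in square mean. *)
Lemma sqint_ind f : sqint P f -> Q f.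
Proof.
move=> sf; have mf := sf.1.
have sp (g : T -> R) : measurable_fun setT g -> (forall x, `|g x| <= `|f x|) -> sqint P g.
  move=> mg gf; split=> //; apply: le_integrable sf.2 => //.
    by apply/measurable_EFinP; exact: measurable_funX.
  by move=> x _; rewrite /= lee_fin !normrX lerXn2r ?nnegrE.
have mx (a : R) : `|Num.max a 0| <= `|a|.
  by case: (leP a 0) => h; rewrite ?normr0.
rewrite (_ : f = fun x => Num.max (f x) 0 + (-1) * Num.max (- f x) 0).
  apply: Q_add; last apply: Q_scale.
    apply: Q_nonneg; last by move=> x; rewrite le_max lexx orbT.
    by apply: sp => //; apply: measurable_maxr => //; exact: measurable_cst.
  apply: Q_nonneg; last by move=> x; rewrite le_max lexx orbT.
  apply: sp; first by apply: measurable_maxr; [exact: measurable_funN|exact: measurable_cst].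
  by move=> x; rewrite -(normrN (f x)).
apply/funext => x; case: (leP (f x) 0) => h; case: (leP (- f x) 0) => h'; lra.
Qed.

End SquareIntegrableInduction.

Section RectangleInduction.
Variables (R : realType) (d : nat).
Notation Om := (labelling R d).
Variable P : probability Om R.

Variable Q : (Om -> R) -> Prop.
Hypothesis Q_rect : forall s (B : tree d -> set R), uniq s -> (forall v, measurable (B v)) ->
  Q \1_(rect s B).
Hypothesis Q_add : forall f g, Q f -> Q g -> Q (fun x => f x + g x).
Hypothesis Q_scale : forall (a : R) f, Q f -> Q (fun x => a * f x).
Hypothesis Q_lim : forall f (g : nat -> Om -> R), sqint P f -> (forall n, sqint P (g n)) ->
  (forall n, Q (g n)) ->
  (fun n => ip P (fun x => f x - g n x) (fun x => f x - g n x)) @ \oo --> (0 : R) -> Q f.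

Lemma indic_sqint (E : set Om) : measurable E -> sqint P \1_E.
Proof.
move=> mE; apply: (@sqint_bounded _ _ _ _ _ 1); first exact: measurable_indic.
by move=> x; rewrite indicE; case: (_ \in _); rewrite ?normr1 ?normr0.
Qed.

(** Dynkin's theorem reduces indicators to those of rectangles; a disjoint union is the limit in
    square mean of its partial unions. *)
Lemma sqint_rect_ind f : sqint P f -> Q f.
Proof.
have Q1 : Q \1_setT by rewrite -(rect_nil (fun=> setT)); apply: Q_rect.
apply: sqint_ind => // E; rewrite rects_generate; move: E.
apply: (@dynkin_induction _ Om (@rects R d) (fun E => Q \1_E)) => //.
- exact: rects_generate.
- exact: rects_setI.
- move=> _ [s [B [mB ->]]]; rewrite -rect_undup; apply: Q_rect => //; exact: undup_uniq.
- move=> S mS QS; rewrite (_ : \1_(~` S) = (fun x => \1_setT x + (-1) * \1_S x)).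
    by apply: Q_add => //; exact: Q_scale.
  apply/funext => x; rewrite !indicE in_setC in_setT.
  by case: (_ \in _) => /=; ring.
- move=> F mF tF QF.
  pose g n (x : Om) : R := \sum_(k < n) \1_(F k) x.
  have mb : measurable (\bigcup_k F k) by exact: bigcup_measurable.
  have gE n x : g n x = \1_(\bigcup_(k < n) F k) x.
    rewrite /g; elim: n => [|n IH].
      by rewrite big_ord0 bigcup_mkord big_ord0 indic0.
    rewrite big_ord_recr /= IH !bigcup_mkord big_ord_recr /= [RHS]indicE in_setU.
    rewrite !indicE; case xU: (x \in \big[setU/set0]_(i < n) F i); last by rewrite add0r.
    case xF: (x \in F n); last by rewrite addr0.
    move/set_mem: xU; rewrite -bigcup_mkord => -[k /= kn Fk].
    by have := tF k n I I (ex_intro _ x (conj Fk (set_mem xF))) => e; rewrite e ltnn in kn.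
  have mbn n : measurable (\bigcup_(k < n) F k) by exact: bigcup_measurable.
  have gE' n : g n = \1_(\bigcup_(k < n) F k) by apply/funext => x; exact: gE.
  apply: (@Q_lim _ g).
  + exact: indic_sqint.
  + by move=> n; rewrite gE'; exact: indic_sqint.
  + move=> n; rewrite /g; elim: n => [|n IH].
      rewrite (_ : (fun=> _) = (fun x : Om => 0 * \1_setT x)); first exact: Q_scale.
      by apply/funext => x; rewrite big_ord0 mul0r.
    rewrite (_ : (fun=> _) = (fun x : Om => (\sum_(k < n) \1_(F k) x) + \1_(F n) x)).
      exact: Q_add.
    by apply/funext => x; rewrite big_ord_recr.
  + apply: ip_dominated.
    * exact: indic_sqint.
    * by move=> n; rewrite gE'; exact: measurable_indic.
    * move=> n x; rewrite gE !indicE; case xb: (x \in \bigcup_(_ < _) _); last first.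
        by rewrite normr0.
      rewrite (_ : x \in \bigcup_k F k) // ; apply/mem_set.
      by move/set_mem: xb => -[k _ Fk]; exists k.
    * move=> x; case: (pselect ((\bigcup_k F k) x)) => [[k _ Fk]|nF].
        apply: cvg_near_cst; exists k.+1 => // n /= kn; rewrite gE !indicE.
        by rewrite !mem_set //; exists k.
      rewrite (_ : g^~ x = cst 0); first by rewrite indicE memNset //; exact: cvg_cst.
      apply/funext => n; rewrite gE indicE memNset //.
      by move=> -[k _ Fk]; apply: nF; exists k.
Qed.

End RectangleInduction.

(** * The spectral bound for factors *)

Section SpectralBound.
Variables (R : realType) (d : nat).
Hypothesis hd : (2 <= d)%N.
Notation Om := (labelling R d).
Variable P : probability Om R.
Hypothesis HP : is_lebesgue_product P.

(** Combinations of terms are kept as lists of data rather than as functions, so that they can be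
    regrouped by their sets and the empty sets filtered out. *)
Definition tdata : Type :=
  R * {fset tree d} * {B : tree d -> set R | forall v, measurable (B v)}.

Definition tterm (t : tdata) (w : Om) : R := t.1.1 * term t.1.2 (sval t.2) w.

Definition ev (l : seq tdata) (w : Om) : R := \sum_(t <- l) tterm t w.

Lemma tterm_sqint t : sqint P (tterm t).
Proof. by apply: sqintZ; apply: term_sqint => v; exact: (svalP t.2). Qed.

Lemma ev_sqint l : sqint P (ev l).
Proof. by apply: sqint_sum => t; exact: tterm_sqint. Qed.

Lemma rect_ev s (B : tree d -> set R) : uniq s -> (forall v, measurable (B v)) ->
  exists l, \1_(rect s B) = ev l.
Proof.
move=> + mB; pose b : {B : tree d -> set R | forall v, measurable (B v)} := exist _ B mB.
suff H : uniq s -> exists l : seq (R * {fset tree d}),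
    (forall t, t \in l -> {subset t.2 <= s}) /\
    \1_(rect s B) = ev [seq (t, b) | t <- l].
  by move=> /H [l [_ e]]; exists [seq (t, b) | t <- l].
elim: s => [_|v s IH /= /andP[vs us]].
  exists [:: (1, fset0)]; split.
    by move=> t; rewrite inE => /eqP -> v; rewrite /= inE.
  apply/funext => w; rewrite rect_nil indicT /ev /= big_seq1 /tterm /= /term.
  by rewrite big_seq_fset0 mulr1.
have [l [ls e]] := IH us.
(* Writing the indicator at [v] as its centred part plus its mass either adjoins [v] to the set or
   rescales the coefficient. The sets stay inside [s], so [v] is new to them. *)
exists ([seq (t.1, v |` t.2)%fset | t <- l] ++ [seq (unif_mass (B v) * t.1, t.2) | t <- l]).
split.
  move=> t; rewrite mem_cat => /orP[] /mapP[t' t'l ->] u /=.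
    rewrite in_fset1U inE => /orP[->//|/(ls _ t'l) ->]; by rewrite orbT.
  by move=> /(ls _ t'l) us'; rewrite inE us' orbT.
apply/funext => w.
have -> : \1_(rect (v :: s) B) w = (centered v (B v) w + unif_mass (B v)) * \1_(rect s B) w :> R.
  rewrite /centered subrK indic_coord indicI_mul; congr (\1_ _ w); apply/seteqP; split.
    move=> {}w h; split=> u; last by move=> us'; apply: h; rewrite inE us' orbT.
    by rewrite inE => /eqP ->; apply: h; rewrite inE eqxx.
  move=> {}w [h1 h2] u; rewrite inE => /orP[/eqP ->|]; last exact: h2.
  by apply: (h1 v); rewrite inE.
rewrite e /ev map_cat big_cat /= mulrDl !mulr_sumr !big_map; congr (_ + _).
  rewrite !big_seq; apply: eq_bigr => t tl; rewrite /tterm /= mulrCA; congr (_ * _).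
  rewrite /term big_fsetU1 //=; apply/negP => /(ls _ tl).
  by rewrite (negPf vs).
by apply: eq_bigr => t _; rewrite /tterm /= mulrA.
Qed.

Lemma ev_dense f : sqint P f -> forall e : R, 0 < e ->
  exists l, ip P (fun w => f w - ev l w) (fun w => f w - ev l w) <= e.
Proof.
pose Q (g : Om -> R) := sqint P g /\ forall e : R, 0 < e ->
  exists l, ip P (fun w => g w - ev l w) (fun w => g w - ev l w) <= e.
move=> sf; suff : Q f by case.
move: f sf; apply: (@sqint_rect_ind R d P Q).
- move=> s B us mB; split; first by apply: indic_sqint; exact: rect_measurable.
  move=> e e0; have [l ->] := rect_ev us mB; exists l.
  rewrite /ip; under eq_Rintegral do rewrite subrr mul0r.
  by rewrite Rintegral_cst // mul0r ltW.
- move=> f g [sf Qf] [sg Qg]; split; first exact: sqintD.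
  (* A quarter, because [ip_normD] doubles each of the two errors. *)
  move=> e e0; have e4 : 0 < e / 4 by rewrite divr_gt0.
  have [l hl] := Qf _ e4; have [m hm] := Qg _ e4; exists (l ++ m).
  have := ip_normD (sqintB sf (ev_sqint l)) (sqintB sg (ev_sqint m)).
  rewrite (@eq_ip _ _ _ _ _ _ (fun w => f w + g w - ev (l ++ m) w)
    (fun w => f w + g w - ev (l ++ m) w)); last 2 first.
  + by move=> w; rewrite /ev big_cat /=; ring.
  + by move=> w; rewrite /ev big_cat /=; ring.
  by move=> h; apply: le_trans h _; lra.
- move=> a f [sf Qf]; split; first exact: sqintZ.
  move=> e e0; pose k := a ^+ 2 + 1; have k0 : 0 < k by rewrite ltr_wpDl ?sqr_ge0.
  have [l hl] := Qf _ (divr_gt0 e0 k0).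
  exists [seq (a * t.1.1, t.1.2, t.2) | t <- l].
  rewrite (@eq_ip _ _ _ _ _ _ (fun w => a * (f w - ev l w))
    (fun w => a * (f w - ev l w))); last 2 first.
  + move=> w; rewrite mulrBr /ev big_map mulr_sumr; congr (_ - _).
    by apply: eq_bigr => t _; rewrite /tterm /= mulrA.
  + move=> w; rewrite mulrBr /ev big_map mulr_sumr; congr (_ - _).
    by apply: eq_bigr => t _; rewrite /tterm /= mulrA.
  have sl := sqintB sf (ev_sqint l).
  rewrite ipZl ?ipZr //; last exact: sqintZ.
  rewrite mulrA -expr2; apply: le_trans (_ : k * ip P (fun w => f w - ev l w) (fun w => f w - ev l w) <= _).
    by rewrite ler_wpM2r ?ip_ge0 // lerDl.
  by rewrite mulrC -ler_pdivlMr.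
- move=> f g sf sg Qg lim; split=> // e e0.
  have e4 : 0 < e / 4 by rewrite divr_gt0.
  have /cvgrPdist_lt /(_ _ e4) [N _ /(_ N (leqnn N)) hN] := lim.
  have [l hl] := (Qg N).2 _ e4; exists l.
  have := ip_normD (sqintB sf (sg N)) (sqintB (sg N) (ev_sqint l)).
  rewrite (@eq_ip _ _ _ _ _ _ (fun w => f w - ev l w) (fun w => f w - ev l w)); last 2 first.
  + by move=> w; ring.
  + by move=> w; ring.
  move=> h; apply: le_trans h _; move: hN; rewrite /= sub0r normrN ger0_norm ?ip_ge0 // => hN; lra.
Qed.

Definition Mop (g : Om -> R) (w : Om) : R :=
  (kap R d)^-1 * \sum_(i < d) g (relabel (rmul i) w).

Lemma rmul_bij (i : 'I_d) : bijective (rmul i).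
Proof. by exists (rmul i); exact: rmulK. Qed.

Lemma relabel_sqint a f : bijective a -> sqint P f -> sqint P (f \o relabel a).
Proof.
move=> ba [mf if2]; split.
  by apply: measurableT_comp mf _; exact: relabel_measurable.
have := @relabel_integrable _ _ _ HP a (fun w => f w ^+ 2) ba _ if2.
by apply; exact: measurable_funX.
Qed.

Lemma relabel_ip a f g : bijective a -> sqint P f -> sqint P g ->
  ip P (f \o relabel a) (g \o relabel a) = ip P f g.
Proof.
move=> ba sf sg; rewrite /ip -(@relabel_Rintegral _ _ _ HP a (fun w => f w * g w) ba) //.
- by apply: measurable_funM; [exact: sf.1|exact: sg.1].
- exact: sqint_mul.
Qed.

Lemma Mop_sqint g : sqint P g -> sqint P (Mop g).
Proof.
move=> sg; apply: sqintZ; apply: (@sqint_sum _ _ _ _ _ _ (fun i w => g (relabel (rmul i) w))) => i.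
exact: (relabel_sqint (rmul_bij i) sg).
Qed.

Lemma ip_Mop f g : sqint P f -> sqint P g ->
  ip P f (Mop g) = (kap R d)^-1 * \sum_(i < d) ip P f (g \o relabel (rmul i)).
Proof.
move=> sf sg; have sU i := relabel_sqint (rmul_bij i) sg.
by rewrite ipZr ?ip_sumr //; exact: sqint_sum.
Qed.

Lemma relabel_rmulK (i : 'I_d) (w : Om) : relabel (rmul i) (relabel (rmul i) w) = w.
Proof. by apply/funext => v; rewrite /relabel /= rmulK. Qed.

Lemma Mop_sym f g : sqint P f -> sqint P g -> ip P (Mop f) g = ip P f (Mop g).
Proof.
move=> sf sg; rewrite ipC !ip_Mop //; congr (_ * _); apply: eq_bigr => i _.
rewrite -(relabel_ip (rmul_bij i) sg (relabel_sqint (rmul_bij i) sf)) ipC.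
by apply: eq_ip => w //=; rewrite relabel_rmulK.
Qed.

(** The trivial norm bound, each translation being an isometry; it serves for error terms only. *)
Lemma ip_Mop_bound (s : R) f g : 0 < s -> sqint P f -> sqint P g ->
  `|ip P f (Mop g)| <= d%:R / kap R d * ((s * ip P f f + s^-1 * ip P g g) / 2).
Proof.
move=> s0 sf sg; rewrite ip_Mop // normrM ger0_norm ?invr_ge0 ?(ltW (kap_gt0 _ hd)) //.
rewrite -[d%:R / _]mulrC -mulrA ler_wpM2l ?invr_ge0 ?(ltW (kap_gt0 _ hd)) //.
apply: le_trans (ler_norm_sum _ _ _) _; rewrite -[d in d%:R]card_ord mulr_natl -sumr_const.
apply: ler_sum => i _; have sU := relabel_sqint (rmul_bij i) sg.
by rewrite -[ip P g g](relabel_ip (rmul_bij i)) //; exact: ip_amgm.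
Qed.

Definition weight (A : {fset tree d}) : R :=
  \sum_(v <- A) (Num.sqrt (d%:R - 1))^-1 ^+ height v.

Definition move_set (i : 'I_d) (A : {fset tree d}) := [fset rmul i v | v in A]%fset.

Lemma move_setK i : involutive (move_set i).
Proof.
move=> A; rewrite /move_set -imfset_comp; apply/fsetP => v; apply/imfsetP/idP => /=.
  by move=> [u uA ->]; rewrite rmulK.
by move=> vA; exists v => //; rewrite rmulK.
Qed.

Lemma weight_gt0 A : A != fset0 -> 0 < weight A.
Proof.
move=> /fset0Pn [v vA]; have s0 : 0 < Num.sqrt (d%:R - 1) :> R by rewrite sqrtr_gt0 d1_gt0.
rewrite /weight (big_fsetD1 v) //= ltr_pwDl ?exprn_gt0 ?invr_gt0 //.
by apply: sumr_ge0 => u _; rewrite exprn_ge0 // invr_ge0 ltW.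
Qed.

(* [weight] is superharmonic: a sum of translates of the positive function
   [r ^ height] with [r = 1 / sqrt (d - 1)]. *)
Lemma weight_sum A : \sum_(i < d) weight (move_set i A) <= kap R d * weight A.
Proof.
rewrite /weight; set s := Num.sqrt _ : R.
have s0 : 0 < s by rewrite sqrtr_gt0 d1_gt0.
have s2 : s ^+ 2 = d%:R - 1 by exact: sqr_sqrtd1.
under eq_bigr => i _.
  rewrite /move_set big_imfset /=; last by move=> u v _ _; exact: rmul_inj.
  over.
rewrite exchange_big mulr_sumr /=; apply: ler_sum => v _.
rewrite (height_rmul_sum (fun n => s^-1 ^+ n)) /kap -/s.
case: (height v) => [|n].
  rewrite expr1 expr0 mulr1 ler_pdivrMr // -mulrA -expr2 s2.
  by have := d1_ge1 R hd; lra.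
rewrite -s2 le_eqVlt; apply/orP; left; apply/eqP; rewrite !exprS.
by field; rewrite gt_eqF.
Qed.

End SpectralBound.

Lemma sum_delta_in (R : nmodType) (I : eqType) (S : seq I) (j : I) (F : I -> R) :
  uniq S -> j \in S -> \sum_(i <- S) (if i == j then F i else 0) = F j.
Proof.
move=> uS jS; rewrite (bigD1_seq j) //= eqxx big1 ?addr0 // => i ij.
by rewrite (negPf ij).
Qed.

Lemma sum_delta_notin (R : nmodType) (I : eqType) (S : seq I) (j : I) (F : I -> R) :
  j \notin S -> \sum_(i <- S) (if i == j then F i else 0) = 0.
Proof.
move=> jS; rewrite big_seq big1 // => i iS; case: eqVneq => // ij.
by move: jS; rewrite -ij iS.
Qed.

Lemma ip_shift d (T : measurableType d) (R : realType) (P : probability T R) (r : T -> R) (k : R) :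
  sqint P r -> ip P r (cst 1) = 0 ->
  ip P r r <= ip P (fun w => r w + k * cst 1 w) (fun w => r w + k * cst 1 w).
Proof.
move=> sr r1; have sc := sqintZ k (sqint_cst P 1).
have rc : ip P r (fun w => k * cst 1 w) = 0 by rewrite ipZr ?r1 ?mulr0 //; exact: sqint_cst.
rewrite ipDl ?ipDr //; last exact: sqintD.
by rewrite rc (ipC _ _ r) rc addr0 add0r lerDl ip_ge0.
Qed.

Lemma ip_subB d (T : measurableType d) (R : realType) (P : probability T R) (f g : T -> R) :
  sqint P f -> sqint P g ->
  ip P (fun w => f w - g w) (fun w => f w - g w) = ip P f f - 2 * ip P f g + ip P g g.
Proof.
move=> sf sg; rewrite ipBl ?ipBr //; last exact: sqintB.
by rewrite (ipC _ g f); ring.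
Qed.

(** * Schur's test on blocks of terms *)

Section SpectralRadius.
Variables (R : realType) (d : nat).
Hypothesis hd : (2 <= d)%N.
Notation Om := (labelling R d).
Variable P : probability Om R.
Hypothesis HP : is_lebesgue_product P.
Notation U i := (fun g : Om -> R => g \o relabel (rmul i)).

Lemma ev_partition (l : seq (tdata R d)) (S : seq {fset tree d}) w : uniq S ->
  {subset [seq t.1.2 | t <- l] <= S} ->
  \sum_(t <- l) \sum_(A <- S) (if A == t.1.2 then tterm t w else 0) = ev l w.
Proof.
move=> uS; rewrite /ev; elim: l => [|t l IH] mS; first by rewrite !big_nil.
rewrite !big_cons -IH; last by move=> A Al; apply: mS; rewrite inE Al orbT.
by rewrite (sum_delta_in (fun=> tterm t w)) //; apply: mS; rewrite inE eqxx.
Qed.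

Section Blocks.
Variable l : seq (tdata R d).
(** Schur's test divides by [weight], which is 0 on the empty set. *)
Hypothesis l0 : forall A, A \in [seq t.1.2 | t <- l] -> A != fset0.

Let S := undup [seq t.1.2 | t <- l].
Let block (A : {fset tree d}) (w : Om) : R :=
  \sum_(t <- l) (if A == t.1.2 then tterm t w else 0).
Let nb A := ip P (block A) (block A).

Let ev_block w : ev l w = \sum_(A <- S) block A w.
Proof.
rewrite /block exchange_big /= ev_partition ?undup_uniq // => A.
by rewrite mem_undup.
Qed.

Let block_sqint A : sqint P (block A).
Proof.
apply: sqint_sum => t; case: (A == t.1.2); first exact: tterm_sqint.
exact: (sqint_cst P 0).
Qed.

Let U_sqint i f : sqint P f -> sqint P (U i f).
Proof. exact: (relabel_sqint HP (rmul_bij i)). Qed.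

Let tterm_orth (t u : tdata R d) i :
  t.1.2 != move_set i u.1.2 -> ip P (tterm t) (U i (tterm u)) = 0.
Proof.
move=> ne; rewrite (@eq_ip _ _ _ _ _ _ (tterm t)
  (fun w => u.1.1 * term (move_set i u.1.2) (sval u.2 \o rmul i) w)) //; last first.
  by move=> w; rewrite /= /tterm term_relabel.
have mt := svalP t.2; have mu := svalP u.2.
have mu' v : measurable ((sval u.2 \o rmul i) v) by exact: mu.
rewrite ipZr; [|exact: tterm_sqint|exact: term_sqint].
rewrite ipZl; [|exact: term_sqint..].
by rewrite term_orth // !mulr0.
Qed.

Let tterm_orth0 (t u : tdata R d) : t.1.2 != u.1.2 -> ip P (tterm t) (tterm u) = 0.
Proof.
move=> ne; have mt := svalP t.2; have mu := svalP u.2.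
rewrite ipZr; [|exact: tterm_sqint|exact: term_sqint].
rewrite ipZl; [|exact: term_sqint..].
by rewrite term_orth // !mulr0.
Qed.

Let ip_block0 A B (g : tdata R d -> Om -> R) : (forall u, sqint P (g u)) ->
  (forall t u, t.1.2 = A -> u.1.2 = B -> ip P (tterm t) (g u) = 0) ->
  ip P (block A) (fun w => \sum_(u <- l) (if B == u.1.2 then g u w else 0)) = 0.
Proof.
move=> sg g0.
have s1 t : sqint P (fun w => if A == t.1.2 then tterm t w else 0).
  by case: (A == t.1.2); [exact: tterm_sqint|exact: (sqint_cst P 0)].
have s2 u : sqint P (fun w => if B == u.1.2 then g u w else 0).
  by case: (B == u.1.2); [exact: sg|exact: (sqint_cst P 0)].
rewrite ip_suml //; last exact: sqint_sum.
apply: big1 => t _; rewrite ip_sumr //; apply: big1 => u _.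
case: eqVneq => [At|_]; last first.
  by rewrite /ip; under eq_Rintegral do rewrite mul0r; rewrite Rintegral_cst // mul0r.
case: eqVneq => [Bu|_]; last first.
  by rewrite /ip; under eq_Rintegral do rewrite mulr0; rewrite Rintegral_cst // mul0r.
exact: g0.
Qed.

Let block_orth0 A B : A != B -> ip P (block A) (block B) = 0.
Proof.
move=> AB; apply: ip_block0 => [u|t u tA uB]; first exact: tterm_sqint.
by apply: tterm_orth0; rewrite tA uB.
Qed.

Let block_orth i A B : A != move_set i B -> ip P (block A) (U i (block B)) = 0.
Proof.
move=> AB; apply: (@ip_block0 A B (fun u => U i (tterm u))) => [u|t u tA uB].
  exact: (U_sqint i (tterm_sqint P u)).
by apply: tterm_orth; rewrite tA uB.
Qed.

Let ip_ev : ip P (ev l) (ev l) = \sum_(A <- S) nb A.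
Proof.
rewrite (eq_ip P ev_block ev_block) ip_suml //; last exact: sqint_sum.
rewrite !big_seq; apply: eq_bigr => A AS; rewrite ip_sumr //.
rewrite -[RHS](sum_delta_in (fun B => ip P (block A) (block B)) (undup_uniq _) AS).
apply: eq_bigr => B _; case: eqVneq => // BA.
by rewrite block_orth0 // eq_sym.
Qed.

Let ip_ev_U i : ip P (ev l) (U i (ev l)) =
  \sum_(A <- S) \sum_(B <- S) ip P (block A) (U i (block B)).
Proof.
have e w : U i (ev l) w = \sum_(B <- S) U i (block B) w by rewrite /= ev_block.
have sU B : sqint P (U i (block B)) by exact: U_sqint.
rewrite (eq_ip P ev_block e) ip_suml //; last exact: sqint_sum.
by apply: eq_bigr => A _; rewrite ip_sumr.
Qed.

Let a i A B : R := if B == move_set i A then weight R B / weight R A * nb A else 0.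

(** A translation pairs the block of [A] only with the block of its translate. The
    arithmetic-geometric inequality with the ratio of weights as parameter gives (a i A B + a i B A)
    / 2, and the two halves agree after summation over both sets. *)
Let U_bound i : `|ip P (ev l) (U i (ev l))| <=
  \sum_(A <- S) weight R (move_set i A) / weight R A * nb A.
Proof.
have w0 A : A \in S -> 0 < weight R A by rewrite mem_undup => /l0; exact: weight_gt0.
have nb0 A : 0 <= nb A by exact: ip_ge0.
have eqC A B : (A == move_set i B) = (B == move_set i A).
  by rewrite -{1}[A](move_setK i) (inj_eq (inv_inj (move_setK i))) eq_sym.
have b A B : A \in S -> B \in S ->
    `|ip P (block A) (U i (block B))| <= (a i A B + a i B A) / 2.
  move=> AS BS; have wA := w0 A AS; have wB := w0 B BS.
  case: (eqVneq A (move_set i B)) => [AB|AB]; last first.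
    by rewrite block_orth // normr0 /a -eqC (negPf AB) addr0 mul0r.
  rewrite /a AB eqxx -{1 2}AB eqC AB eqxx -AB.
  have := ip_amgm (divr_gt0 wB wA) (block_sqint A) (U_sqint i (block_sqint B)).
  by rewrite (relabel_ip HP (rmul_bij i)) // invf_div.
rewrite ip_ev_U; apply: le_trans (ler_norm_sum _ _ _) _.
apply: le_trans (_ : \sum_(A <- S) \sum_(B <- S) (a i A B + a i B A) / 2 <= _).
  rewrite !big_seq; apply: ler_sum => A AS; apply: le_trans (ler_norm_sum _ _ _) _.
  by rewrite !big_seq; apply: ler_sum => B BS; exact: b.
have -> : \sum_(A <- S) \sum_(B <- S) (a i A B + a i B A) / 2 =
    \sum_(A <- S) \sum_(B <- S) a i A B.
  under eq_bigr do rewrite -mulr_suml big_split /=.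
  by rewrite -mulr_suml big_split /= [X in _ + X]exchange_big /=; field.
rewrite !big_seq; apply: ler_sum => A AS.
have [mS|mS] := boolP (move_set i A \in S).
  by rewrite /a (sum_delta_in (fun B => weight R B / weight R A * nb A) (undup_uniq _) mS).
rewrite /a (sum_delta_notin (fun B => weight R B / weight R A * nb A) mS).
rewrite mulr_ge0 // divr_ge0 ?(ltW (w0 _ AS)) //.
by apply: sumr_ge0 => v _; rewrite exprn_ge0 // invr_ge0.
Qed.

(** After summation over [i], the superharmonicity of [weight] bounds the coefficient of each block
    norm by [kap], which the normalisation of M cancels. *)
Lemma ev_spectral : `|ip P (ev l) (Mop (ev l))| <= ip P (ev l) (ev l).
Proof.
have k0 := kap_gt0 R hd; have sl := ev_sqint P l.
rewrite (ip_Mop HP) // normrM ger0_norm ?invr_ge0 ?(ltW k0) //.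
rewrite ler_pdivrMl //; apply: le_trans (ler_norm_sum _ _ _) _.
apply: le_trans (ler_sum _ (fun i _ => U_bound i)) _.
rewrite exchange_big /= ip_ev mulr_sumr !big_seq; apply: ler_sum => A AS.
have wA : 0 < weight R A by apply: weight_gt0 => //; apply: l0; rewrite -mem_undup.
rewrite -!mulr_suml ler_wpM2r ?ip_ge0 // ler_pdivrMr //; exact: weight_sum.
Qed.

End Blocks.

(** Approximate [f] by a combination of terms, then drop its constant terms: since [f] is centred,
    this does not increase the distance, by orthogonality to constants. *)
Lemma spectral_bound f : sqint P f -> \int[P]_w f w = 0 ->
  `|ip P f (Mop f)| <= ip P f f.
Proof.
move=> sf f0; pose N := ip P f f; pose C := d%:R / kap R d.
have C0 : 0 <= C by rewrite divr_ge0 // ltW // kap_gt0.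
have N0 : 0 <= N by exact: ip_ge0.
(* With f = g + r, the groups [N + 2], [C * (2 * N + 3)] and [C * (1 + N)] bound, per unit of [e],
   the errors in <g, M g>, <g, M r> and <r, M f>. *)
pose K := N + 2 + C * (2 * N + 3) + C * (1 + N).
suff H (e : R) : 0 < e -> e <= 1 -> `|ip P f (Mop f)| <= N + e * K.
  apply/ler_addgt0Pr => e e0; have K0 : 0 < K.
    by rewrite /K; have := mulr_ge0 C0 N0; lra.
  pose x := Num.min 1 (e / K).
  have x0 : 0 < x by rewrite lt_min ltr01 divr_gt0.
  apply: le_trans (H x x0 _) _; first by rewrite ge_min lexx.
  by rewrite lerD2l -ler_pdivlMr // ge_min lexx orbT.
(* Precision [e * e], because the inequality with parameter [e] divides the squared norm of the
   remainder by [e]. *)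
move=> e0 e1; have [l hl] := ev_dense sf (mulr_gt0 e0 e0).
pose l' := [seq t <- l | t.1.2 != fset0].
pose c := \sum_(t <- l | t.1.2 == fset0) t.1.1.
have sl := ev_sqint P l; have sl' := ev_sqint P l'.
have lE w : ev l w = ev l' w + c.
  rewrite /ev (bigID (fun t : tdata R d => t.1.2 != fset0)) /= big_filter; congr (_ + _).
  under eq_bigl do rewrite negbK.
  by apply: eq_bigr => t /eqP t0; rewrite /tterm /term t0 big_seq_fset0 mulr1.
have l'0 A : A \in [seq t.1.2 | t <- l'] -> A != fset0.
  rewrite /l'; elim: (l) => [//|t m IH] /=; case: ifP => // tA.
  by rewrite /= inE => /orP[/eqP ->|/IH].
have El' : ip P (ev l') (cst 1) = 0.
  rewrite ip_suml; [|by move=> t; exact: tterm_sqint|exact: sqint_cst].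
  rewrite big_filter; apply: big1 => t t0.
  have mT (v : tree d) : measurable (setT : set R) by exact: measurableT.
  pose one : tdata R d := (1, fset0, exist _ (fun=> setT) mT).
  rewrite (@eq_ip _ _ _ _ _ _ (tterm t) (tterm one)) //.
    rewrite ipZr; [|exact: tterm_sqint|exact: term_sqint].
    rewrite ipZl; [|by apply: term_sqint => v; exact: (svalP t.2)|exact: term_sqint].
    by rewrite term_orth ?mulr0 //; exact: (svalP t.2).
  by move=> w; rewrite /tterm /one /= /term big_seq_fset0 mulr1.
pose g := ev l'; pose r w := f w - g w.
have sr : sqint P r by exact: sqintB.
have Er : ip P r (cst 1) = 0.
  rewrite ipBl //; last exact: sqint_cst.
  rewrite El' subr0 /ip; under eq_Rintegral do rewrite mulr1.
  exact: f0.
have Nr : ip P r r <= e * e.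
  apply: le_trans hl; rewrite [leRHS](@eq_ip _ _ _ _ _ _ (fun w => r w + - c * cst 1 w)
    (fun w => r w + - c * cst 1 w)); last 2 first.
  - by move=> w; rewrite lE /r /g /=; ring.
  - by move=> w; rewrite lE /r /g /=; ring.
  exact: ip_shift.
have fE w : f w = g w + r w by rewrite /r; ring.
have sMf := Mop_sqint HP sf; have sMg := Mop_sqint HP sl'; have sMr := Mop_sqint HP sr.
have e0' : 0 < e^-1 by rewrite invr_gt0.
have -> : ip P f (Mop f) = ip P g (Mop g) + ip P g (Mop r) + ip P r (Mop f).
  rewrite (eq_ip P fE (fun=> erefl)) ipDl //; congr (_ + _).
  rewrite -ipDr //; apply: eq_ip => // w; rewrite /Mop -mulrDr -big_split /=.
  by congr (_ * _); apply: eq_bigr => i _; rewrite fE.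
have h1 := ev_spectral l'0.
have h2 := ip_Mop_bound hd HP e0 sl' sr.
have h3 := ip_Mop_bound hd HP e0' sr sf.
have sub : e^-1 * ip P r r <= e by rewrite mulrC ler_pdivrMr.
have Ng : ip P g g <= (1 + e) * N + e + e * e.
  have -> : ip P g g = N - 2 * ip P f r + ip P r r.
    rewrite (@eq_ip _ _ _ _ g g (fun w => f w - r w) (fun w => f w - r w)); last 2 first.
    - by move=> w; rewrite /r; ring.
    - by move=> w; rewrite /r; ring.
    exact: ip_subB.
  have := ip_amgm e0 sf sr; have := ler_norm (- ip P f r); rewrite normrN -/N; lra.
rewrite invrK -/C -/N -/g in h1 h2 h3.
have n1 := ler_normD (ip P g (Mop g) + ip P g (Mop r)) (ip P r (Mop f)).
have n2 := ler_normD (ip P g (Mop g)) (ip P g (Mop r)).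
have ee : e * e <= e by rewrite ler_piMr // ltW.
have eN : e * N <= N by rewrite ler_piMl.
have Ng2 : ip P g g <= 2 * N + 2 by lra.
have h2' : `|ip P g (Mop r)| <= C * (e * (2 * N + 3)).
  apply: le_trans h2 _; rewrite ler_wpM2l //.
  have : e * ip P g g <= e * (2 * N + 2) by rewrite ler_wpM2l // ltW.
  by have := ip_ge0 P g; have := mulr_ge0 (ltW e0) N0; lra.
have h3' : `|ip P r (Mop f)| <= C * (e * (1 + N)).
  apply: le_trans h3 _; rewrite ler_wpM2l //.
  by have := mulr_ge0 (ltW e0) N0; lra.
have -> : e * K = e * N + 2 * e + C * (e * (2 * N + 3)) + C * (e * (1 + N)).
  by rewrite /K; ring.
lra.
Qed.

End SpectralRadius.

(** * Positivity of the moments of a centred function *)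

Section SpectralPositivity.
Variables (R : realType) (d : nat).
Hypothesis hd : (2 <= d)%N.
Notation Om := (labelling R d).
Variable P : probability Om R.
Hypothesis HP : is_lebesgue_product P.
Variables (f : Om -> R) (c : nat -> R).
Hypotheses (sf : sqint P f) (f0 : \int[P]_w f w = 0).
Notation M := (@Mop R d).
Hypothesis cf : forall k, ip P f (iter k M f) = ip P f f * mom d c k.

Lemma iter_Mop_sqint g k : sqint P g -> sqint P (iter k M g).
Proof. by move=> sg; elim: k => [//|k IH] /=; exact: Mop_sqint. Qed.

Lemma Mop_mean g : sqint P g -> \int[P]_w M g w = d%:R / kap R d * \int[P]_w g w.
Proof.
move=> sg; have sU (i : 'I_d) := relabel_sqint HP (rmul_bij i) sg.
rewrite /Mop RintegralZl //; last first.
  by apply: sqint_integrable; exact: (@sqint_sum _ _ _ _ _ _ (fun i => g \o relabel (rmul i))).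
rewrite (@Rintegral_sumr _ _ _ _ _ _ _ (fun i => g \o relabel (rmul i))) //; last first.
  by move=> i; exact: sqint_integrable.
rewrite (eq_bigr (fun=> \int[P]_w g w)) => [|i _]; last first.
  by apply: (relabel_Rintegral HP (rmul_bij i)); [exact: sg.1|exact: sqint_integrable].
by rewrite sumr_const card_ord -[_ *+ d]mulr_natl; ring.
Qed.

Lemma iter_Mop_mean k : \int[P]_w iter k M f w = 0.
Proof.
elim: k => [//|k IH]; rewrite iterS Mop_mean ?IH ?mulr0 //; exact: iter_Mop_sqint.
Qed.

Let ip_iter a b : ip P (iter a M f) (iter b M f) = ip P f f * mom d c (a + b).
Proof.
elim: a b => [|a IH] b; first exact: cf.
rewrite iterS Mop_sym //; [|exact: iter_Mop_sqint..].
by rewrite -iterS IH addnS.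
Qed.

Let evp (p : {poly R}) (w : Om) : R := \sum_(k < size p) p`_k * iter k M f w.

Let evpE (p : {poly R}) n w : (size p <= n)%N -> evp p w = \sum_(k < n) p`_k * iter k M f w.
Proof.
move=> le; rewrite /evp (big_ord_widen _ (fun k => p`_k * iter k M f w) le).
rewrite big_mkcond; apply: eq_bigr => k _; case: ltnP => // h.
by rewrite nth_default ?mul0r.
Qed.

Let s1 a k : sqint P (fun w => a * iter k M f w).
Proof. by apply: sqintZ; exact: iter_Mop_sqint. Qed.

Let evp_sqint p : sqint P (evp p).
Proof. by apply: sqint_sum => k; exact: s1. Qed.

Let evp_mean p : \int[P]_w evp p w = 0.
Proof.
rewrite /evp (@Rintegral_sumr _ _ _ _ _ _ _ (fun (k : 'I_(size p)) w => p`_k * iter k M f w)) //; last first.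
  by move=> k; exact: sqint_integrable.
apply: big1 => k _; rewrite RintegralZl // ?iter_Mop_mean ?mulr0 //.
by apply: sqint_integrable; exact: iter_Mop_sqint.
Qed.

Let ip_evp p q : ip P (evp p) (evp q) = ip P f f * Lc d c (p * q).
Proof.
have -> : p * q = \sum_(k < size p) \sum_(l < size q) (p`_k * q`_l) *: 'X^(k + l).
  rewrite -{1}[p]coefK -{1}[q]coefK !poly_def mulr_suml; apply: eq_bigr => k _.
  rewrite mulr_sumr; apply: eq_bigr => l _.
  by rewrite -scalerAl -scalerAr scalerA exprD.
rewrite Lc_sum mulr_sumr (@ip_suml _ _ _ _ _ _ (fun (k : 'I_(size p)) w => p`_k * iter k M f w)) //.
apply: eq_bigr => k _; rewrite Lc_sum mulr_sumr.
rewrite (@ip_sumr _ _ _ _ _ _ (fun (l : 'I_(size q)) w => q`_l * iter l M f w)) //.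
apply: eq_bigr => l _; rewrite LcZ LcXn ipZl ?ipZr ?ip_iter //; try exact: iter_Mop_sqint.
by ring.
Qed.

Let Mop_evp p : M (evp p) =1 evp (p * 'X).
Proof.
move=> w; rewrite (@evpE _ (size p).+1); last first.
  by rewrite (leq_trans (size_polyMleq _ _)) // size_polyX addn2.
rewrite big_ord_recl coefMX eqxx mul0r add0r /Mop.
under eq_bigr do rewrite /evp.
rewrite exchange_big mulr_sumr /=; apply: eq_bigr => k _.
by rewrite coefMX /= -mulr_sumr /Mop; ring.
Qed.

Hypothesis f1 : 0 < ip P f f.

Let L_sq p : 0 <= Lc d c (p ^+ 2).
Proof. by rewrite -(pmulr_rge0 _ f1) expr2 -ip_evp ip_ge0. Qed.

(** The spectral bound for p(M) f, which is again centred because M multiplies means by a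
    constant. *)
Let spectral p : `|Lc d c (p ^+ 2 * 'X)| <= Lc d c (p ^+ 2).
Proof.
rewrite -(ler_pM2l f1) -{1}(gtr0_norm f1) -normrM expr2 -mulrA -!ip_evp.
rewrite -(@eq_ip _ _ _ _ (evp p) (M (evp p)) _ _ (fun=> erefl) (Mop_evp p)).
exact: spectral_bound.
Qed.

Let L_plus p : 0 <= Lc d c (p ^+ 2 * (1 + 'X)).
Proof.
rewrite mulrDr mulr1 LcD; have := spectral p; have := ler_norm (- Lc d c (p ^+ 2 * 'X)).
by rewrite normrN; lra.
Qed.

Let L_minus p : 0 <= Lc d c (p ^+ 2 * (1 - 'X)).
Proof.
rewrite mulrBr mulr1 LcB; have := spectral p; have := ler_norm (Lc d c (p ^+ 2 * 'X)).
by lra.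
Qed.

(** After extraction of a square, four parities remain. The doubly odd one follows from 2 a b = b^2
    a + a^2 b, a consequence of a + b = 2. *)
Lemma spectral_haus : haus d c.
Proof.
move=> i j; set a : {poly R} := 1 + 'X; set b : {poly R} := 1 - 'X.
rewrite -(odd_double_half i) -(odd_double_half j) -!muln2 !exprD !exprM.
set x := a ^+ _; set y := b ^+ _; rewrite -!exprM !muln2.
have -> : a ^+ i./2.*2 = (a ^+ i./2) ^+ 2 by rewrite -exprM muln2.
have -> : b ^+ j./2.*2 = (b ^+ j./2) ^+ 2 by rewrite -exprM muln2.
rewrite mulrACA -exprMn mulrC {}/x {}/y; set p := _ * b ^+ _.
case: (odd i); case: (odd j); rewrite ?expr1 ?expr0 ?mulr1 ?mul1r //=.
have -> : p ^+ 2 * (a * b) = 2^-1 *: ((p * b) ^+ 2 * a + (p * a) ^+ 2 * b).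
  have -> : (p * b) ^+ 2 * a + (p * a) ^+ 2 * b = (2 : R) *: (p ^+ 2 * (a * b)).
    rewrite scaler_nat; have : a + b = 2 by rewrite /a /b; ring.
    move=> ab; rewrite -mulr_natl -ab; ring.
  by rewrite scalerA mulVf ?pnatr_eq0 // scale1r.
by rewrite LcZ LcD mulr_ge0 ?invr_ge0 // addr_ge0.
Qed.

End SpectralPositivity.

(** Both pairs are moved to the root, where transitivity on spheres applies. This is why covariances
    of a factor depend on the distance alone. *)
Lemma two_point_transitive d n (u v u' v' : tree d) : at_distance n u v -> at_distance n u' v' ->
  exists b, [/\ tree_aut b, b u = u' & b v = v'].
Proof.
move=> h h'; have [a aa a0] := tree_transitive u; have [a' aa' a0'] := tree_transitive u'.
have [b [ab Kab Kba]] := tree_aut_inv aa; have [b' [ab' Kab' Kba']] := tree_aut_inv aa'.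
have bu : b u = tree_root d by rewrite -a0 Kab.
have bu' : b' u' = tree_root d by rewrite -a0' Kab'.
have hv : height (b v) = n by apply: height_at_distance; rewrite -bu; exact: at_distance_aut.
have hv' : height (b' v') = n by apply: height_at_distance; rewrite -bu'; exact: at_distance_aut.
have [r [ar r0 rv]] : exists r, [/\ tree_aut r, r (tree_root d) = tree_root d & r (b v) = b' v'].
  by apply: sphere_transitive; rewrite hv hv'.
exists (a' \o (r \o b)); split.
- by apply: tree_aut_comp => //; exact: tree_aut_comp.
- by rewrite /= bu r0.
- by rewrite /= rv Kba'.
Qed.

Lemma height_surj d n : (2 <= d)%N -> exists v : tree d, height v = n.
Proof.
move=> hd; elim: n => [|n [[w rw] hv]]; first by exists (tree_root d).
have [i wi] : exists i : 'I_d, reduced (i :: w).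
  pose i0 : 'I_d := Ordinal (ltnW hd); pose i1 : 'I_d := Ordinal hd.
  case: w rw {hv} => [|a w] rw; first by exists i0.
  have [e|ne] := eqVneq i0 a; last by exists i0; move: rw; rewrite /reduced /= ne.
  by exists i1; move: rw; rewrite /reduced /= -e.
by exists (exist _ (i :: w) wi); rewrite /height /=; move: hv; rewrite /height /= => ->.
Qed.

Lemma prob_Rintegral_cst dT (T : measurableType dT) (R : realType) (P : probability T R) (k : R) :
  \int[P]_w k = k.
Proof.
rewrite Rintegral_cst // -[RHS]mulr1; congr (_ * _).
exact: (congr1 fine (probability_setT P)).
Qed.

(** * Correlations of factors *)

Section FactorProcess.
Variables (R : realType) (d : nat).
Hypothesis hd : (2 <= d)%N.
Notation Om := (labelling R d).
Variable P : probability Om R.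
Hypothesis HP : is_lebesgue_product P.
Variables (f : Om -> R) (Y : tree d -> Om -> R).
Hypotheses (sf : sqint P f) (fY : is_factor_process f Y).
Notation M := (@Mop R d).
Let m : R := \int[P]_w f w.
Let f0 w := f w - m.
Let Y0 v w := Y v w - m.

Lemma factor_aut b v : tree_aut b -> Y (b v) =1 Y v \o relabel b.
Proof.
move=> ab w; have [a aa a0] := tree_transitive v.
have e1 : Y (b v) w = f (w \o (b \o a)).
  by apply: fY; [exact: tree_aut_comp|rewrite /= a0].
by rewrite e1 /= (fY aa a0 (relabel b w)).
Qed.

Lemma factor_root : Y (tree_root d) =1 f.
Proof. by move=> w; rewrite (@fY _ id) //; split=> //; exists id. Qed.

Lemma factor_sqint v : sqint P (Y v).
Proof.
have [a aa <-] := tree_transitive v.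
have -> : Y (a (tree_root d)) = f \o relabel a.
  by apply/funext => w; rewrite factor_aut //= factor_root.
by apply: relabel_sqint => //; case: aa.
Qed.

Lemma factor_mean v : \int[P]_w Y v w = m.
Proof.
have [a aa <-] := tree_transitive v.
have -> : Y (a (tree_root d)) = (fun w => f (relabel a w)).
  by apply/funext => w; rewrite factor_aut //= factor_root.
by apply: (relabel_Rintegral HP); [case: aa|exact: sf.1|exact: sqint_integrable].
Qed.

Lemma centered_factor_sqint v : sqint P (Y0 v).
Proof. by apply: sqintB; [exact: factor_sqint|exact: (sqint_cst P m)]. Qed.

Lemma centered_sqint_f : sqint P f0.
Proof. by apply: sqintB => //; exact: (sqint_cst P m). Qed.

Lemma centered_mean : \int[P]_w f0 w = 0.
Proof.
rewrite /f0 RintegralB //; [|exact: sqint_integrable|exact: (sqint_integrable (sqint_cst P m))].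
by rewrite -/m prob_Rintegral_cst subrr.
Qed.

Lemma factor_corr u v : corr P (Y u) (Y v) = ip P (Y0 u) (Y0 v) / ip P (Y0 u) (Y0 u).
Proof. by rewrite (corrE (factor_mean u) (factor_mean v)). Qed.

Lemma factor_ip_aut b u v : tree_aut b -> ip P (Y0 (b u)) (Y0 (b v)) = ip P (Y0 u) (Y0 v).
Proof.
move=> ab; have sY := centered_factor_sqint.
rewrite -(relabel_ip HP (_ : bijective b) (sY u) (sY v)); last by case: ab.
by apply: eq_ip => w; rewrite /Y0 factor_aut.
Qed.

Lemma factor_ip_var u : ip P (Y0 u) (Y0 u) = ip P f0 f0.
Proof.
have [a aa <-] := tree_transitive u; rewrite factor_ip_aut //.
by apply: eq_ip => w; rewrite /Y0 factor_root.
Qed.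

Lemma factor_Mop v : M (Y0 v) =1 fun w => (kap R d)^-1 * \sum_(i < d) Y0 (rmul i v) w.
Proof.
move=> w; congr (_ * _); apply: eq_bigr => i _.
by rewrite /Y0 (factor_aut v (rmul_aut i)).
Qed.

Lemma iter_Mop_lin (I : finType) (a : R) (g : I -> Om -> R) k :
  iter k M (fun w => a * \sum_i g i w) =1 fun w => a * \sum_i iter k M (g i) w.
Proof.
elim: k => [//|k /funext IH] w; rewrite iterS IH {1}/Mop.
rewrite -mulr_sumr mulrCA exchange_big mulr_sumr /=.
by congr (_ * _); rewrite /Mop -mulr_sumr.
Qed.

(** M sends [Y0 v] to the normalised sum of the [Y0 (rmul i v)], so the covariances with the root,
    which depend on heights only, evolve by [tstep]. *)
Lemma factor_mom (e : nat -> R) : (forall v, ip P f0 (Y0 v) = ip P f0 f0 * e (height v)) ->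
  forall k, ip P f0 (iter k M f0) = ip P f0 f0 * mom d e k.
Proof.
move=> he k; have sf0 := centered_sqint_f; have sY := centered_factor_sqint.
have -> : f0 = Y0 (tree_root d) by apply/funext => w; rewrite /Y0 factor_root.
suff H v : ip P f0 (iter k M (Y0 v)) = ip P f0 f0 * iter k (@tstep R d) e (height v).
  have := H (tree_root d); rewrite -[height _]/0%N -/(mom d e k).
  by have -> : f0 = Y0 (tree_root d) by apply/funext => w; rewrite /Y0 factor_root.
elim: k v => [|k IH] v; first exact: he.
rewrite iterSr (_ : M (Y0 v) = fun w => (kap R d)^-1 * \sum_(i < d) Y0 (rmul i v) w); last first.
  by apply/funext => w; rewrite factor_Mop.
rewrite (eq_ip P (fun=> erefl) (iter_Mop_lin _ _ _)).
have sI i : sqint P (iter k M (Y0 (rmul i v))) by exact: iter_Mop_sqint.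
rewrite ipZr //; last exact: (@sqint_sum _ _ _ _ _ _ (fun i => iter k M (Y0 (rmul i v)))).
rewrite (@ip_sumr _ _ _ _ _ _ (fun i => iter k M (Y0 (rmul i v)))) //.
under eq_bigr do rewrite IH.
rewrite -mulr_sumr (height_rmul_sum (iter k (@tstep R d) e)) iterS /tstep.
by case: (height v) => [|n]; ring.
Qed.

Hypothesis f1 : 0 < ip P f0 f0.

(** One vertex of each height supplies the value; transitivity on pairs at equal distance makes it
    independent of the choice. *)
Lemma factor_correlation_sequence : exists c : nat -> R,
  is_correlation_sequence P Y c /\ forall v, ip P f0 (Y0 v) = ip P f0 f0 * ext1 c (height v).
Proof.
pose v_ n := sval (cid (height_surj n hd)).
have v_h n : height (v_ n) = n by rewrite /v_; case: cid.
pose c n := ip P f0 (Y0 (v_ n.+1)) / ip P f0 f0.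
have f0E : f0 = Y0 (tree_root d) by apply/funext => w; rewrite /Y0 factor_root.
have key n u v : at_distance n.+1 u v -> ip P (Y0 u) (Y0 v) = ip P f0 f0 * c n.
  move=> uv; rewrite /c mulrCA mulfV ?gt_eqF // mulr1 f0E.
  have h' := at_distance_root (v_ n.+1); rewrite v_h in h'.
  have [b [ab <- <-]] := two_point_transitive uv h'; by rewrite factor_ip_aut.
exists c; split=> [n u v uv|v].
  by rewrite factor_corr factor_ip_var (key _ _ _ uv) mulrAC mulfV ?gt_eqF // mul1r.
case E: (height v) => [|n] /=.
  rewrite mulr1; congr (ip P f0 _); rewrite f0E; congr Y0; apply: val_inj.
  by move: E; rewrite /height; case: (val v).
by rewrite {1}f0E; apply: key; rewrite -E; exact: at_distance_root.
Qed.

Lemma correlation_sequence_ip c : is_correlation_sequence P Y c ->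
  forall v, ip P f0 (Y0 v) = ip P f0 f0 * ext1 c (height v).
Proof.
move=> hc v; have [c' [hc' e]] := factor_correlation_sequence; rewrite e.
case E: (height v) => [//|n] /=; congr (_ * _).
have h := at_distance_root v; rewrite E in h.
by rewrite (hc _ _ _ h) (hc' _ _ _ h).
Qed.

End FactorProcess.

Section FiidCorrelations.
Variables (R : realType) (d : nat).
Hypothesis hd : (2 <= d)%N.
Notation Om := (labelling R d).

Lemma ip_gt0 dT (T : measurableType dT) (P : probability T R) (g : T -> R) :
  sqint P g -> ~ {ae P, forall w, g w = 0} -> 0 < ip P g g.
Proof.
move=> sg ng; rewrite lt_neqAle ip_ge0 andbT; apply/eqP => e; apply: ng.
have i2 := sqint_mul sg sg.
pose G : T -> \bar R := EFin \o (fun w => g w * g w).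
have E : (\int[P]_w `|G w|)%E = 0%E.
  have -> : (\int[P]_w `|G w|)%E = (\int[P]_w G w)%E.
    by apply: eq_integral => w _; rewrite gee0_abs // lee_fin -expr2 sqr_ge0.
  rewrite -[LHS]fineK; last exact: integrable_fin_num.
  by rewrite -[fine _]/(ip P g g) -e.
have [/(_ E) h _] := @ae_eq_integral_abs _ _ _ P setT measurableT G (measurable_int _ i2).
case: h => N [mN N0 sub]; exists N; split=> // w /= gw; apply: sub => /= h; apply: gw.
by have := h I => -[] /eqP; rewrite mulf_eq0 => /orP[] /eqP.
Qed.

Lemma fiid_haus (c : nat -> R) : fiid_correlations R d c -> haus d (ext1 c).
Proof.
move=> [P [f [Y [HP [mf if2 ri] nc fY hc]]]].
have sf : sqint P f by [].
have f1 : 0 < ip P (fun w => f w - \int[P]_x f x) (fun w => f w - \int[P]_x f x).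
  apply: ip_gt0; first exact: centered_sqint_f.
  move=> h; apply: nc; exists (\int[P]_x f x).
  by apply: filterS h => w /eqP; rewrite subr_eq0 => /eqP.
have e := correlation_sequence_ip hd HP sf fY f1 hc.
apply: (spectral_haus hd HP (centered_sqint_f sf) (centered_mean sf) _ f1).
exact: (factor_mom HP sf fY e).
Qed.

(** The process is defined through chosen automorphisms [al v], and root invariance makes the choice
    immaterial. A function of mean zero and positive norm cannot be almost surely constant. *)
Lemma fiid_intro (P : probability Om R) (f : Om -> R) : is_lebesgue_product P ->
  sqint P f -> root_invariant f -> \int[P]_w f w = 0 -> 0 < ip P f f ->
  exists2 c, fiid_correlations R d c &
    forall k, ip P f (iter k (@Mop R d) f) = ip P f f * mom d (ext1 c) k.
Proof.
move=> HP sf ri f0 f1.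
pose al v := sval (cid2 (@tree_transitive d v)).
have [al1 al2] : (forall v, tree_aut (al v)) /\ forall v, al v (tree_root d) = v.
  by split=> v; rewrite /al; case: cid2.
pose Y v (w : Om) := f (relabel (al v) w).
have fY : is_factor_process f Y.
  move=> v a aa av w; rewrite /Y; have [b [ab Kb bK]] := tree_aut_inv (al1 v).
  rewrite -(ri (b \o a)) //=.
  - congr f; apply/funext => u; rewrite /relabel /=; by rewrite bK.
  - exact: tree_aut_comp.
  - by rewrite av -[X in b X](al2 v) Kb.
have fE : (fun w => f w - \int[P]_x f x) = f by apply/funext => w; rewrite f0 subr0.
have f1' : 0 < ip P (fun w => f w - \int[P]_x f x) (fun w => f w - \int[P]_x f x) by rewrite fE.
have [c [hc e]] := factor_correlation_sequence hd HP sf fY f1'.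
exists c; last by have := factor_mom HP sf fY e; rewrite fE.
exists P, f, Y; split=> //; first by split=> //; [exact: sf.1|exact: sf.2].
move=> [r hr]; move: f1; suff -> : ip P f f = 0 by rewrite ltxx.
have r0 : \int[P]_w f w = r.
  rewrite -[RHS](prob_Rintegral_cst P) /Rintegral; congr fine.
  apply: ae_eq_integral => //.
  - by apply/measurable_EFinP; exact: sf.1.
  - by apply: filterS hr => w -> _.
rewrite /ip /Rintegral (@ae_eq_integral _ _ _ P setT (cst 0%E)) //.
- by rewrite integral_cst //= mul0e.
- by apply/measurable_EFinP; apply: measurable_funM; exact: sf.1.
- by apply: filterS hr => w fw _; rewrite /= fw -r0 f0 mulr0.
Qed.

End FiidCorrelations.

(** * Existence of the product measure *)

Section UniformSplitting.
Variable R : realType.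
Notation RT := (measurableTypeR R).
Let U : probability RT R := uniform_prob (@ltr01 R).

(** The distribution function of the uniform law on [0, 1]. *)
Definition clamp (x : R) : R := Num.max 0 (Num.min x 1).

Lemma uniform_mass (A : set R) : measurable A -> U A = (unif_mass A)%:E.
Proof.
move=> mA; have mI : measurable (A `&` `[0, 1]%classic : set R) by exact: measurableI.
have fin : lebesgue_measure (A `&` `[0, 1]%classic : set R) \is a fin_num.
  rewrite ge0_fin_numE //; apply: (@le_lt_trans _ _ (lebesgue_measure (`[0, 1]%classic : set R))).
    by apply: le_measure; rewrite ?inE //; exact: subIsetr.
  by rewrite lebesgue_measure_itv /= lte_fin ltr01 -EFinB ltry.
rewrite /unif_mass fineK // /U /= /uniform_prob integral_uniform_pdf.
rewrite (eq_integral (fun=> 1%:E)); last first.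
  by move=> x; rewrite inE /= => -[_]; rewrite in_itv /= /uniform_pdf => ->; rewrite subr0 invr1.
by rewrite integral_cst //= mul1e.
Qed.

Lemma unif_mass_ray (x : R) : unif_mass (`]-oo, x[%classic : set R) = clamp x.
Proof.
rewrite /unif_mass; have [x0|x0] := leP x 0.
  rewrite (_ : _ `&` _ = set0).
    by rewrite measure0 /clamp; case: (leP x 1) => [h|]; [rewrite max_l|lra].
  apply/seteqP; split=> // y /= []; rewrite !in_itv /= => yx /andP[y0 _].
  by have := lt_le_trans yx x0; rewrite ltNge y0.
have [x1|x1] := leP x 1.
  rewrite (_ : _ `&` _ = `[0, x[%classic).
    by rewrite lebesgue_measure_itv /= lte_fin x0 -EFinB subr0 /= /clamp min_l // max_r // ltW.
  apply/seteqP; split=> y /=; rewrite !in_itv /=; first by case=> -> /andP[-> _].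
  by move=> /andP[-> yx]; rewrite yx (ltW (lt_le_trans yx x1)).
rewrite (_ : _ `&` _ = `[0, 1]%classic).
  by rewrite lebesgue_measure_itv /= lte_fin ltr01 -EFinB subr0 /= /clamp min_r ?max_r // ltW.
apply/seteqP; split=> y /=; rewrite !in_itv /=; first by case.
by move=> /andP[y0 y1]; rewrite y0 y1 (le_lt_trans y1 x1).
Qed.

Lemma clampE0 x : x <= 0 -> clamp x = 0.
Proof. by move=> h; rewrite /clamp min_l ?max_l //; lra. Qed.

Lemma clampE1 x : 1 <= x -> clamp x = 1.
Proof. by move=> h; rewrite /clamp min_r ?max_r //; lra. Qed.

Lemma clamp_mid x : 0 <= x -> x <= 1 -> clamp x = x.
Proof. by move=> h h'; rewrite /clamp min_l ?max_r //; lra. Qed.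

(** The self-similarity of the uniform law under the doubling map, in terms of its distribution
    function. *)
Lemma clamp_half x : clamp x = (clamp (2 * x) + clamp (2 * x - 1)) / 2.
Proof.
have [x0|x0] := leP x 0; first by rewrite !clampE0 ?addr0 ?mul0r //; lra.
have [x1|x1] := leP 1 x; first by rewrite !clampE1; lra.
have [xh|xh] := leP x (1 / 2).
  by rewrite (@clampE0 (2 * x - 1)) ?(@clamp_mid (2 * x)) ?clamp_mid; lra.
by rewrite (@clampE1 (2 * x)) ?(@clamp_mid (2 * x - 1)) ?clamp_mid; lra.
Qed.

Lemma clamp01 x : 0 <= clamp x <= 1.
Proof. by rewrite /clamp le_max lexx /= ge_max ler01 /= ge_min lexx orbT. Qed.

Lemma unif_mass_ge0 (A : set R) : 0 <= unif_mass A.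
Proof. by apply: fine_ge0; exact: measure_ge0. Qed.

Lemma unif_mass_le1 (A : set R) : measurable A -> unif_mass A <= 1.
Proof.
by move=> mA; rewrite -lee_fin -uniform_mass //; exact: probability_le1.
Qed.

Section Independence.
Context dT (T : measurableType dT) (Q : probability T R).

(** Both sides are finite measures in [B] and agree on the rays, a generating pi-system. The
    hypothesis forces [p] to be the mass of [E], so this is a criterion for [X] to be uniform and
    independent of [E]. *)
Lemma indep_ray (X : T -> RT) (E : set T) (p : R) : measurable_fun setT X -> measurable E ->
  0 <= p -> (forall x, Q ([set t | X t < x] `&` E) = (clamp x * p)%:E) ->
  forall B : set R, measurable B -> Q (X @^-1` B `&` E) = (unif_mass B * p)%:E.
Proof.
move=> mX mE p0 hray B mB.
pose m1 (mX : measurable_fun setT X) : {measure set RT -> \bar R} :=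
  measure_function_pushforward__canonical__measure_function_Measure (mrestr Q mE) mX.
pose m2 : {measure set RT -> \bar R} := mscale (NngNum p0) U.
have m2E (A : set R) : measurable A -> m2 A = (unif_mass A * p)%:E.
  move=> mA; transitivity (p%:E * U A)%E; first by [].
  by rewrite uniform_mass // -EFinM mulrC.
rewrite -m2E //.
transitivity (m1 mX B); first by [].
apply: (@measure_unique _ R RT (@RGenInftyO.G R) (fun n => `]-oo, n%:R[%classic)
  _ _ _ _ (m1 mX) m2 _ _ B mB).
- exact: RGenInftyO.measurableE.
- move=> _ _ [x ->] [y ->]; exists (Num.min x y); apply/seteqP; split=> z /=.
    by rewrite !in_itv /= lt_min => -[-> ->].
  by rewrite !in_itv /= lt_min => /andP[].
- by move=> n; exists n%:R.
- apply/seteqP; split=> // z _; exists (Num.truncn z).+1 => //=.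
  by rewrite in_itv /= truncnS_gt.
- move=> _ [x ->]; rewrite m2E // unif_mass_ray -hray.
  transitivity (Q (X @^-1` `]-oo, x[%classic `&` E)); first by [].
  congr (Q (_ `&` E)); by apply/seteqP; split=> t /=; rewrite in_itv.
- move=> n; apply: (@le_lt_trans _ _ (Q setT)).
    by apply: le_measure; rewrite ?inE //; apply: measurableI => //; rewrite -[X in measurable X]setTI; exact: mX.
  by rewrite probability_setT ltry.
Qed.

End Independence.
End UniformSplitting.

(** * Independent uniform variables from binary digits *)

Section BinaryDigits.
Variable R : realType.
Notation RT := (measurableTypeR R).
Let U : probability RT R := uniform_prob (@ltr01 R).

Definition digit (u : R) : bool := 2^-1 <= u.

Definition shift (u : RT) : RT := 2 * u - (digit u)%:R.

Lemma digit_measurable : measurable [set u : RT | digit u].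
Proof.
rewrite (_ : [set u : RT | digit u] = `[2^-1, +oo[%classic); first exact: measurable_itv.
by apply/seteqP; split=> u /=; rewrite in_itv /= andbT.
Qed.

Lemma indic_digit (u : RT) : \1_[set u | digit u] u = (digit u)%:R :> R.
Proof. by rewrite indicE; congr (nat_of_bool _)%:R; apply/idP/idP; rewrite inE. Qed.

Lemma shift_measurable : measurable_fun setT shift.
Proof.
rewrite (_ : shift = fun u => 2 * u - \1_[set u | digit u] u); last first.
  by apply/funext => u; rewrite indic_digit.
apply: measurable_funB; last by apply: measurable_indic; exact: digit_measurable.
by apply: measurable_funM; [exact: measurable_cst|exact: measurable_id].
Qed.

Lemma mass_ray (x : R) : U [set u | u < x] = (clamp x)%:E.
Proof.
by rewrite -unif_mass_ray -uniform_mass.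
Qed.

(** Tested on rays: for either value of the digit, the event is an explicit interval whose uniform
    mass is half of [clamp x]. *)
Lemma shift_indep (a : bool) (B : set R) : measurable B ->
  U (shift @^-1` B `&` [set u | digit u = a]) = (unif_mass B / 2)%:E.
Proof.
have mray (x : R) : measurable [set u : RT | u < x].
  rewrite (_ : [set u : RT | u < x] = `]-oo, x[%classic); first exact: measurable_itv.
  by apply/seteqP; split=> u /=; rewrite in_itv.
have mE : measurable [set u : RT | digit u = a].
  case: a; first exact: digit_measurable.
  rewrite (_ : [set u : RT | digit u = false] = ~` [set u | digit u]).
    exact: measurableC digit_measurable.
  by apply/seteqP; split=> u /=; [move=> ->|move/negP/negbTE].
apply: (indep_ray shift_measurable mE) => // x.
have dT (u : R) : digit u = true -> 2^-1 <= u by [].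
have dF (u : R) : digit u = false -> u < 2^-1 by move/negbT; rewrite -ltNge.
have [x0|x0] := leP x 0; case: a {mE}.
- rewrite (_ : _ `&` _ = set0) ?measure0 ?clampE0 ?mul0r //.
  by apply/seteqP; split=> // u [/= + h]; rewrite /shift h /=; move: (dT u h); lra.
- rewrite (_ : _ `&` _ = [set u | u < x / 2]).
    by rewrite mass_ray !clampE0 ?mul0r //; lra.
  apply/seteqP; split=> u /=; rewrite /shift; first by case=> + h; rewrite h /=; lra.
  move=> h; have -> : digit u = false by apply/negbTE; rewrite /digit -ltNge; lra.
  by split=> //=; lra.
- rewrite (_ : _ `&` _ = [set u | u < (x + 1) / 2] `\` [set u | u < 2^-1]); last first.
    apply/seteqP; split=> u /=; rewrite /shift.
      case=> + h; rewrite h /= => h'; have := dT u h => h2.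
      by split; [lra|move=> h3; lra].
    move=> [h /negP]; rewrite -leNgt => h2; have -> : digit u = true by [].
    by split=> //=; lra.
  rewrite measureD //; last first.
    by apply: (@le_lt_trans _ _ 1%E); [exact: probability_le1|rewrite ltry].
  rewrite (_ : _ `&` _ = [set u | u < 2^-1]); last first.
    by apply/seteqP; split=> u /=; [case|move=> h; split=> //; lra].
  transitivity (U [set u | (u < (x + 1) / 2)%R] - U [set u | (u < 2^-1)%R])%E; first by [].
  rewrite !mass_ray -EFinB; congr EFin.
  rewrite (clamp_half ((x + 1) / 2)) (@clamp_mid _ 2^-1); [|lra..].
  rewrite (@clampE1 _ (2 * ((x + 1) / 2))); last by lra.
  have -> : 2 * ((x + 1) / 2) - 1 = x by field.
  by lra.
- rewrite (_ : _ `&` _ = [set u | u < Num.min 2^-1 (x / 2)]); last first.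
    apply/seteqP; split=> u /=; rewrite /shift lt_min.
      by case=> + h; rewrite h /= => h'; rewrite (dF u h) /=; lra.
    move=> /andP[h h']; have -> : digit u = false by rewrite /digit leNgt h.
    by split=> //=; lra.
  rewrite mass_ray; congr EFin; have [x1|x1] := leP 1 x.
    by rewrite min_l ?(@clampE1 _ x) ?clamp_mid; lra.
  by rewrite min_r ?(@clamp_mid _ x) ?clamp_mid; lra.
Qed.

Lemma shift_split (C C0 C1 : set R) : measurable C0 -> measurable C1 -> measurable C ->
  (forall u, C u <-> if digit u then C1 (shift u) else C0 (shift u)) ->
  unif_mass C = (unif_mass C0 + unif_mass C1) / 2.
Proof.
move=> m0 m1 mC hC; apply: EFin_inj; rewrite -uniform_mass //.
have e : C = (shift @^-1` C0 `&` [set u | digit u = false]) `|`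
             (shift @^-1` C1 `&` [set u | digit u = true]).
  apply/seteqP; split=> u.
    by move/hC; case E: (digit u) => h; [right|left].
  by case=> -[/= h E]; apply/hC; rewrite E.
have mpre B : measurable B -> measurable (shift @^-1` B).
  by move=> mB; rewrite -[X in measurable X]setTI; exact: shift_measurable.
have mf : measurable [set u : RT | digit u = false].
  rewrite (_ : [set u : RT | digit u = false] = ~` [set u | digit u]).
    exact: measurableC digit_measurable.
  by apply/seteqP; split=> u /=; [move=> ->|move/negP/negbTE].
have mt := digit_measurable.
rewrite e measureU; first last.
- by apply/seteqP; split=> // u [] [_ /= ->] [_ /=].
- by apply: measurableI => //; exact: mpre.
- by apply: measurableI => //; exact: mpre.
transitivity (U (shift @^-1` C0 `&` [set u | digit u = false]) +
              U (shift @^-1` C1 `&` [set u | digit u = true]))%E; first by [].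
by rewrite !shift_indep // -EFinD mulrDl.
Qed.

Fixpoint spart (n : nat) (u : RT) : RT :=
  if n is n'.+1 then ((digit u)%:R + spart n' (shift (shift u))) / 2 else 0.

Lemma spart_measurable n : measurable_fun setT (spart n).
Proof.
elim: n => [|n IH]; first exact: measurable_cst.
rewrite (_ : spart n.+1 = fun u => (\1_[set u | digit u] u + spart n (shift (shift u))) / 2).
  apply: measurable_funM; last exact: measurable_cst.
  apply: measurable_funD; first by apply: measurable_indic; exact: digit_measurable.
  apply: measurableT_comp IH _.
  exact: measurableT_comp shift_measurable shift_measurable.
by apply/funext => u; rewrite indic_digit.
Qed.

Lemma spart_bound n u : 0 <= spart n u <= 1.
Proof.
elim: n u => [|n IH] u /=; first by rewrite lexx ler01.
have := IH (shift (shift u)); case: (digit u) => /=; lra.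
Qed.

Lemma spart_nd u : nondecreasing_seq (spart^~ u).
Proof.
apply/nondecreasing_seqP => n; elim: n u => [|n IH] u.
  by have /andP[] := spart_bound 1 u.
by have := IH (shift (shift u)); rewrite /=; lra.
Qed.

(* The digits of [u] of even rank; those of odd rank remain available to build
   further independent uniform variables. *)
Definition dpart (u : RT) : RT := limn (spart^~ u).

Lemma spart_cvg u : spart^~ u @ \oo --> dpart u.
Proof.
apply: nondecreasing_is_cvgn; first exact: spart_nd.
by exists 1 => _ [n _ <-]; case/andP: (spart_bound n u).
Qed.

Lemma dpart_measurable : measurable_fun setT dpart.
Proof.
apply: (measurable_fun_cvg (h := spart)); first exact: spart_measurable.
by move=> u _; exact: spart_cvg.
Qed.

Lemma dpart01 u : 0 <= dpart u <= 1.
Proof.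
apply/andP; split.
  by apply: (cvgr_to_ge (@spart_cvg u)); apply: nearW => n; case/andP: (spart_bound n u).
by apply: (cvgr_to_le (@spart_cvg u)); apply: nearW => n; case/andP: (spart_bound n u).
Qed.

Lemma dpartE u : dpart u = ((digit u)%:R + dpart (shift (shift u))) / 2.
Proof.
have h : (fun n => spart n.+1 u) @ \oo --> dpart u.
  by have := @spart_cvg u; rewrite -(cvg_shiftS (spart^~ u)).
apply: cvg_unique h _ => //.
by apply: cvgMr_tmp; apply: cvgD; [exact: cvg_cst|exact: spart_cvg].
Qed.

Definition epart (u : RT) : RT := dpart (shift u).

Lemma epart_measurable : measurable_fun setT epart.
Proof. exact: measurableT_comp dpart_measurable shift_measurable. Qed.

Definition quad (x y : R) : set RT := [set u | dpart u < x /\ epart u < y].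

Lemma measurable_lt (g : RT -> RT) (x : R) : measurable_fun setT g -> measurable [set u | g u < x].
Proof.
move=> mg; rewrite (_ : [set u | g u < x] = setT `&` g @^-1` `]-oo, x[%classic).
  exact: mg.
by apply/seteqP; split=> u /=; rewrite in_itv //=; case.
Qed.

Lemma quad_measurable x y : measurable (quad x y).
Proof.
by apply: measurableI; apply: measurable_lt; [exact: dpart_measurable|exact: epart_measurable].
Qed.

Let K x y := unif_mass (quad x y).

(** The first digit of [u] belongs to [dpart] and the second to [epart]; conditioning on both leaves
    a pair with the same law and rescaled thresholds. *)
Lemma quad_rec x y : K x y =
  (K (2 * x) (2 * y) + K (2 * x) (2 * y - 1) + K (2 * x - 1) (2 * y) + K (2 * x - 1) (2 * y - 1)) / 4.
Proof.
(* After one shift the two parts exchange their roles. *)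
pose C (a : R) := [set u : RT | dpart (shift u) < 2 * x - a /\ dpart u < y].
have mC a : measurable (C a).
  apply: measurableI; apply: measurable_lt; last exact: dpart_measurable.
  exact: epart_measurable.
have -> : K x y = (unif_mass (C 0) + unif_mass (C 1)) / 2.
  apply: (shift_split (mC 0) (mC 1) (quad_measurable x y)).
  move=> u; rewrite /quad /C /= {1}dpartE /epart.
  by case: (digit u) => /=; split=> -[h1 h2]; split=> //; lra.
have hC a : unif_mass (C a) = (K (2 * x - a) (2 * y) + K (2 * x - a) (2 * y - 1)) / 2.
  apply: (shift_split (quad_measurable (2 * x - a) (2 * y))
    (quad_measurable (2 * x - a) (2 * y - 1)) (mC a)).
  move=> u; rewrite /quad /C /= {1}(dpartE u) /epart.
  by case: (digit u) => /=; split=> -[h1 h2]; split=> //; lra.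
by rewrite !hC subr0; field.
Qed.

Lemma quad_lo x y : x <= 0 \/ y <= 0 -> K x y = 0.
Proof.
move=> h; rewrite /K /unif_mass (_ : _ `&` _ = set0) ?measure0 //.
apply/seteqP; split=> // u [[/= h1 h2] _].
have /andP[a _] := dpart01 u; have /andP[b _] := dpart01 (shift u).
by move: h2; rewrite /epart; case: h; lra.
Qed.

Lemma quad_hix x x' y : 1 < x -> 1 < x' -> K x y = K x' y.
Proof.
move=> h h'; congr unif_mass; apply/seteqP; split=> u [_ ?]; split=> //;
  by have /andP[_] := dpart01 u; lra.
Qed.

Lemma quad_hiy x y y' : 1 < y -> 1 < y' -> K x y = K x y'.
Proof.
move=> h h'; congr unif_mass; apply/seteqP; split=> u [? _]; split=> //;
  by rewrite /epart; have /andP[_] := dpart01 (shift u); lra.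
Qed.

Lemma quad_full x y : 1 < x -> 1 < y -> K x y = 1.
Proof.
move=> hx hy; apply: EFin_inj; rewrite /K -uniform_mass; last exact: quad_measurable.
rewrite (_ : quad x y = setT); first exact: probability_setT.
apply/seteqP; split=> // u _; split.
  by have /andP[_] := dpart01 u; lra.
by rewrite /epart; have /andP[_] := dpart01 (shift u); lra.
Qed.

Let Del x y := K x y - clamp x * clamp y.

Let Del_rec x y : Del x y =
  (Del (2 * x) (2 * y) + Del (2 * x) (2 * y - 1) + Del (2 * x - 1) (2 * y) + Del (2 * x - 1) (2 * y - 1)) / 4.
Proof.
by rewrite /Del quad_rec (clamp_half x) (clamp_half y); field.
Qed.

Let Del_bound x y : `|Del x y| <= 1.
Proof.
have k0 := unif_mass_ge0 (quad x y); have k1 := unif_mass_le1 (quad_measurable x y).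
have /andP[a0 a1] := clamp01 x; have /andP[b0 b1] := clamp01 y.
have c0 : 0 <= clamp x * clamp y by rewrite mulr_ge0.
have c1 : clamp x * clamp y <= 1 by rewrite mulr_ile1.
by rewrite /Del /K ler_norml; apply/andP; split; lra.
Qed.

Let half_pow_le (r : R) : (forall n, `|r| <= 2^-1 ^+ n) -> r = 0.
Proof.
move=> h; apply/eqP; rewrite -normr_le0.
have c : (fun n => 2^-1 ^+ n : R) @ \oo --> (0 : R).
  by apply: cvg_expr; rewrite ger0_norm ?invr_ge0 // invf_lt1 // ltr1n.
by apply: (cvgr_to_ge c); exact: nearW.
Qed.

Let Del_lo x y : x <= 0 \/ y <= 0 -> Del x y = 0.
Proof.
by move=> h; rewrite /Del quad_lo //; case: h => h; rewrite (clampE0 h) ?mul0r ?mulr0 subrr.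
Qed.

Let Del_hix x x' y : 1 < x -> 1 < x' -> Del x y = Del x' y.
Proof.
by move=> h h'; rewrite /Del (quad_hix y h h') (clampE1 (ltW h)) (clampE1 (ltW h')).
Qed.

Let Del_hiy x y y' : 1 < y -> 1 < y' -> Del x y = Del x y'.
Proof.
by move=> h h'; rewrite /Del (quad_hiy x h h') (clampE1 (ltW h)) (clampE1 (ltW h')).
Qed.

Let Del_full x y : 1 < x -> 1 < y -> Del x y = 0.
Proof.
by move=> h h'; rewrite /Del quad_full // (clampE1 (ltW h)) (clampE1 (ltW h')) mulr1 subrr.
Qed.

(* The difference of the joint distribution function and the product vanishes
   because the self-similarity relation contracts it. *)
Let Del_marginal x : Del x 2 = 0 /\ Del 2 x = 0.
Proof.
suff H n : forall x, `|Del x 2| <= 2^-1 ^+ n /\ `|Del 2 x| <= 2^-1 ^+ n.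
  by split; apply: half_pow_le => n; case: (H n x).
elim: n => [|n IH] {}x; first by rewrite expr0 !Del_bound.
have e1 : Del x 2 = (Del (2 * x) 2 + Del (2 * x - 1) 2) / 2.
  rewrite Del_rec (@Del_hiy (2 * x) (2 * 2) 2) ?(@Del_hiy (2 * x) (2 * 2 - 1) 2)
    ?(@Del_hiy (2 * x - 1) (2 * 2) 2) ?(@Del_hiy (2 * x - 1) (2 * 2 - 1) 2); try lra.
have e2 : Del 2 x = (Del 2 (2 * x) + Del 2 (2 * x - 1)) / 2.
  rewrite Del_rec (@Del_hix (2 * 2) 2 (2 * x)) ?(@Del_hix (2 * 2) 2 (2 * x - 1))
    ?(@Del_hix (2 * 2 - 1) 2 (2 * x)) ?(@Del_hix (2 * 2 - 1) 2 (2 * x - 1)); try lra.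
have [a1 a2] := IH (2 * x); have [b1 b2] := IH (2 * x - 1).
rewrite e1 e2 exprS !normrM (@ger0_norm _ 2^-1) ?invr_ge0 //.
rewrite ![_ * 2^-1]mulrC !ler_pM2l ?invr_gt0 //.
have [xh|xh] := leP x 2^-1.
  have z : 2 * x - 1 <= 0 by lra.
  by rewrite (@Del_lo (2 * x - 1) 2) ?(@Del_lo 2 (2 * x - 1)) ?addr0; [|right|left].
have z : 1 < 2 * x by lra.
by rewrite (@Del_full (2 * x) 2) ?(@Del_full 2 (2 * x)) ?add0r //; lra.
Qed.

(** Of the four terms at most one survives: when x <= 1/2 those at 2 x - 1 vanish, when x > 1/2
    those at 2 x are marginal, and likewise for y. Thresholds above 1 play the part of infinity,
    hence the 2 in the marginals. *)
Let Del0 x y : Del x y = 0.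
Proof.
suff H n : forall x y, `|Del x y| <= 2^-1 ^+ n by apply: half_pow_le => n; exact: H.
elim: n => [|n IH] {}x {}y; first by rewrite expr0 Del_bound.
have big_x z : 1 < 2 * x -> Del (2 * x) z = 0.
  by move=> h; rewrite (@Del_hix _ 2) //; [case: (Del_marginal z)|lra].
have big_y z : 1 < 2 * y -> Del z (2 * y) = 0.
  by move=> h; rewrite (@Del_hiy _ _ 2) //; [case: (Del_marginal z)|lra].
have small_x z : x <= 2^-1 -> Del (2 * x - 1) z = 0 by move=> h; apply: Del_lo; left; lra.
have small_y z : y <= 2^-1 -> Del z (2 * y - 1) = 0 by move=> h; apply: Del_lo; right; lra.
have q a b : `|Del a b / 4| <= 2^-1 ^+ n.+1.
  rewrite normrM (@ger0_norm _ 4^-1) ?invr_ge0 // exprS.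
  have := IH a b; have : 0 <= 2^-1 ^+ n :> R by rewrite exprn_ge0 // invr_ge0.
  by lra.
rewrite Del_rec; have [hx|hx] := leP x 2^-1; have [hy|hy] := leP y 2^-1.
- by rewrite !small_x // small_y // !addr0.
- by rewrite !small_x // big_y ?addr0 ?add0r //; lra.
- by rewrite !big_x ?small_y ?addr0 ?add0r //; lra.
- by rewrite !big_x ?big_y ?add0r //; lra.
Qed.

Lemma quad_mass x y : unif_mass (quad x y) = clamp x * clamp y.
Proof. by have /eqP := Del0 x y; rewrite /Del subr_eq0 => /eqP. Qed.

(** Quadrants are extended to rectangles one side at a time, by two uses of [indep_ray]. *)
Lemma split_indep (A B : set R) : measurable A -> measurable B ->
  U (dpart @^-1` A `&` epart @^-1` B) = (unif_mass A * unif_mass B)%:E.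
Proof.
move=> mA mB; have md := dpart_measurable; have me := epart_measurable.
have mpre (g : RT -> RT) C : measurable_fun setT g -> measurable C -> measurable (g @^-1` C).
  by move=> mg mC; rewrite -[X in measurable X]setTI; exact: mg.
have dray (y : R) (C : set R) : measurable C ->
    U (dpart @^-1` C `&` [set u | epart u < y]) = (unif_mass C * clamp y)%:E.
  apply: (indep_ray md); [exact: measurable_lt|by case/andP: (clamp01 y)|].
  move=> x; rewrite -quad_mass -uniform_mass; last exact: quad_measurable.
  by congr (uniform_prob _ _).
have dall C : measurable C -> U (dpart @^-1` C) = (unif_mass C)%:E.
  move=> mC; rewrite -[unif_mass C]mulr1 -(@clampE1 _ 2) ?ler1n // -dray //.
  congr (uniform_prob _ _); apply/seteqP; split=> u /=; last by case.
  by split=> //; rewrite /epart; have /andP[_] := dpart01 (shift u); lra.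
rewrite setIC mulrC; apply: (indep_ray me) => //; [exact: mpre|exact: unif_mass_ge0|].
by move=> y; rewrite setIC dray // mulrC.
Qed.

Fixpoint tail (n : nat) (u : RT) : RT := if n is n'.+1 then tail n' (epart u) else u.

(** Each step spends half of the remaining digits on one coordinate and keeps the other half. *)
Definition coordn (n : nat) (u : RT) : RT := dpart (tail n u).

Lemma coordn_measurable n : measurable_fun setT (coordn n).
Proof.
suff mt : measurable_fun setT (tail n) by exact: measurableT_comp dpart_measurable mt.
elim: n => [|n IH]; first exact: measurable_id.
exact: measurableT_comp IH epart_measurable.
Qed.

(** [coordn i.+1] is [coordn i] after [epart], so [split_indep] detaches coordinate 0. *)
Lemma coordn_indep N (B : nat -> set R) : (forall i, measurable (B i)) ->
  U [set u | forall i, (i < N)%N -> B i (coordn i u)] = (\prod_(i < N) unif_mass (B i))%:E.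
Proof.
elim: N B => [|N IH] B mB.
  rewrite big_ord0 (_ : [set _ | _] = setT); first exact: probability_setT.
  by apply/seteqP; split.
have mA : measurable [set u : RT | forall i, (i < N)%N -> B i.+1 (coordn i u)].
  rewrite (_ : [set _ | _] = \bigcap_i [set u | (i < N)%N -> B i.+1 (coordn i u)]); last first.
    by apply/seteqP; split=> [u h i _|u h i]; [exact: h|exact: (h i I)].
  apply: bigcapT_measurable => i; case: (ltnP i N) => iN.
    rewrite (_ : [set _ | _] = coordn i @^-1` B i.+1).
      by have := @coordn_measurable i measurableT _ (mB i.+1); rewrite setTI.
    by apply/seteqP; split=> u /=; [exact|move=> h _].
  by rewrite (_ : [set _ | _] = setT) //; apply/seteqP; split.
rewrite (_ : [set _ | _] = dpart @^-1` B 0 `&`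
    epart @^-1` [set u | forall i, (i < N)%N -> B i.+1 (coordn i u)]); last first.
  apply/seteqP; split=> [u h|u [h0 h1] [|i] iN].
  - by split=> [|i iN]; [exact: (h 0)|exact: (h i.+1)].
  - exact: h0.
  - exact: (h1 i).
rewrite split_indep // big_ord_recl; congr (_ * _)%:E.
by apply: EFin_inj; rewrite -uniform_mass // (IH (fun i => B i.+1)).
Qed.

End BinaryDigits.

Lemma lebesgue_product_exists (R : realType) (d : nat) :
  exists P : probability (labelling R d) R, is_lebesgue_product P.
Proof.
pose U : probability (measurableTypeR R) R := uniform_prob (@ltr01 R).
pose code (v : tree d) : nat := choice.pickle (val v : seq 'I_d).
have code_inj : injective code by move=> v w /(pcan_inj choice.pickleK) /val_inj.
pose X0 (u : measurableTypeR R) : labelling R d :=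
  fun v => exist (fun t : R => 0 <= t <= 1) (coordn (code v) u) (dpart01 _).
have mX0 : measurable_fun setT X0.
  apply: (@measurability _ _ (measurableTypeR R) (labelling R d) setT X0 (@cylinders R d)) => //.
  move=> _ [_ [v [B [mB ->]]] <-]; exact: (coordn_measurable (code v)).
pose X : {mfun measurableTypeR R >-> labelling R d} := mfun_Sub (mem_set mX0).
exists (distribution U X) => s B us mB.
pose N := (\max_(v <- s) (code v).+1)%N.
(* The conditions transported along [code]; an index that codes no vertex of [s] receives the whole
   line, of mass 1. *)
pose B' i : set R := [set x | forall v, v \in s -> code v = i -> B v x].
have B'p v : v \in s -> B' (code v) = B v.
  move=> vs; apply/seteqP; split=> x /=; first by apply.
  by move=> Bx w _ /code_inj ->.
have B'n i : i \notin [seq code v | v <- s] -> B' i = setT.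
  move=> /negP is_; apply/seteqP; split=> // x _ v vs e.
  by case: is_; rewrite -e map_f.
have mB' i : measurable (B' i).
  have [/mapP[v vs ->]|/B'n -> //] := boolP (i \in [seq code v | v <- s]).
  by rewrite B'p.
transitivity (U [set u | forall i, (i < N)%N -> B' i (coordn i u)]).
  rewrite /distribution /= /pushforward /=; congr (uniform_prob _ _).
  apply/seteqP; split=> u /= h.
    move=> i _; have [/mapP[v vs ->]|/B'n -> //] := boolP (i \in [seq code v | v <- s]).
    by rewrite B'p //; exact: h.
  move=> v vs; have := h (code v); rewrite B'p //; apply.
  by rewrite /N (big_rem v) //= leq_max leqnn.
rewrite coordn_indep //; congr EFin.
have mT : unif_mass (setT : set R) = 1.
  by apply: EFin_inj; rewrite -uniform_mass //; exact: probability_setT.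
rewrite -(big_mkord xpredT (fun i => unif_mass (B' i))).
rewrite (bigID (fun i => i \in [seq code v | v <- s])) /= [X in _ * X]big1 ?mulr1; last first.
  by move=> i /B'n ->.
rewrite -big_filter (perm_big [seq code v | v <- s]) /=.
  by rewrite big_map !big_seq; apply: eq_bigr => v vs; rewrite B'p.
apply: uniq_perm; first by rewrite filter_uniq // iota_uniq.
  by rewrite map_inj_uniq //; exact: code_inj.
move=> i; rewrite mem_filter andb_idr // => /mapP[v vs ->].
by rewrite mem_index_iota /= /N (big_rem v) //= leq_max leqnn.
Qed.

(** * Truncated spherical functions *)

Section Balls.
Variable d : nat.

Lemma lmulK (i : 'I_d) : involutive (lmul i).
Proof.
move=> [w rw]; apply: val_inj; move: rw; rewrite /= /reduced; case: w => [|a t] /=.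
  by rewrite eqxx.
case: eqVneq => [->|ai] /= h; last by rewrite eqxx.
by case: t h => [|b t] //= /andP[ib _]; rewrite eq_sym (negPf ib).
Qed.

Lemma tball_exists n : exists s : seq (tree d), uniq s /\ forall u, (u \in s) = (height u <= n)%N.
Proof.
elim: n => [|n [s [us ms]]].
  exists [:: tree_root d]; split=> // u; rewrite inE leqn0 /height size_eq0.
  by apply/eqP/eqP => [->|e] //; apply: val_inj.
exists (undup (s ++ [seq lmul i u | u <- s, i <- enum 'I_d])); split; first exact: undup_uniq.
move=> u; rewrite mem_undup mem_cat ms; apply/orP/idP.
  case=> [h|/allpairsP[[v i] /= [vs _ ->]]]; first exact: leqW.
  move: vs; rewrite ms /height /= /lmulw; case: (val v) => [|a t] //= h.
  by case: eqP => _ //=; rewrite ltnW // ltnW.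
rewrite leq_eqVlt => /orP[/eqP e|h]; last by left.
right; case E: (val u) => [|a t]; first by move: e; rewrite /height E.
apply/allpairsP; exists (lmul a u, a); split; rewrite ?mem_enum //=; last by rewrite lmulK.
by rewrite ms /height /= E /= eqxx; move: e; rewrite /height E /= => -[->].
Qed.

Definition tball n : seq (tree d) := sval (cid (tball_exists n)).

Lemma tball_uniq n : uniq (tball n).
Proof. by rewrite /tball; case: cid => s []. Qed.

Lemma mem_tball n u : (u \in tball n) = (height u <= n)%N.
Proof. by rewrite /tball; case: cid => s []. Qed.

Lemma height_rmul_le (i : 'I_d) u : (height (rmul i u) <= (height u).+1)%N.
Proof. by rewrite /height /= rmulw_size; case: ifP => _ //; lia. Qed.

Section Sums.
Variable V : nmodType.
Implicit Type phi : tree d -> V.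

Lemma ball_sum_filter phi n N : (n <= N)%N -> (forall u, (n < height u)%N -> phi u = 0) ->
  \sum_(u <- tball N) phi u = \sum_(u <- tball n) phi u.
Proof.
move=> nN phi0; rewrite (bigID (fun u => (height u <= n)%N)) /= [X in _ + X]big1 ?addr0; last first.
  by move=> u; rewrite -ltnNge => /phi0.
rewrite -big_filter; apply: perm_big; apply: uniq_perm.
- exact: filter_uniq (tball_uniq N).
- exact: tball_uniq.
- by move=> u; rewrite mem_filter !mem_tball andb_idr // => /leq_trans; apply.
Qed.

Lemma ball_sum_aut phi n (a : tree d -> tree d) : injective a -> (forall u, height (a u) = height u) ->
  (forall u, exists v, a v = u) ->
  \sum_(u <- tball n) phi (a u) = \sum_(u <- tball n) phi u.
Proof.
move=> ia ha sa; rewrite -(big_map a xpredT phi); apply: perm_big; apply: uniq_perm.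
- by rewrite map_inj_uniq ?tball_uniq.
- exact: tball_uniq.
- move=> u; apply/mapP/idP => [[v vn ->]|un]; first by rewrite mem_tball ha -mem_tball.
  have [v vu] := sa u; exists v => //; by rewrite mem_tball -ha vu -mem_tball.
Qed.

(** A translation changes heights by at most one, and [n < N] leaves room for it, so both sums cover
    the whole support. *)
Lemma ball_sum_rmul phi n N (i : 'I_d) : (n < N)%N -> (forall u, (n < height u)%N -> phi u = 0) ->
  \sum_(u <- tball N) phi (rmul i u) = \sum_(u <- tball N) phi u.
Proof.
move=> nN phi0; rewrite (bigID (fun u => (height (rmul i u) <= n)%N)) /=.
rewrite [X in _ + X]big1 ?addr0; last by move=> u; rewrite -ltnNge => /phi0.
rewrite (@ball_sum_filter phi n) ?(ltnW nN) //.
rewrite -big_filter -(big_map (rmul i) xpredT phi); apply: perm_big; apply: uniq_perm.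
- rewrite map_inj_uniq; last exact: rmul_inj.
  exact: filter_uniq (tball_uniq N).
- exact: tball_uniq.
- move=> u; apply/mapP/idP => [[v]|un].
    by rewrite mem_filter mem_tball => /andP[h _] ->; rewrite mem_tball.
  exists (rmul i u); last by rewrite rmulK.
  rewrite mem_filter rmulK -mem_tball un mem_tball.
  by move: un; rewrite mem_tball => un; apply: leq_trans (height_rmul_le _ _) (leq_ltn_trans un nN).
Qed.

End Sums.

Section Counting.
Variable R : realType.

Definition sphere_card N k : R := \sum_(u <- tball N) (height u == k)%:R.

Lemma ball_sum_height (h : nat -> R) N :
  \sum_(u <- tball N) h (height u) = \sum_(k < N.+1) sphere_card N k * h k.
Proof.
under [RHS]eq_bigr do rewrite mulr_suml.
rewrite exchange_big /= !big_seq; apply: eq_bigr => u; rewrite mem_tball => uN.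
rewrite (bigD1 (Ordinal (uN : (height u < N.+1)%N))) //= eqxx mul1r big1 ?addr0 // => k ku.
by case: eqVneq => [e|_]; [move: ku; rewrite -val_eqE /= -e eqxx|rewrite mul0r].
Qed.

Lemma sphere_card0 N : sphere_card N 0 = 1.
Proof.
rewrite /sphere_card (bigD1_seq (tree_root d)) ?tball_uniq ?mem_tball //= big1 ?addr0 // => u u0.
case: eqP => // e; case/negP: u0; apply/eqP/val_inj.
by move: e; rewrite /height; case: (val u).
Qed.

(** Double counting of the pairs formed by a vertex at height k + 1 and a translate at height k,
    translations being involutions; [k.+1 < N] keeps them inside the ball. *)
Lemma sphere_card_rec N k : (k.+1 < N)%N ->
  sphere_card N k.+1 = (if k is 0 then d%:R else d%:R - 1) * sphere_card N k.
Proof.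
move=> kN.
pose phi (i : 'I_d) (u : tree d) : R := (height u == k.+1)%:R * (height (rmul i u) == k)%:R.
have e : \sum_(i < d) \sum_(u <- tball N) phi i (rmul i u) = \sum_(i < d) \sum_(u <- tball N) phi i u.
  apply: eq_bigr => i _; apply: (@ball_sum_rmul _ _ k.+1) => // u ku.
  by rewrite /phi gtn_eqF ?mul0r.
move: e; rewrite exchange_big [RHS]exchange_big /=.
have -> : \sum_(u <- tball N) \sum_(i < d) phi i u = sphere_card N k.+1.
  rewrite /sphere_card; apply: eq_bigr => u _.
  rewrite -mulr_sumr (height_rmul_sum (fun n => (n == k)%:R)).
  case: (eqVneq (height u) k.+1) => [->|_]; last by rewrite mul0r.
  by rewrite eqxx mul1r gtn_eqF // mulr0 add0r.
move=> <-; rewrite mulr_sumr; apply: eq_bigr => u _.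
under eq_bigr do rewrite /phi rmulK mulrC.
rewrite -mulr_sumr (height_rmul_sum (fun n => (n == k.+1)%:R)) mulrC.
case: (eqVneq (height u) k) => [->|_]; last by rewrite !mulr0.
case: k {kN phi} => [|k]; first by rewrite ?eqxx !(mulr1, mul1r).
by rewrite ?eqxx ltn_eqF // !(mulr1, mul1r, addr0).
Qed.

Lemma sphere_cardE N k : (k.+1 < N)%N -> sphere_card N k.+1 = d%:R * (d%:R - 1) ^+ k.
Proof.
elim: k => [|k IH] kN; first by rewrite sphere_card_rec // sphere_card0 expr0.
by rewrite sphere_card_rec // IH ?(ltnW kN) // exprS; ring.
Qed.

End Counting.
End Balls.

Lemma cross_bound (R : realType) (t a b : R) : `|2 * t * a * b| <= `|t| * (a ^+ 2 + b ^+ 2).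
Proof.
rewrite !normrM (ger0_norm (_ : 0 <= 2 :> R)) //.
rewrite -(real_normK (num_real a)) -(real_normK (num_real b)).
have := mulr_ge0 (normr_ge0 t) (sqr_ge0 (`|a| - `|b|)).
by lra.
Qed.

Section TruncatedSpherical.
Variables (R : realType) (d : nat).
Hypothesis hd : (2 <= d)%N.
Variable t : R.
Hypothesis t1 : `|t| < 1.

Let s : R := Num.sqrt (d%:R - 1).
Let phi k : R := (sph R d k).[t].
(** The factor s^k offsets the growth (d - 1)^k of the spheres and turns the recurrence into that of
    the Chebyshev polynomials. *)
Let psi k : R := s ^+ k * phi k.

Let s0 : 0 < s. Proof. by rewrite sqrtr_gt0 d1_gt0. Qed.
Let s2 : s ^+ 2 = d%:R - 1. Proof. exact: sqr_sqrtd1. Qed.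
Let d0 : 0 < d%:R :> R. Proof. exact: d_gt0. Qed.

Let phi_rec k : phi k.+2 = (2 * s * t * phi k.+1 - phi k) / s ^+ 2.
Proof.
rewrite /phi sphSS !(hornerD, hornerN, hornerM, hornerZ, hornerX) -s2 /kap -/s; ring.
Qed.

Let psi_rec k : psi k.+2 = 2 * t * psi k.+1 - psi k.
Proof. by rewrite /psi phi_rec !exprS; field; rewrite gt_eqF. Qed.

(** The quadratic form conserved by the recurrence of [psi]. *)
Let inv k := psi k ^+ 2 - 2 * t * psi k * psi k.+1 + psi k.+1 ^+ 2.

Let inv_const k : inv k = inv 0.
Proof. by elim: k => [//|k <-]; rewrite /inv psi_rec; ring. Qed.

Let tsqr : t ^+ 2 < 1.
Proof. by rewrite -(real_normK (num_real t)) expr_lt1. Qed.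

Let inv_gt0 : 0 < inv 0.
Proof.
rewrite /inv {1 2}/psi expr0 mul1r /phi sph0 hornerC; set x := psi 1.
have -> : 1 ^+ 2 - 2 * t * 1 * x + x ^+ 2 = (x - t) ^+ 2 + (1 - t ^+ 2) by ring.
by rewrite ltr_wpDl ?sqr_ge0 ?subr_gt0.
Qed.

(* the invariant quadratic form [inv] is definite because [|t| < 1] *)
Let psi_upper k : psi k ^+ 2 + psi k.+1 ^+ 2 <= inv 0 / (1 - `|t|).
Proof.
rewrite ler_pdivlMr ?subr_gt0 // -(inv_const k) /inv.
have h : 2 * t * psi k * psi k.+1 <= `|t| * (psi k ^+ 2 + psi k.+1 ^+ 2).
  exact: le_trans (ler_norm _) (cross_bound _ _ _).
by lra.
Qed.

Let psi_lower k : inv 0 / 2 <= psi k ^+ 2 + psi k.+1 ^+ 2.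
Proof.
rewrite ler_pdivrMr // -(inv_const k) /inv.
have h : - (2 * t * psi k * psi k.+1) <= `|t| * (psi k ^+ 2 + psi k.+1 ^+ 2).
  apply: le_trans (ler_norm _) _; rewrite normrN; exact: cross_bound.
have h2 : `|t| * (psi k ^+ 2 + psi k.+1 ^+ 2) <= psi k ^+ 2 + psi k.+1 ^+ 2.
  by rewrite ler_piMl ?addr_ge0 ?sqr_ge0 // ltW.
by lra.
Qed.

Definition tphi n k : R := if (k <= n)%N then (sph R d k).[t] else 0.

Definition radial_norm2 (a : nat -> R) N : R := \sum_(u <- tball d N) a (height u) ^+ 2.

(** The sphere of radius k has at least s^(2 k) vertices, so the norm dominates the sum of the
    psi^2. Each pair of consecutive terms contributes at least half of [inv 0]; the odd radius makes
    the number of terms even. *)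
Lemma tphi_norm_lower n N : (n.*2.+3 < N)%N ->
  n.+1%:R * (inv 0 / 2) <= radial_norm2 (tphi n.*2.+1) N.
Proof.
move=> nN; rewrite /radial_norm2 (ball_sum_height d (fun k => tphi n.*2.+1 k ^+ 2)).
apply: le_trans (_ : \sum_(k < n.*2.+2) psi k ^+ 2 <= _).
  elim: n {nN} => [|n IH]; first by rewrite mul1r big_ord_recr big_ord1 /=; exact: psi_lower.
  rewrite doubleS 2!big_ord_recr /= -natr1 mulrDl mul1r -addrA lerD //; exact: psi_lower.
have cw k : (k < n.*2.+2)%N -> psi k ^+ 2 <= sphere_card d R N k * tphi n.*2.+1 k ^+ 2.
  move=> kn; rewrite /tphi -ltnS kn -/(phi k) /psi exprMn ler_wpM2r ?sqr_ge0 //.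
  case: k kn => [|k] kn; first by rewrite sphere_card0 expr0 expr1n.
  rewrite sphere_cardE; last by lia.
  rewrite exprAC s2 exprS ler_wpM2r ?exprn_ge0 ?(ltW (d1_gt0 R hd)) //.
  by rewrite lerBlDr lerDl.
have h : (n.*2.+2 <= N.+1)%N by lia.
rewrite (big_ord_widen _ (fun k => psi k ^+ 2) h) big_mkcond; apply: ler_sum => k _.
case: ifP => [/cw //|_]; rewrite mulr_ge0 ?sqr_ge0 //.
by apply: sumr_ge0 => u _; rewrite ler0n.
Qed.

(** The truncation satisfies the eigenvalue equation except at heights n + 1 and n + 2, where the
    sphere sizes turn the defect into multiples of psi^2, bounded independently of n by the
    conserved form. *)
Lemma tphi_defect : exists B : R, forall n N, (n.+3 < N)%N ->
  radial_norm2 (fun k => tstep d (tphi n.+1) k - t * tphi n.+1 k) N <= B.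
Proof.
(* The two exceptional spheres contribute exactly d / (4 s^2) times psi(n + 2)^2 and psi(n +
   1)^2. *)
exists (d%:R / (4 * s ^+ 2) * (inv 0 / (1 - `|t|))) => n N nN.
rewrite /radial_norm2 (ball_sum_height d (fun k => (tstep d (tphi n.+1) k - t * tphi n.+1 k) ^+ 2)).
have kE : kap R d = 2 * s by [].
have ts k : tstep d phi k = t * phi k by have /(congr1 (@^~ k)) := tstep_horner hd t.
have sub k : (k <= n)%N -> tstep d (tphi n.+1) k = t * tphi n.+1 k.
  move=> kn; rewrite {2}/tphi leqW // -/(phi k) -ts.
  case: k kn => [|k] kn; rewrite /tstep /tphi //.
  by rewrite ltnS kn (leqW (ltnW kn)).
have top1 : tstep d (tphi n.+1) n.+1 - t * tphi n.+1 n.+1 = - (s / 2 * phi n.+2).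
  rewrite {2}/tphi leqnn -/(phi n.+1) -ts /tstep /tphi ltnn leqnSn -!/(phi _) kE -s2.
  by field; rewrite gt_eqF.
have top2 : tstep d (tphi n.+1) n.+2 - t * tphi n.+1 n.+2 = phi n.+1 / (2 * s).
  rewrite {2}/tphi ltnn mulr0 subr0 /tstep /tphi leqnn -!/(phi _) kE.
  have -> : (n.+3 <= n.+1)%N = false by lia.
  by rewrite mulr0 add0r.
have top3 k : (n.+2 < k)%N -> tstep d (tphi n.+1) k - t * tphi n.+1 k = 0.
  case: k => [//|k] kn; rewrite /tstep /tphi !ifF ?mulr0 ?addr0 ?mul0r ?subr0 //; lia.
pose F k := sphere_card d R N k * (tstep d (tphi n.+1) k - t * tphi n.+1 k) ^+ 2.
have h : (n.+3 <= N.+1)%N by lia.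
have -> : \sum_(k < N.+1) F k = \sum_(k < n.+3) F k.
  rewrite (big_ord_widen _ F h) [RHS]big_mkcond; apply: eq_bigr => k _.
  by case: ltnP => // kn; rewrite /F top3 ?expr0n ?mulr0.
rewrite !big_ord_recr /= big1 ?add0r; last first.
  by move=> k _; rewrite /F sub ?subrr ?expr0n ?mulr0 // ltnW.
rewrite {1}/F sub // subrr expr0n mulr0 add0r /F top1 top2 !sphere_cardE; [|lia..].
apply: le_trans (_ : d%:R / (4 * s ^+ 2) * (psi n.+1 ^+ 2 + psi n.+2 ^+ 2) <= _); last first.
  by rewrite ler_wpM2l ?psi_upper // divr_ge0 ?mulr_ge0 ?sqr_ge0 // ltW.
rewrite le_eqVlt; apply/orP; left; apply/eqP.
have e1 : (d%:R - 1) ^+ n = (s ^+ n) ^+ 2 :> R by rewrite -s2 exprAC.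
rewrite /psi (exprS _ n) e1 -s2 (exprS s n.+1) (exprS s n).
by move: (s ^+ n) (phi n.+1) (phi n.+2) => x y z; field; rewrite gt_eqF.
Qed.

Lemma tphi_norm_infty (C : R) : exists n0, forall n N, (n0 <= n)%N -> (n.*2.+3 < N)%N ->
  C <= radial_norm2 (tphi n.*2.+1) N.
Proof.
exists (Num.truncn (C / (inv 0 / 2))) => n N nn nN; apply: le_trans (tphi_norm_lower nN).
rewrite -ler_pdivrMr ?divr_gt0 //; apply/ltW.
by apply: lt_le_trans (truncnS_gt _) _; rewrite ler_nat ltnS.
Qed.

End TruncatedSpherical.

(** * Factors with a prescribed atomic spectrum *)

Section AlmostEigenvectors.
Variables (R : realType) (d : nat).
Hypothesis hd : (2 <= d)%N.
Notation Om := (labelling R d).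
Variable P : probability Om R.
Hypothesis HP : is_lebesgue_product P.
Notation M := (@Mop R d).

Lemma iter_Mop_sym f g k : sqint P f -> sqint P g ->
  ip P f (iter k M g) = ip P (iter k M f) g.
Proof.
move=> sf sg; elim: k f sf => [//|k IH] f sf.
rewrite iterS -(Mop_sym HP) //; last exact: iter_Mop_sqint.
by rewrite IH ?iterSr //; exact: Mop_sqint.
Qed.

Lemma iter_Mop_norm g k : sqint P g ->
  ip P (iter k M g) (iter k M g) <= (d%:R / kap R d) ^+ 2 ^+ k * ip P g g.
Proof.
move=> sg; set C := d%:R / kap R d.
have C0 : 0 < C by rewrite divr_gt0 ?kap_gt0 // d_gt0.
have one h : sqint P h -> ip P (M h) (M h) <= C ^+ 2 * ip P h h.
  move=> sh; have sMh := Mop_sqint HP sh.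
  have Ci : 0 < C^-1 by rewrite invr_gt0.
  have := ip_Mop_bound hd HP Ci sMh sh; rewrite ger0_norm ?ip_ge0 // -/C invrK.
  rewrite (_ : C * _ = ip P (M h) (M h) / 2 + C ^+ 2 * ip P h h / 2); last first.
    by field; rewrite gt_eqF.
  by lra.
elim: k => [|k IH]; first by rewrite expr0 mul1r.
rewrite iterS; apply: le_trans (one _ (iter_Mop_sqint HP k sg)) _.
by rewrite (exprS _ k) -mulrA ler_wpM2l ?sqr_ge0.
Qed.

(** The quotient at k + 1 differs from t times the quotient at k by <M^k r, (M - t) r> / <r, r>; the
    numerator grows at most like the square root of the denominator, which tends to infinity. *)
Lemma almost_eigenvector (r : nat -> Om -> R) (t B : R) k : (forall n, sqint P (r n)) ->
  (forall C, exists n0, forall n, (n0 <= n)%N -> C <= ip P (r n) (r n)) ->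
  (forall n, ip P (fun w => M (r n) w - t * r n w) (fun w => M (r n) w - t * r n w) <= B) ->
  (fun n => ip P (r n) (iter k M (r n)) / ip P (r n) (r n)) @ \oo --> t ^+ k.
Proof.
move=> sr rinf rB; have B0 : 0 <= B by apply: le_trans (rB 0%N); exact: ip_ge0.
elim: k => [|k IH].
  rewrite expr0; apply: cvg_near_cst; have [n0 hn0] := rinf 1; exists n0 => // n nn.
  by rewrite /= divff // gt_eqF // (lt_le_trans ltr01 (hn0 n nn)).
pose D n := ip P (r n) (iter k.+1 M (r n)) / ip P (r n) (r n) -
            t * (ip P (r n) (iter k M (r n)) / ip P (r n) (r n)).
have cD : D @ \oo --> (0 : R).
  apply/cvgrPdist_le => e e0; pose C := (d%:R / kap R d) ^+ 2 ^+ k.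
  have C0 : 0 <= C by rewrite exprn_ge0 // sqr_ge0.
  (* This parameter makes the first half of the arithmetic-geometric bound at most e V; the second
     half is so once V exceeds B / (x e). *)
  pose x := e / (C + 1); have C1 : 0 < C + 1 by lra.
  have x0 : 0 < x by rewrite divr_gt0.
  have [n0 hn0] := rinf (B / (x * e) + 1); exists n0 => // n nn /=.
  rewrite sub0r normrN; set V := ip P (r n) (r n).
  have V1 : B / (x * e) + 1 <= V by exact: hn0.
  have V0 : 0 < V.
    by apply: lt_le_trans V1; rewrite ltr_wpDl // divr_ge0 // mulr_ge0 // ltW.
  have sk := iter_Mop_sqint HP k (sr n); have sM := Mop_sqint HP (sr n).
  have str := sqintZ t (sr n).
  have -> : D n = ip P (iter k M (r n)) (fun w => M (r n) w - t * r n w) / V.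
    rewrite ipBr // ipZr // /D iterSr (iter_Mop_sym k (sr n) sM) ipC.
    by rewrite [ip P (r n) (iter k M (r n))]ipC [ip P (M (r n)) _]ipC; ring.
  rewrite normrM normfV (gtr0_norm V0) ler_pdivrMr //.
  apply: le_trans (ip_amgm x0 sk (sqintB sM str)) _.
  have h1 : x * ip P (iter k M (r n)) (iter k M (r n)) <= e * V.
    apply: le_trans (_ : x * (C * V) <= _).
      by rewrite ler_wpM2l ?(ltW x0) //; exact: iter_Mop_norm.
    rewrite mulrA ler_wpM2r ?(ltW V0) // /x mulrAC ler_pdivrMr // ler_wpM2l ?(ltW e0) //.
    by rewrite lerDl.
  have h2 : x^-1 * ip P (fun w => M (r n) w - t * r n w) (fun w => M (r n) w - t * r n w) <= e * V.
    apply: le_trans (_ : x^-1 * B <= _); first by rewrite ler_wpM2l ?invr_ge0 ?(ltW x0).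
    have : B / (x * e) <= V by lra.
    have xe0 : 0 < x * e by exact: mulr_gt0.
    rewrite ler_pdivrMr // => h.
    by rewrite mulrC ler_pdivrMr // (le_trans h) // le_eqVlt; apply/orP; left; apply/eqP; ring.
  by lra.
have -> : (fun n => ip P (r n) (iter k.+1 M (r n)) / ip P (r n) (r n)) =
    (fun n => D n + t * (ip P (r n) (iter k M (r n)) / ip P (r n) (r n))).
  by apply/funext => n; rewrite /D; ring.
rewrite exprS -[X in _ --> X]add0r; apply: cvgD => //.
by apply: cvgMl_tmp.
Qed.

End AlmostEigenvectors.

(** * Radial linear factors *)

Section RadialFactors.
Variables (R : realType) (d : nat).
Hypothesis hd : (2 <= d)%N.
Notation Om := (labelling R d).
Variable P : probability Om R.
Hypothesis HP : is_lebesgue_product P.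
Variable J : nat.
Hypothesis J0 : (0 < J)%N.
Notation M := (@Mop R d).

Let piece (k : nat) : set R := `[k%:R / J.*2%:R, k.+1%:R / J.*2%:R[%classic.

Let J2 : 0 < J.*2%:R :> R.
Proof. by rewrite ltr0n double_gt0. Qed.

Let piece_measurable k : measurable (piece k).
Proof. exact: measurable_itv. Qed.

Let piece_mass k : (k < J.*2)%N -> unif_mass (piece k) = J.*2%:R^-1.
Proof.
move=> kJ; apply: EFin_inj; rewrite -uniform_mass //.
apply: eq_trans (uniform_prob_itv _ _ _) _.
- by rewrite divr_ge0.
- by rewrite ler_pM2r ?invr_gt0 // ler_nat.
- by rewrite ler_pdivrMr // mul1r ler_nat.
- by congr EFin; rewrite -natr1; field; rewrite gt_eqF.
Qed.

Let piece_disj k l x : k != l -> piece k x -> piece l x -> False.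
Proof.
wlog kl : k l / (k < l)%N => [H|].
  case: (ltngtP k l) => [h _ a b|h _ a b|-> /eqP//].
    by apply: (H k l) => //; rewrite neq_ltn h.
  by apply: (H l k) => //; rewrite neq_ltn h.
move=> _; rewrite /piece /= !in_itv /= => /andP[_ a] /andP[b _].
have h : k.+1%:R / J.*2%:R <= l%:R / J.*2%:R :> R.
  by rewrite ler_pM2r ?invr_gt0 // ler_nat.
by have := lt_le_trans (le_lt_trans b a) h; rewrite ltxx.
Qed.

(** One noise per atom: [0, 1[ is cut into 2 J equal pieces, and each noise is a difference of
    indicators of two of them. The means cancel, and distinct noises have disjoint supports, so they
    are orthogonal at a common vertex; the centred form gives orthogonality at distinct vertices. *)
Definition unit_noise (j : 'I_J) (u : tree d) (w : Om) : R :=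
  centered u (piece j.*2) w - centered u (piece j.*2.+1) w.

Let j1 (j : 'I_J) : (j.*2 < J.*2)%N. Proof. by rewrite ltn_double. Qed.
Let j2 (j : 'I_J) : (j.*2.+1 < J.*2)%N. Proof. by rewrite -doubleS leq_double. Qed.

Lemma unit_noiseE j u w :
  unit_noise j u w = \1_(piece j.*2) (val (w u)) - \1_(piece j.*2.+1) (val (w u)).
Proof. by rewrite /unit_noise /centered !piece_mass //; ring. Qed.

Lemma unit_noise_sqint j u : sqint P (unit_noise j u).
Proof. by apply: sqintB; exact: centered_sqint. Qed.

Lemma centered_orth u v (B C : set R) : u != v -> measurable B -> measurable C ->
  ip P (centered u B) (centered v C) = 0.
Proof. by move=> uv mB mC; apply: centered_indep => //; apply: cyl_centered; rewrite 1?eq_sym. Qed.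

Lemma unit_noise_ip j k u v : ip P (unit_noise j u) (unit_noise k v) =
  if (j == k) && (u == v) then J%:R^-1 else 0.
Proof.
have sc v' B : measurable B -> sqint P (centered v' B) by move=> mB; exact: centered_sqint.
have [uv|uv] := eqVneq u v; last first.
  have sj := sc u _ (piece_measurable j.*2); have sj' := sc u _ (piece_measurable j.*2.+1).
  have sk := sc v _ (piece_measurable k.*2); have sk' := sc v _ (piece_measurable k.*2.+1).
  rewrite andbF (ipBl sj sj' (unit_noise_sqint k v)) (ipBr sj sk sk') (ipBr sj' sk sk').
  by rewrite !centered_orth // !subrr.
subst v; rewrite andbT; case: eqVneq => [<-|jk]; last first.
  rewrite /ip (@eq_Rintegral _ _ _ _ _ (fun=> 0)) ?Rintegral_cst ?mul0r // => w _.
  rewrite !unit_noiseE; have D (a b : nat) : a != b -> \1_(piece a) (val (w u)) * \1_(piece b) (val (w u)) = 0 :> R.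
    move=> ab; rewrite indicI_mul (_ : _ `&` _ = set0) ?indic0 //.
    by apply/seteqP; split=> // x [h1 h2]; exact: (piece_disj ab h1 h2).
  have jk' : val j != val k by [].
  rewrite mulrBl !mulrBr !D ?subrr //; apply/eqP => e; move/eqP: jk'; apply => /=; lia.
have mI k' : measurable ([set w | piece k' (val (w u))] : set Om) by exact: cylinder_measurable.
have mass k' : (k' < J.*2)%N -> \int[P]_w (\1_(piece k') (val (w u)) : R) = J.*2%:R^-1.
  move=> kJ; rewrite -(piece_mass kJ).
  under eq_Rintegral do rewrite indic_coord.
  rewrite Rintegral_indicE; last exact: rect_measurable.
  rewrite (_ : fine _ = fine (unif_mass (piece k'))%:E) //; congr fine.
  by rewrite (product_rect HP) // big_seq1.
have int k' : P.-integrable setT (EFin \o (fun w : Om => \1_(piece k') (val (w u)) : R)).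
  apply: (@bounded_integrable _ _ _ _ _ _ 1) => //.
    by apply: measurableT_comp (@coord_measurable R d u); exact: measurable_indic.
  by move=> w; rewrite indicE; case: (_ \in _); rewrite ?normr1 ?normr0.
transitivity (\int[P]_w (\1_(piece j.*2) (val (w u)) + \1_(piece j.*2.+1) (val (w u)) : R)).
  apply: eq_Rintegral => w _; rewrite unit_noiseE.
  have ne : j.*2 != j.*2.+1 by rewrite neq_ltn ltnSn.
  rewrite !indicE; case h1: (_ \in piece j.*2); case h2: (_ \in piece j.*2.+1) => /=; try ring.
  by case: (piece_disj ne (set_mem h1) (set_mem h2)).
rewrite RintegralD // !mass //.
by rewrite -muln2 natrM; field; rewrite pnatr_eq0 -lt0n.
Qed.

Lemma unit_noise_mean j u : \int[P]_w unit_noise j u w = 0.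
Proof.
have := @centered_indep _ _ P HP u _ (cst 1) (piece_measurable j.*2) (cyl_cst u 1).
have := @centered_indep _ _ P HP u _ (cst 1) (piece_measurable j.*2.+1) (cyl_cst u 1).
rewrite /ip; under eq_Rintegral do rewrite mulr1; move=> h2.
under eq_Rintegral do rewrite mulr1; move=> h1.
by rewrite RintegralB ?h1 ?h2 ?subrr //; apply: sqint_integrable; exact: centered_sqint.
Qed.

Lemma unit_noise_relabel j u a w : unit_noise j u (relabel a w) = unit_noise j (a u) w.
Proof. by []. Qed.

Definition radial (j : 'I_J) (a : nat -> R) (n : nat) (w : Om) : R :=
  \sum_(u <- tball d n) a (height u) * unit_noise j u w.

Lemma radial_sqint j a n : sqint P (radial j a n).
Proof.
apply: (@sqint_sum _ _ _ _ _ _ (fun u w => a (height u) * unit_noise j u w)) => u.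
by apply: sqintZ; exact: unit_noise_sqint.
Qed.

Lemma radial_widen j a n N w : (n <= N)%N -> (forall k, (n < k)%N -> a k = 0) ->
  radial j a N w = radial j a n w.
Proof.
move=> nN a0; apply: (ball_sum_filter nN) => u nu.
by rewrite a0 // mul0r.
Qed.

Lemma tstep_support (a : nat -> R) n : (forall k, (n < k)%N -> a k = 0) ->
  forall k, (n.+1 < k)%N -> tstep d a k = 0.
Proof.
move=> a0 [//|k] nk; rewrite /tstep !a0 ?mulr0 ?addr0 ?mul0r //; lia.
Qed.

(** Translating the labels by an involution amounts to translating the coefficients, so M acts on
    radial coefficients by [tstep]; the sums are taken over a ball that contains all the
    supports. *)
Lemma radial_Mop j a n : (forall k, (n < k)%N -> a k = 0) ->
  M (radial j a n) =1 radial j (tstep d a) n.+1.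
Proof.
move=> a0 w; rewrite -(@radial_widen j (tstep d a) n.+1 n.+2) //; last exact: tstep_support.
rewrite /Mop; under eq_bigr do rewrite -(@radial_widen j a n n.+2) ?leqW //.
rewrite /radial (eq_bigr (fun i : 'I_d => \sum_(u <- tball d n.+2)
   a (height (rmul i u)) * unit_noise j u w)); last first.
  move=> i _; pose F u := a (height (rmul i u)) * unit_noise j u w.
  rewrite -(@ball_sum_rmul _ _ F n.+1 n.+2 i) //; last first.
    move=> u nu; rewrite /F a0 ?mul0r //.
    have := height_rmul_le i (rmul i u); rewrite rmulK; lia.
  by apply: eq_bigr => u _; rewrite /F rmulK unit_noise_relabel.
rewrite exchange_big mulr_sumr /=; apply: eq_bigr => u _.
rewrite -mulr_suml (height_rmul_sum a) mulrA; congr (_ * _).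
by rewrite /tstep; case: (height u) => [|m]; rewrite mulrC.
Qed.

Lemma radial_iter j a n k : (forall m, (n < m)%N -> a m = 0) ->
  iter k M (radial j a n) = radial j (iter k (@tstep R d) a) (n + k) /\
  forall m, (n + k < m)%N -> iter k (@tstep R d) a m = 0.
Proof.
move=> a0; elim: k => [|k [IH1 IH2]]; first by rewrite addn0.
rewrite !iterS IH1 addnS; split; first by apply/funext => w; rewrite radial_Mop.
by move=> m; apply: tstep_support.
Qed.

Lemma radial_ip j k a b n m : ip P (radial j a n) (radial k b m) =
  if j == k then J%:R^-1 * \sum_(u <- tball d n) (if (height u <= m)%N then a (height u) * b (height u) else 0)
  else 0.
Proof.
have s1 j' (c : R) u : sqint P (fun w => c * unit_noise j' u w).
  by apply: sqintZ; exact: unit_noise_sqint.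
rewrite (@ip_suml _ _ _ _ _ _ (fun u w => a (height u) * unit_noise j u w)) //; last exact: radial_sqint.
have e u : ip P (fun w => a (height u) * unit_noise j u w) (radial k b m) =
    if j == k then J%:R^-1 * (if (height u <= m)%N then a (height u) * b (height u) else 0) else 0.
  rewrite (@ip_sumr _ _ _ _ _ _ (fun u w => b (height u) * unit_noise k u w)) //.
  under eq_bigr => v _.
    rewrite ipZl ?ipZr //; [|exact: unit_noise_sqint..].
    rewrite unit_noise_ip; over.
  case: (j == k) => /=; last by rewrite big1 // => v _; rewrite !mulr0.
  rewrite -mem_tball; have [um|um] := boolP (u \in tball d m).
    rewrite (bigD1_seq u) ?tball_uniq //= eqxx big1 ?addr0; first by ring.
    by move=> v vu; rewrite eq_sym (negPf vu) !mulr0.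
  rewrite mulr0 big_seq big1 // => v vm; case: eqVneq => [uv|_]; last by rewrite !mulr0.
  by move: um; rewrite uv vm.
under eq_bigr do rewrite e.
by case: (j == k); [rewrite mulr_sumr|rewrite big1].
Qed.

Lemma radial_orth j k a b n m : j != k -> ip P (radial j a n) (radial k b m) = 0.
Proof. by move=> jk; rewrite radial_ip (negPf jk). Qed.

Lemma radial_norm j a n N : (n <= N)%N -> (forall k, (n < k)%N -> a k = 0) ->
  ip P (radial j a n) (radial j a n) = J%:R^-1 * radial_norm2 d a N.
Proof.
move=> nN a0; rewrite radial_ip eqxx; congr (_ * _).
rewrite /radial_norm2 (ball_sum_filter (phi := fun u => a (height u) ^+ 2) nN); last first.
  by move=> u nu; rewrite a0 // expr0n.
by rewrite !big_seq; apply: eq_bigr => u; rewrite mem_tball => ->; rewrite expr2.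
Qed.

Lemma radial_mean j a n : \int[P]_w radial j a n w = 0.
Proof.
rewrite /radial (@Rintegral_sumr _ _ _ _ _ _ _ (fun u w => a (height u) * unit_noise j u w)) //; last first.
  by move=> u; apply: sqint_integrable; apply: sqintZ; exact: unit_noise_sqint.
apply: big1 => u _; rewrite RintegralZl ?unit_noise_mean ?mulr0 //.
by apply: sqint_integrable; exact: unit_noise_sqint.
Qed.

Lemma radial_invariant j a n (b : tree d -> tree d) w : tree_aut b -> b (tree_root d) = tree_root d ->
  radial j a n (w \o b) = radial j a n w.
Proof.
move=> ab b0; have hb u := height_aut u ab b0.
have [b' [_ bb' b'b]] := tree_aut_inv ab.
rewrite /radial -(@ball_sum_aut _ _ (fun u => a (height u) * unit_noise j u w) n b) //.
- by apply: eq_bigr => u _; rewrite hb.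
- exact: can_inj bb'.
- by move=> u; exists (b' u).
Qed.

End RadialFactors.

(** * Convex combinations of atoms *)

Section AtomicMeasures.
Variables (R : realType) (d : nat).
Hypothesis hd : (2 <= d)%N.
Notation Om := (labelling R d).
Notation M := (@Mop R d).

Lemma iter_MopZ (a : R) (g : Om -> R) k :
  iter k M (fun w => a * g w) =1 fun w => a * iter k M g w.
Proof.
move=> w; have := iter_Mop_lin a (fun _ : 'I_1 => g) k w.
rewrite big_ord1 => <-; congr (iter k M _ w).
by apply/funext => v; rewrite big_ord1.
Qed.

Section Fixed.
Variable P : probability Om R.
Hypothesis HP : is_lebesgue_product P.
Variable J : nat.
Hypothesis J0 : (0 < J)%N.
Variables w t : 'I_J -> R.
Hypotheses (w0 : forall j, 0 <= w j) (w1 : \sum_j w j = 1) (t1 : forall j, `|t j| < 1).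

Let r (j : 'I_J) n : Om -> R := radial j (tphi d (t j) n.*2.+1) n.*2.+1.

Let tphi0 j n k : (n.*2.+1 < k)%N -> tphi d (t j) n.*2.+1 k = 0.
Proof. by move=> h; rewrite /tphi leqNgt h. Qed.

Let r_sqint j n : sqint P (r j n).
Proof. exact: radial_sqint. Qed.

Let r_infty j C : exists n0, forall n, (n0 <= n)%N -> C <= ip P (r j n) (r j n).
Proof.
have [n0 hn0] := tphi_norm_infty hd (t1 j) (C * J%:R).
exists n0 => n nn; rewrite (@radial_norm _ _ hd _ HP _ J0 _ _ _ n.*2.+4) //; last 2 first.
- by rewrite ltnS; lia.
- by move=> k; exact: tphi0.
by rewrite mulrC ler_pdivlMr ?ltr0n //; apply: hn0.
Qed.

Let r_defect j : exists B, forall n,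
  ip P (fun x => M (r j n) x - t j * r j n x) (fun x => M (r j n) x - t j * r j n x) <= B.
Proof.
have [B hB] := tphi_defect hd (t1 j); exists (J%:R^-1 * B) => n.
pose a k := tstep d (tphi d (t j) n.*2.+1) k - t j * tphi d (t j) n.*2.+1 k.
have e x : M (r j n) x - t j * r j n x = radial j a n.*2.+2 x.
  rewrite /r radial_Mop //; last by move=> k; exact: tphi0.
  rewrite -(@radial_widen _ _ _ j _ n.*2.+1 n.*2.+2) ?leqnSn //; last by move=> k; exact: tphi0.
  by rewrite /radial mulr_sumr -sumrB; apply: eq_bigr => u _; rewrite /a; ring.
have nn : (n.*2.+2 <= n.*2.+4)%N by lia.
have a0 k : (n.*2.+2 < k)%N -> a k = 0.
  move=> nk; rewrite /a (tstep_support hd J0 (@tphi0 j n)) //.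
  by rewrite tphi0 ?mulr0 ?subrr // ltnW.
rewrite (eq_ip P e e) (radial_norm hd HP J0 j nn a0).
by rewrite ler_wpM2l ?invr_ge0 //; exact: hB.
Qed.

Let eigen_noises : exists s : 'I_J -> nat -> Om -> R,
  [/\ forall j n, sqint P (s j n), forall j n, 0 < ip P (s j n) (s j n),
      forall i j k n, i != j -> ip P (s i n) (iter k M (s j n)) = 0,
      forall j n, root_invariant (s j n) /\ \int[P]_x s j n x = 0 &
      forall j k, (fun n => ip P (s j n) (iter k M (s j n)) / ip P (s j n) (s j n)) @ \oo -->
        t j ^+ k].
Proof.
have [n0 hn0] := choice (fun j => r_infty j 1).
(* A common shift of the index makes all squared norms at least 1, so that the quotients make sense
   for every [n]. *)
pose n1 := (\max_j n0 j)%N.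
exists (fun j n => r j (n + n1)%N); split.
- by move=> j n; exact: r_sqint.
- move=> j n; apply: (lt_le_trans ltr01); apply: hn0.
  by apply: leq_trans (leq_addl _ _); exact: (leq_bigmax j).
- move=> i j k n ij; have [-> _] := radial_iter hd J0 j k (@tphi0 j (n + n1)%N).
  exact: (radial_orth hd HP J0).
- move=> j n; split; last exact: (radial_mean HP).
  by move=> a aa a0 x; exact: (radial_invariant _ _ _ _ aa a0).
- move=> j k; have [B hB] := r_defect j.
  apply: (@almost_eigenvector _ _ hd _ HP _ _ B) => [n|C|n]; [exact: r_sqint| |exact: hB].
  have [m hm] := r_infty j C; exists m => n mn; apply: hm.
  exact: leq_trans mn (leq_addr _ _).
Qed.

(** M changes the coefficients of a radial factor but not its noise, so the cross terms vanish and
    the moments of the sum are weighted averages of those of the summands. *)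
Lemma atomic_approximation : exists f : nat -> Om -> R,
  [/\ forall n, sqint P (f n), forall n, root_invariant (f n),
      forall n, \int[P]_x f n x = 0, forall n, ip P (f n) (f n) = 1 &
      forall k, (fun n => ip P (f n) (iter k M (f n))) @ \oo --> \sum_j w j * t j ^+ k].
Proof.
have [s [ss V0 so si sc]] := eigen_noises.
(* Amplitudes giving the [j]-th summand the squared norm [w j], for a total of 1. *)
have [b b2] : exists b : 'I_J -> nat -> R, forall j n, b j n ^+ 2 = w j / ip P (s j n) (s j n).
  exists (fun j n => Num.sqrt (w j / ip P (s j n) (s j n))) => j n.
  by rewrite sqr_sqrtr // divr_ge0 // ltW.
have sM k j n : sqint P (iter k M (s j n)) by exact: iter_Mop_sqint.
have sg j n : sqint P (fun x => b j n * s j n x) by exact: sqintZ.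
pose f n x := \sum_j b j n * s j n x.
have ipf k n : ip P (f n) (iter k M (f n)) =
    \sum_j w j * (ip P (s j n) (iter k M (s j n)) / ip P (s j n) (s j n)).
  have e : iter k M (f n) = fun x => \sum_j b j n * iter k M (s j n) x.
    apply/funext => x; transitivity (iter k M (fun x => 1 * f n x) x).
      by congr (iter k M _ x); apply/funext => y; rewrite mul1r.
    rewrite iter_Mop_lin mul1r; apply: eq_bigr => j _; exact: iter_MopZ.
  rewrite e (@ip_suml _ _ _ _ _ _ (fun j x => b j n * s j n x)) //; last first.
    apply: (@sqint_sum _ _ _ _ _ _ (fun j x => b j n * iter k M (s j n) x)) => j.
    exact: sqintZ.
  apply: eq_bigr => j _.
  rewrite (@ip_sumr _ _ _ _ _ _ (fun i x => b i n * iter k M (s i n) x)) //; last first.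
    by move=> i; exact: sqintZ.
  have term i : ip P (fun x => b j n * s j n x) (fun x => b i n * iter k M (s i n) x) =
      b j n * (b i n * ip P (s j n) (iter k M (s i n))).
    by rewrite (ipZl (b j n) (ss j n) (sqintZ (b i n) (sM k i n))) (ipZr (b i n) (ss j n) (sM k i n)).
  rewrite (eq_bigr _ (fun i _ => term i)) (bigD1 j) //= big1 ?addr0 => [|i ij].
    by rewrite mulrA -expr2 b2; ring.
  by rewrite so ?mulr0 // eq_sym.
exists f; split=> [n|n|n|n|k].
- exact: (@sqint_sum _ _ _ _ _ _ (fun j x => b j n * s j n x)).
- move=> a aa a0 x; rewrite /f; apply: eq_bigr => j _.
  by have [-> //] := si j n.
- rewrite /f (@Rintegral_sumr _ _ _ _ _ _ _ (fun j x => b j n * s j n x)) //; last first.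
    by move=> j; exact: sqint_integrable.
  apply: big1 => j _; rewrite RintegralZl //; last exact: (sqint_integrable (ss j n)).
  by have [_ ->] := si j n; rewrite mulr0.
- rewrite (ipf 0%N) -[RHS]w1; apply: eq_bigr => j _.
  by rewrite /= divff ?mulr1 // gt_eqF.
- under eq_fun do rewrite ipf.
  by apply: cvg_sumr => j; apply: cvgMl_tmp; exact: sc.
Qed.

End Fixed.

(** Each correlation is a fixed finite combination of moments, with the coefficients of [sph], so
    convergence of the moments is convergence of the correlations. *)
Lemma atomic_closure J (w t : 'I_J -> R) : (forall j, 0 <= w j) -> \sum_j w j = 1 ->
  (forall j, `|t j| < 1) ->
  closure (fiid_correlations R d : set {ptws nat -> R})
    (fun n => \sum_j w j * (sph R d n.+1).[t j]).
Proof.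
move=> w0 w1 t1; have J0 : (0 < J)%N.
  by case: J w t w0 w1 t1 => // w t _ /eqP; rewrite big_ord0 eq_sym oner_eq0.
have [P HP] := lebesgue_product_exists R d.
have [f [sf ri f0 f1 fc]] := atomic_approximation HP J0 w0 w1 t1.
have f1' n : 0 < ip P (f n) (f n) by rewrite f1.
have ex n : exists c, fiid_correlations R d c /\
    forall k, ip P (f n) (iter k M (f n)) = mom d (ext1 c) k.
  have [c hc e] := fiid_intro hd HP (sf n) (ri n) (f0 n) (f1' n).
  by exists c; split=> // k; rewrite e f1 mul1r.
have [c hc] := choice ex.
apply: (@closure_seq _ _ c); first by move=> n; case: (hc n).
move=> n; have cE m : c m n = Lc d (ext1 (c m)) (sph R d n.+1) by rewrite Lc_sph.
have -> : c ^~ n = fun m => \sum_(i < size (sph R d n.+1)) (sph R d n.+1)`_i *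
    ip P (f m) (iter i M (f m)).
  by apply/funext => m; rewrite cE; apply: eq_bigr => i _; case: (hc m) => _ ->.
have -> : \sum_j w j * (sph R d n.+1).[t j] =
    \sum_(i < size (sph R d n.+1)) (sph R d n.+1)`_i * \sum_j w j * t j ^+ i.
  under eq_bigr do rewrite horner_coef mulr_sumr.
  rewrite exchange_big; apply: eq_bigr => i _ /=; rewrite mulr_sumr.
  by apply: eq_bigr => j _; ring.
by apply: cvg_sumr => i; apply: cvgMl_tmp; exact: fc.
Qed.

End AtomicMeasures.

Lemma X_set_closure (R : realType) (d : nat) (x : nat -> R) : (2 <= d)%N ->
  X_set R d x -> closure (fiid_correlations R d : set {ptws nat -> R}) x.
Proof.
move=> hd /(X_set_haus hd) hx; have c0 : ext1 x 0%N = 1 by [].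
(* The atomic approximations are themselves only limits of correlation sequences, so [x] is reached
   in the closure of the closure. *)
have /closure_id -> := @closed_closure _ (fiid_correlations R d : set {ptws nat -> R}).
pose a N n := \sum_(j < N.+1) bweight d (ext1 x) N j * (sph R d n.+1).[2 * bnode R N j - 1].
apply: (@closure_seq _ _ a) => [N|n].
  apply: (atomic_closure hd) => [j||j].
  - exact: bweight_ge0.
  - exact: (@bweight_sum R d _ c0).
  - have h0 := bnode_gt0 R N j; have h1 : bnode R N j < 1 by apply: bnode_lt1; rewrite -ltnS.
    by rewrite ltr_norml; apply/andP; split; lra.
rewrite -[x n]/(ext1 x n.+1) -(Lc_sph hd (ext1 x) n.+1).
exact: (bpoly_cvg hd hx c0).
Qed.

Theorem theorem5p1 (R : realType) (d : nat) (hd : (2 <= d)%N) :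
  closure (fiid_correlations R d : set {ptws nat -> R}) = X_set R d.
Proof.
apply/seteqP; split=> x; last exact: X_set_closure.
by move=> /(haus_closure (fiid_haus hd)) /(haus_X_set hd).
Qed.
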